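(* For $1\le p<\infty$, $$\mathfrak{K}_p^{\mathcal{P}-dual}=(\mathfrak{N}_p\circ\mathcal{P})^{inj},$$ and for $1<p\le\infty$, with $\frac1p+\frac1{p^*}=1$, $$\mathcal{D}_p^{\mathcal{P}-dual}=(\mathfrak{I}_{p^*}\circ\mathcal{P})^{inj}.$$
   Context: All Banach spaces are over $\mathbb{K}=\mathbb{R}$ or $\mathbb{C}$. For Banach spaces $E,F$ and $m\in\mathbb{N}$, $\mathcal{L}(E;F)$ is the space of bounded linear operators and $\mathcal{P}(^mE;F)$ the space of continuous $m$-homogeneous polynomials from $E$ to $F$ with the sup norm over the closed unit ball $B_E$; $\mathcal{P}(^mE)=\mathcal{P}(^mE;\mathbb{K})$; $E^*$ is the topological dual; $p^*$ is the conjugate exponent of $p$. $\ell_p(E)$ denotes the absolutely $p$-summable sequences in $E$ (bounded sequences if $p=\infty$) and $\ell_p^w(E)$ the weakly $p$-summable ones, i.e. $(x_n)$ with $(\varphi(x_n))_n\in\ell_p$ for all $\varphi\in E^*$. Operator ideals involved (for an operator $u\in\mathcal{L}(E;F)$): - $\mathfrak{K}_p$ ($p$-compact operators, $1\le p<\infty$): there is $(y_n)\in\ell_p(F)$ with $u(B_E)\subseteq\{\sum_n\alpha_ny_n:(\alpha_n)\in B_{\ell_{p^*}}\}$ ($B_{c_0}$ in place of $B_{\ell_{p^*}}$ if $p=1$). - $\mathfrak{N}_p$ ($p$-nuclear operators, $1\le p<\infty$): $u=\sum_{n=1}^\infty\varphi_n\otimes y_n$ (i.e. $u(x)=\sum_n\varphi_n(x)y_n$)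 with $(\varphi_n)\in\ell_p(E^* )$ and $(y_n)\in\ell_{p^*}^w(F)$. - $\mathfrak{I}_q$ ($q$-integral operators, $1\le q<\infty$): there are a finite measure space $(\Omega,\mu)$ and operators $a\in\mathcal{L}(E;L_\infty(\mu))$, $b\in\mathcal{L}(L_q(\mu);F^{**})$ with $J_F\circ u=b\circ i\circ a$, where $i\colon L_\infty(\mu)\to L_q(\mu)$ is the inclusion and $J_F\colon F\to F^{**}$ the canonical embedding. - $\mathcal{D}_p$ (Cohen strongly $p$-summing operators, $1<p\le\infty$): there is $C\ge0$ such that for all $n$, $x_1,\dots,x_n\in E$ and $\varphi_1,\dots,\varphi_n\in F^*$, $$\sum_{i=1}^n|\varphi_i(u(x_i))|\le C\left(\sum_{i=1}^n\|x_i\|^p\right)^{1/p}\sup_{y\in B_F}\left(\sum_{i=1}^n|\varphi_i(y)|^{p^*}\right)^{1/p^*}$$ (with $\max_i\|x_i\|$ in place of the first factor if $p=\infty$). Polynomial dual of an operator ideal $\mathcal{I}$: $\mathcal{I}^{\mathcal{P}-dual}(^mE;F)=\{P\in\mathcal{P}(^mE;F):P^*\in\mathcal{I}(F^*;\mathcal{P}(^mE))\}$, where $P^*\colon F^*\to\mathcal{P}(^mE)$ is given by $P^*(\varphi)(x)=\varphi(P(x))$. Composition ideal: $P\in\mathcal{P}(^mE;F)$ belongs to $\mathcal{I}\circ\mathcal{P}(^mE;F)$ if $P=u\circ Q$ for some Banach space $G$, $Q\in\mathcal{P}(^mE;G)$ and $u\in\mathcal{I}(G;F)$. Injective hull of a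 polynomial ideal $\mathcal{Q}$: $\mathcal{Q}^{inj}(^mE;F)=\{P\in\mathcal{P}(^mE;F): I_F\circ P\in\mathcal{Q}(^mE;\ell_\infty(B_{F^*}))\}$, where $I_F\colon F\to\ell_\infty(B_{F^*})$, $I_F(y)=(\varphi(y))_{\varphi\in B_{F^*}}$, and $\ell_\infty(B_{F^*})$ is the space of bounded scalar functions on the closed unit ball $B_{F^*}$ of $F^*$ with the sup norm. Equalities are equalities of classes: the components for every $m\in\mathbb{N}$ and all Banach spaces $E,F$ coincide. *)

(* Defs.v *)
From HB Require Import structures.
From mathcomp Require Import all_boot all_order all_algebra.
From mathcomp Require Import generic_quotient ring_quotient complex.
From mathcomp Require Import all_classical all_reals all_analysis.
From mathcomp Require Import measurable_realfun ess_sup_inf.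

Set Implicit Arguments.
Unset Strict Implicit.
Unset Printing Implicit Defensive.

Import Order.TTheory GRing.Theory Num.Theory.
Import numFieldNormedType.Exports.

Local Open Scope classical_set_scope.
Local Open Scope ring_scope.

(* The scalar field K is R or R[i], for an arbitrary model R of the reals. *)
Variant scalar_kind := real_scalars | complex_scalars.

Definition scalars (R : realType) (k : scalar_kind) : numFieldType :=
  match k with
  | real_scalars => R
  | complex_scalars => R[i]%C
  end.

Section Scalars.
Context {R : realType} {k : scalar_kind}.
Local Notation K := (scalars R k).

Definition re_part : K -> R :=
  match k return scalars R k -> R with
  | real_scalars => fun x => x
  | complex_scalars => fun z => complex.Re z
  end.

Definition im_part : K -> R :=
  match k return scalars R k -> R with
  | real_scalars => fun=> 0
  | complex_scalars => fun z => complex.Im z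
  end.

Definition of_real : R -> K :=
  match k return R -> scalars R k with
  | real_scalars => fun x => x
  | complex_scalars => fun x => real_complex R x
  end.

(* In MathComp the norm of a normed space over K is K-valued; [rnorm] is the
   same norm as a real number (see [of_real_rnorm]). *)
Definition rnorm {E : normedModType K} (x : E) : R := re_part `|x|.

End Scalars.
Arguments re_part {R k}.
Arguments im_part {R k}.
Arguments of_real {R k}.

Section ScalarTheory.
Context {R : realType} {k : scalar_kind}.
Local Notation K := (scalars R k).

Lemma of_realK : cancel (of_real : R -> K) re_part.
Proof. by case: k. Qed.

Lemma of_real_inj : injective (of_real : R -> K).
Proof. exact: can_inj of_realK. Qed.

Lemma of_real0 : of_real 0 = 0 :> K.
Proof. by case: k. Qed.

Lemma of_real1 : of_real 1 = 1 :> K.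
Proof. by case: k. Qed.

Lemma of_realD (x y : R) : of_real (x + y) = of_real x + of_real y :> K.
Proof. by case: k => //=; apply: rmorphD. Qed.

Lemma of_realM (x y : R) : of_real (x * y) = of_real x * of_real y :> K.
Proof. by case: k => //=; apply: rmorphM. Qed.

Lemma ler_of_real (x y : R) : (of_real x <= of_real y :> K) = (x <= y).
Proof. by case: k => //=; apply: lecR. Qed.

Lemma re_partK (x : K) : 0 <= x -> of_real (re_part x) = x.
Proof. by case: k x => //= x x0; apply: RRe_real; apply: ger0_real. Qed.

Lemma re_part_of_ge0 (x : K) : 0 <= x -> 0 <= re_part x.
Proof. by move=> x0; rewrite -ler_of_real of_real0 re_partK. Qed.

Lemma ler_re_part (x y : K) : 0 <= x -> x <= y -> re_part x <= re_part y.
Proof.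
by move=> x0 xy; rewrite -ler_of_real !re_partK// (le_trans x0).
Qed.

Implicit Types E : normedModType K.

Lemma of_real_rnorm E (x : E) : of_real (rnorm x) = `|x|.
Proof. exact/re_partK/normr_ge0. Qed.

Lemma rnorm_ge0 E (x : E) : 0 <= rnorm x.
Proof. exact/re_part_of_ge0/normr_ge0. Qed.

Lemma ler_rnormD E (x y : E) : rnorm (x + y) <= rnorm x + rnorm y.
Proof. by rewrite -ler_of_real of_realD !of_real_rnorm ler_normD. Qed.

Lemma rnormZ E (a : K) (x : E) : rnorm (a *: x) = rnorm (a : K^o) * rnorm x.
Proof.
by apply: of_real_inj; rewrite of_realM !of_real_rnorm normrZ.
Qed.

Lemma rnorm0_eq0 E (x : E) : rnorm x = 0 -> x = 0.
Proof.
by move=> x0; apply/normr0_eq0; rewrite -of_real_rnorm x0 of_real0.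
Qed.

Lemma rnorm0 E : rnorm (0 : E) = 0.
Proof. by apply: of_real_inj; rewrite of_real_rnorm normr0 of_real0. Qed.

Lemma rnorm_le E (x : E) (r : R) : (rnorm x <= r) = (`|x| <= of_real r).
Proof. by rewrite -ler_of_real of_real_rnorm. Qed.

End ScalarTheory.

Definition closed_unit_ball {R : realType} {k : scalar_kind}
    (E : normedModType (scalars R k)) : set E :=
  [set x | rnorm x <= 1].

Section SupNorm.
Context {R : realType} {k : scalar_kind}.
Local Notation K := (scalars R k).
Context {X : Type} {F : normedModType K}.
Variable B : set X.
Implicit Types f g : X -> F.

Definition sup_norm f : R := sup [set rnorm (f x) | x in B].

Definition bounded_over f := exists M : R, forall x, B x -> rnorm (f x) <= M.

Lemma sup_norm_ub f x : bounded_over f -> B x -> rnorm (f x) <= sup_norm f.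
Proof.
move=> [M fM] Bx; apply: ub_le_sup; last by exists x.
by exists M => _ [y By <-]; exact: fM.
Qed.

Lemma sup_norm_le f (M : R) :
  0 <= M -> (forall x, B x -> rnorm (f x) <= M) -> sup_norm f <= M.
Proof.
move=> M0 fM; have [B0|/set0P[x Bx]] := eqVneq B set0.
  by rewrite /sup_norm B0 image_set0 sup0.
apply: ge_sup; first by exists (rnorm (f x)), x.
by move=> _ [y By <-]; exact: fM.
Qed.

Lemma sup_norm_ge0 f : bounded_over f -> 0 <= sup_norm f.
Proof.
move=> bf; have [B0|/set0P[x Bx]] := eqVneq B set0.
  by rewrite /sup_norm B0 image_set0 sup0.
exact: le_trans (rnorm_ge0 _) (sup_norm_ub bf Bx).
Qed.

Lemma sup_normD f g : bounded_over f -> bounded_over g ->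
  sup_norm (f \+ g) <= sup_norm f + sup_norm g.
Proof.
move=> bf bg; apply: sup_norm_le => [|x Bx].
  by rewrite addr_ge0 ?sup_norm_ge0.
by rewrite (le_trans (ler_rnormD _ _))// lerD ?sup_norm_ub.
Qed.

Lemma sup_normZ (a : K) f : bounded_over f ->
  sup_norm (a \*: f) = rnorm (a : K^o) * sup_norm f.
Proof.
move=> bf; have [->|a0] := eqVneq a 0.
  rewrite rnorm0 mul0r; apply/eqP; rewrite eq_le; apply/andP; split.
    by apply: sup_norm_le => // x _; rewrite /= scale0r rnorm0.
  by apply: sup_norm_ge0; exists 0 => x _; rewrite /= scale0r rnorm0.
have ra0 : 0 < rnorm (a : K^o).
  rewrite lt_neqAle rnorm_ge0 andbT eq_sym.
  by apply: contra a0 => /eqP/rnorm0_eq0 ->.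
have baf : bounded_over (a \*: f).
  case: bf => M fM; exists (rnorm (a : K^o) * M) => x Bx.
  by rewrite /= rnormZ ler_wpM2l ?rnorm_ge0 ?fM.
apply/eqP; rewrite eq_le; apply/andP; split.
  apply: sup_norm_le => [|x Bx]; first by rewrite mulr_ge0 ?rnorm_ge0 ?sup_norm_ge0.
  by rewrite /= rnormZ ler_wpM2l ?rnorm_ge0 ?sup_norm_ub.
rewrite mulrC -ler_pdivlMr//; apply: sup_norm_le => [|x Bx].
  by rewrite divr_ge0 ?sup_norm_ge0 ?rnorm_ge0.
by rewrite ler_pdivlMr// mulrC -rnormZ; exact: sup_norm_ub baf Bx.
Qed.

Lemma sup_norm_eq0 f x : bounded_over f -> sup_norm f = 0 -> B x -> f x = 0.
Proof.
move=> bf f0 Bx; apply: rnorm0_eq0; apply/eqP; rewrite eq_le rnorm_ge0 andbT.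
by rewrite -f0 sup_norm_ub.
Qed.

End SupNorm.

Section UnitBall.
Context {R : realType} {k : scalar_kind}.
Local Notation K := (scalars R k).
Context {E F : normedModType K}.

(* Every [x] is a scalar multiple of a point of the unit ball, so a function
   that is homogeneous of degree [m] is determined by its values there. *)
Lemma homogeneous_bounded (m : nat) (f : E -> F) :
  (forall a x, f (a *: x) = a ^+ m *: f x) -> continuous f ->
  bounded_over (@closed_unit_ball R k E) f.
Proof.
move=> fh fc; have /cvgrPdist_lt/(_ 1 ltr01) := fc 0.
move=> /nbhs_norm0P[e /= e0 fe].
pose t := e / 2.
have t0 : 0 < t by rewrite divr_gt0.
exists (re_part ((1 + `|f 0|) / t ^+ m)) => x; rewrite /closed_unit_ball /= => x1.
rewrite rnorm_le re_partK; last first.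
  by rewrite divr_ge0 ?addr_ge0 ?exprn_ge0// ltW.
have {}x1 : `|x| <= 1.
  by rewrite -of_real_rnorm (le_trans (y := of_real 1)) ?ler_of_real ?of_real1.
rewrite ler_pdivlMr ?exprn_gt0// mulrC.
have -> : t ^+ m * `|f x| = `|f (t *: x)|.
  by rewrite fh normrZ normrX gtr0_norm.
have := fe (t *: x); rewrite /= normrZ gtr0_norm// => H.
have /H{H} fx : t * `|x| < e.
  rewrite (le_lt_trans (y := t))// ?ler_piMr ?(ltW t0)//.
  by rewrite /t ltr_pdivrMr// ltr_pMr// ltrDl.
rewrite -[f (t *: x)](subrK (f 0)) (le_trans (ler_normD _ _))// lerD2r.
by rewrite distrC ltW.
Qed.

Lemma homogeneous_eq0 (m : nat) (f : E -> F) :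
  (forall a x, f (a *: x) = a ^+ m *: f x) ->
  (forall x, closed_unit_ball x -> f x = 0) -> forall x, f x = 0.
Proof.
move=> fh f0 x; have [->|x0] := eqVneq x 0.
  by apply: f0; rewrite /closed_unit_ball /= rnorm0.
have nx0 : `|x| != 0 by rewrite normr_eq0.
rewrite -[x](scale1r) -(divff nx0) -scalerA fh f0 ?scaler0//.
rewrite /closed_unit_ball /= rnorm_le normrZ normrV ?unitfE// normr_id mulVf//.
by rewrite of_real1.
Qed.

End UnitBall.

Section ContinuousLinear.
Context {R : realType} {k : scalar_kind}.
Local Notation K := (scalars R k).
Variables E F : normedModType K.

Definition is_lop (f : E -> F) : Prop := linear f /\ continuous f.
Definition lop_pred : {pred E -> F} := fun f => `[< is_lop f >].

Record lop := Lop { lop_fun :> E -> F; lopP : lop_fun \in lop_pred }.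

HB.instance Definition _ := [isSub for lop_fun].
HB.instance Definition _ := [Choice of lop by <:].

Lemma lop_submod_closed : submod_closed lop_pred.
Proof.
split=> [|a f g /asboolP[lf cf] /asboolP[lg cg]]; apply/asboolP; split.
- by move=> a u v /=; rewrite scaler0 addr0.
- by move=> x; exact: cvg_cst.
- move=> b u v; rewrite !fctE lf lg !scalerDr !scalerA (mulrC a b).
  by rewrite addrACA.
- by move=> x; apply: cvgD; [apply: cvgZl_tmp; exact: cf|exact: cg].
Qed.

HB.instance Definition _ :=
  GRing.isSubmodClosed.Build K _ lop_pred lop_submod_closed.
HB.instance Definition _ := [SubChoice_isSubLmodule of lop by <:].

Lemma lop_linear (u : lop) : linear u.
Proof. by case: u => u /= /asboolP[]. Qed.

Lemma lop_continuous (u : lop) : continuous u.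
Proof. by case: u => u /= /asboolP[]. Qed.

Lemma lop_homogeneous (u : lop) a x : u (a *: x) = a ^+ 1 *: u x.
Proof.
have u0 : u 0 = 0 by have := lop_linear u (-1) 0 0; rewrite scaleN1r addNr scaleN1r addNr.
by rewrite -[a *: x]addr0 (lop_linear u) u0 addr0 expr1.
Qed.

Lemma lop_bounded (u : lop) : bounded_over (@closed_unit_ball R k E) u.
Proof. exact: homogeneous_bounded (lop_homogeneous u) (@lop_continuous u). Qed.

Definition lop_norm (u : lop) : K := of_real (sup_norm (@closed_unit_ball R k E) u).

Lemma lop_normD u v : lop_norm (u + v) <= lop_norm u + lop_norm v.
Proof.
by rewrite -of_realD ler_of_real; exact: sup_normD (lop_bounded u) (lop_bounded v).
Qed.

Lemma lop_normZ a u : lop_norm (a *: u) = `|a| * lop_norm u.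
Proof.
rewrite -[`|a|](@of_real_rnorm R k K^o) -of_realM; congr of_real.
exact: sup_normZ (lop_bounded u).
Qed.

Lemma lop_norm_eq0 u : lop_norm u = 0 -> u = 0.
Proof.
rewrite -of_real0 => /of_real_inj u0; apply/val_inj/funext => x /=.
apply: (homogeneous_eq0 (lop_homogeneous u)) => {}x Bx.
exact: sup_norm_eq0 (lop_bounded u) u0 Bx.
Qed.

HB.instance Definition _ :=
  Lmodule_isNormed.Build K lop lop_normD lop_normZ lop_norm_eq0.

Lemma rnorm_lop (u : lop) : rnorm u = sup_norm (@closed_unit_ball R k E) u.
Proof. exact: of_realK. Qed.

Lemma lop_le (u : lop) x : rnorm (u x) <= rnorm u * rnorm x.
Proof.
have [->|x0] := eqVneq x 0.
  by have := lop_homogeneous u 0 0; rewrite !scale0r => ->; rewrite !rnorm0 mulr0.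
have nx0 : `|x| != 0 by rewrite normr_eq0.
rewrite -{1}[x]scale1r -(divff nx0) -scalerA lop_homogeneous expr1 rnormZ.
have -> : rnorm (`|x| : K^o) = rnorm x by rewrite /rnorm normr_id.
rewrite mulrC ler_wpM2r ?rnorm_ge0// rnorm_lop; apply: sup_norm_ub.
  exact: lop_bounded.
by rewrite /closed_unit_ball /= rnorm_le normrZ normrV ?unitfE// normr_id mulVf// of_real1.
Qed.

End ContinuousLinear.
Arguments lop_pred {R k} E F.
Arguments lop {R k} E F.

Definition dual {R : realType} {k : scalar_kind}
    (E : normedModType (scalars R k)) : normedModType (scalars R k) :=
  lop E (scalars R k)^o.

Section HomogeneousPolynomials.
Context {R : realType} {k : scalar_kind}.
Local Notation K := (scalars R k).
Variables (m : nat) (E F : normedModType K).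

Definition multilinear (A : ('I_m -> E) -> F) : Prop :=
  forall (i : 'I_m) (x : 'I_m -> E),
    linear (fun u : E => A (fun j => if j == i then u else x j)).

Definition is_hpoly (P : E -> F) : Prop :=
  (exists2 A, multilinear A & forall x, P x = A (fun=> x)) /\ continuous P.
Definition hpoly_pred : {pred E -> F} := fun P => `[< is_hpoly P >].

Record hpoly := Hpoly { hpoly_fun :> E -> F; hpolyP : hpoly_fun \in hpoly_pred }.

HB.instance Definition _ := [isSub for hpoly_fun].
HB.instance Definition _ := [Choice of hpoly by <:].

Lemma hpoly_submod_closed : submod_closed hpoly_pred.
Proof.
split=> [|a P Q /asboolP[[A mA PA] cP] /asboolP[[B mB QB] cQ]];
    apply/asboolP; split.
- by exists (fun=> 0) => // i x b u v; rewrite scaler0 addr0.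
- by move=> x; exact: cvg_cst.
- exists (fun x => a *: A x + B x) => [i x b u v|x].
    by rewrite (mA i x) (mB i x) !scalerDr !scalerA (mulrC a b) addrACA.
  by rewrite !fctE PA QB.
- by move=> x; apply: cvgD; [apply: cvgZl_tmp; exact: cP|exact: cQ].
Qed.

HB.instance Definition _ :=
  GRing.isSubmodClosed.Build K _ hpoly_pred hpoly_submod_closed.
HB.instance Definition _ := [SubChoice_isSubLmodule of hpoly by <:].

Lemma hpoly_continuous (P : hpoly) : continuous P.
Proof. by case: P => P /= /asboolP[]. Qed.

Lemma hpoly_homogeneous (P : hpoly) a x : P (a *: x) = a ^+ m *: P x.
Proof.
case: P => P /= /asboolP[[A mA PA] _]; rewrite !PA.
pose B n : 'I_m -> E := fun i => if (i < n)%N then a *: x else x.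
suff AB n : (n <= m)%N -> A (B n) = a ^+ n *: A (fun=> x).
  by rewrite -AB//; congr A; apply/funext => i; rewrite /B ltn_ord.
elim: n => [_|n IHn nm].
  by rewrite expr0 scale1r; congr A; apply/funext => i; rewrite /B ltn0.
rewrite exprS -scalerA -IHn ?(ltnW nm)//.
have lin0 i y : A (fun j => if j == i then 0 else y j) = 0.
  by have := mA i y (-1) 0 0; rewrite !scaleN1r !addNr.
pose i := Ordinal nm.
have BSn : B n.+1 = fun j => if j == i then a *: x + 0 else B n j.
  apply/funext => j; rewrite /B ltnS leq_eqVlt addr0 -val_eqE /=.
  by case: eqVneq.
have Bn : B n = fun j => if j == i then x else B n j.
  apply/funext => j; rewrite /B -val_eqE /=.
  by case: eqVneq => // ->; rewrite ltnn.
by rewrite BSn (mA i (B n)) lin0 addr0 -Bn.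
Qed.

Lemma hpoly_bounded (P : hpoly) : bounded_over (@closed_unit_ball R k E) P.
Proof.
exact: homogeneous_bounded (hpoly_homogeneous P) (@hpoly_continuous P).
Qed.

Definition hpoly_norm (P : hpoly) : K :=
  of_real (sup_norm (@closed_unit_ball R k E) P).

Lemma hpoly_normD P Q : hpoly_norm (P + Q) <= hpoly_norm P + hpoly_norm Q.
Proof.
rewrite -of_realD ler_of_real.
exact: sup_normD (hpoly_bounded P) (hpoly_bounded Q).
Qed.

Lemma hpoly_normZ a P : hpoly_norm (a *: P) = `|a| * hpoly_norm P.
Proof.
rewrite -[`|a|](@of_real_rnorm R k K^o) -of_realM; congr of_real.
exact: sup_normZ (hpoly_bounded P).
Qed.

Lemma hpoly_norm_eq0 P : hpoly_norm P = 0 -> P = 0.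
Proof.
rewrite -of_real0 => /of_real_inj P0; apply/val_inj/funext => x /=.
apply: (homogeneous_eq0 (hpoly_homogeneous P)) => {}x Bx.
exact: sup_norm_eq0 (hpoly_bounded P) P0 Bx.
Qed.

HB.instance Definition _ :=
  Lmodule_isNormed.Build K hpoly hpoly_normD hpoly_normZ hpoly_norm_eq0.

Lemma rnorm_hpoly (P : hpoly) : rnorm P = sup_norm (@closed_unit_ball R k E) P.
Proof. exact: of_realK. Qed.

End HomogeneousPolynomials.
Arguments hpoly_pred {R k} m E F.
Arguments hpoly {R k} m E F.

Section BoundedFunctions.
Context {R : realType} {k : scalar_kind}.
Local Notation K := (scalars R k).
Variable S : Type.

Definition linf_pred : {pred S -> K^o} :=
  fun f => `[< bounded_over [set: S] f >].

Record linf := Linf { linf_fun :> S -> K^o; linfP : linf_fun \in linf_pred }.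

HB.instance Definition _ := [isSub for linf_fun].
HB.instance Definition _ := [Choice of linf by <:].

Lemma linf_submod_closed : submod_closed linf_pred.
Proof.
split=> [|a f g /asboolP[M fM] /asboolP[N gN]]; apply/asboolP.
  by exists 0 => x _; rewrite rnorm0.
exists (rnorm (a : K^o) * M + N) => x _.
rewrite (le_trans (ler_rnormD _ _))// lerD ?gN// rnormZ.
by rewrite ler_wpM2l ?rnorm_ge0 ?fM.
Qed.

HB.instance Definition _ :=
  GRing.isSubmodClosed.Build K _ linf_pred linf_submod_closed.
HB.instance Definition _ := [SubChoice_isSubLmodule of linf by <:].

Lemma linf_bounded (f : linf) : bounded_over [set: S] f.
Proof. by case: f => f /= /asboolP. Qed.

Definition linf_norm (f : linf) : K := of_real (sup_norm [set: S] f).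

Lemma linf_normD f g : linf_norm (f + g) <= linf_norm f + linf_norm g.
Proof.
rewrite -of_realD ler_of_real.
exact: sup_normD (linf_bounded f) (linf_bounded g).
Qed.

Lemma linf_normZ a f : linf_norm (a *: f) = `|a| * linf_norm f.
Proof.
rewrite -[`|a|](@of_real_rnorm R k K^o) -of_realM; congr of_real.
exact: sup_normZ (linf_bounded f).
Qed.

Lemma linf_norm_eq0 f : linf_norm f = 0 -> f = 0.
Proof.
rewrite -of_real0 => /of_real_inj f0; apply/val_inj/funext => x /=.
exact: sup_norm_eq0 (linf_bounded f) f0 _.
Qed.

HB.instance Definition _ :=
  Lmodule_isNormed.Build K linf linf_normD linf_normZ linf_norm_eq0.

End BoundedFunctions.
Arguments linf_pred {R k} S.
Arguments linf R k S : clear implicits.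

Section Constructions.
Context {R : realType} {k : scalar_kind}.
Local Notation K := (scalars R k).
Implicit Types E F G : normedModType K.

Lemma linear_bounded_is_lop E F (f : E -> F) (C : R) :
  linear f -> (forall x, rnorm (f x) <= C * rnorm x) -> f \in lop_pred E F.
Proof.
move=> lf fC; apply/asboolP; split=> // x.
have fB y z : f y - f z = f (y - z).
  by have := lf 1 (y - z) z; rewrite !scale1r subrK => ->; rewrite addrK.
apply/cvgrPdist_le => /= e e0.
pose M : R := `|C| + 1.
have M0 : 0 < of_real M :> K.
  by rewrite lt_neqAle -!(@of_real0 R k) ler_of_real (inj_eq of_real_inj) -lt_neqAle ltr_wpDl.
near=> y.
rewrite fB -of_real_rnorm (le_trans (y := of_real (M * rnorm (x - y))))//.
  rewrite ler_of_real (le_trans (fC _))// ler_wpM2r ?rnorm_ge0//.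
  by rewrite (le_trans (ler_norm _))// lerDl.
rewrite of_realM of_real_rnorm mulrC -ler_pdivlMr//.
by near: y; apply: (@cvgr_dist_le _ _ _ (nbhs x) _ id x) => //; rewrite divr_gt0.
Unshelve. all: by end_near. Qed.

Lemma lop_comp_subproof E F G (v : lop F G) (u : lop E F) :
  v \o u \in lop_pred E G.
Proof.
apply/asboolP; split.
  by move=> a x y; rewrite /= !lop_linear.
by move=> x; apply: continuous_comp; exact: lop_continuous.
Qed.
Definition lop_comp E F G (v : lop F G) (u : lop E F) : lop E G :=
  Lop (lop_comp_subproof v u).

Lemma lop_hpoly_subproof m E F G (u : lop F G) (P : hpoly m E F) :
  u \o P \in hpoly_pred m E G.
Proof.
case: P => P /= /asboolP[[A mA PA] cP]; apply/asboolP; split.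
  exists (u \o A); first by move=> i x a y z; rewrite /= (mA i x) lop_linear.
  by move=> x; rewrite /= PA.
by move=> x; apply: continuous_comp; [exact: cP|exact: lop_continuous].
Qed.
Definition lop_hpoly m E F G (u : lop F G) (P : hpoly m E F) : hpoly m E G :=
  Hpoly (lop_hpoly_subproof u P).

Lemma hpoly_adjoint_subproof m E F (P : hpoly m E F) :
  (fun phi : dual F => lop_hpoly phi P) \in lop_pred (dual F) (hpoly m E K^o).
Proof.
apply: (@linear_bounded_is_lop _ _ _ (rnorm P)).
  by move=> a phi psi; exact/val_inj.
move=> phi; rewrite [leLHS]rnorm_hpoly; apply: sup_norm_le => [|x Bx].
  by rewrite mulr_ge0 ?rnorm_ge0.
rewrite mulrC (le_trans (lop_le _ _))// ler_wpM2l ?rnorm_ge0//.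
by rewrite rnorm_hpoly; apply: sup_norm_ub => //; exact: hpoly_bounded.
Qed.
Definition hpoly_adjoint m E F (P : hpoly m E F) : lop (dual F) (hpoly m E K^o) :=
  Lop (hpoly_adjoint_subproof P).

Lemma evaluation_subproof F (y : F) :
  (fun phi : dual F => phi y) \in lop_pred (dual F) K^o.
Proof.
apply: (@linear_bounded_is_lop _ _ _ (rnorm y)) => // phi.
by rewrite mulrC; exact: lop_le.
Qed.
Definition evaluation F (y : F) : dual (dual F) := Lop (evaluation_subproof y).

Lemma bidual_embedding_subproof F : @evaluation F \in lop_pred F (dual (dual F)).
Proof.
apply: (@linear_bounded_is_lop _ _ _ 1).
  by move=> a x y; apply/val_inj/funext => phi; rewrite /= lop_linear.
move=> y; rewrite mul1r [leLHS]rnorm_lop; apply: sup_norm_le => [|phi Bphi].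
  exact: rnorm_ge0.
by rewrite (le_trans (lop_le phi y))// ler_piMl ?rnorm_ge0.
Qed.
Definition bidual_embedding F : lop F (dual (dual F)) :=
  Lop (bidual_embedding_subproof F).

Definition dual_ball F := {phi : dual F | closed_unit_ball phi}.

Lemma dual_ball_bounded F (y : F) :
  (fun phi : dual_ball F => sval phi y) \in linf_pred (dual_ball F).
Proof.
apply/asboolP; exists (rnorm y) => -[phi Bphi] _ /=.
by rewrite (le_trans (lop_le phi y))// ler_piMl ?rnorm_ge0.
Qed.
Definition dual_ball_eval F (y : F) : linf R k (dual_ball F) :=
  Linf (dual_ball_bounded y).

Lemma linf_embedding_subproof F :
  @dual_ball_eval F \in lop_pred F (linf R k (dual_ball F)).
Proof.
apply: (@linear_bounded_is_lop _ _ _ 1).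
  by move=> a x y; apply/val_inj/funext => phi; rewrite /= lop_linear.
move=> y; rewrite mul1r (_ : rnorm _ = sup_norm [set: dual_ball F] (dual_ball_eval y)); last exact: of_realK.
apply: sup_norm_le => [|[phi Bphi] _]; first exact: rnorm_ge0.
by rewrite (le_trans (lop_le phi y))// ler_piMl ?rnorm_ge0.
Qed.
Definition linf_embedding F : lop F (linf R k (dual_ball F)) :=
  Lop (linf_embedding_subproof F).

End Constructions.

Section LpSpace.
Context {R : realType} {k : scalar_kind}.
Local Notation K := (scalars R k).

Lemma re_partD (x y : K) : re_part (x + y) = re_part x + re_part y.
Proof. by case: k x y => //= -[? ?] [? ?]. Qed.

Lemma im_partD (x y : K) : im_part (x + y) = im_part x + im_part y.
Proof. by case: k x y => /= [x y|[? ?] [? ?]//]; rewrite addr0. Qed.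

Lemma re_partM (x y : K) :
  re_part (x * y) = re_part x * re_part y - im_part x * im_part y.
Proof. by case: k x y => /= [x y|[? ?] [? ?]//]; rewrite mul0r subr0. Qed.

Lemma im_partM (x y : K) :
  im_part (x * y) = re_part x * im_part y + im_part x * re_part y.
Proof. by case: k x y => /= [x y|[? ?] [? ?]//]; rewrite mulr0 mul0r addr0. Qed.

Lemma rnorm_scalarE (x : K) :
  rnorm (x : K^o) = Num.sqrt (re_part x ^+ 2 + im_part x ^+ 2).
Proof.
rewrite /rnorm; case: k x => [x|[x y]] //=.
by rewrite expr0n addr0 sqrtr_sqr.
Qed.

Context {d : measure_display} {T : measurableType d}.
Variable mu : {measure set T -> \bar R}.

(* Measurability for the Borel sigma-algebra of K. *)
Definition scalar_measurable (f : T -> K) : Prop :=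
  measurable_fun setT (re_part \o f) /\ measurable_fun setT (im_part \o f).

Lemma scalar_measurable0 : scalar_measurable (fun=> 0).
Proof. by split; exact: measurable_cst. Qed.

Lemma scalar_measurableD (f g : T -> K) :
  scalar_measurable f -> scalar_measurable g -> scalar_measurable (f \+ g).
Proof.
move=> [rf jf] [rg jg]; split.
  rewrite (_ : _ \o _ = (re_part \o f) \+ (re_part \o g)); first exact: measurable_funD.
  by apply/funext => t /=; rewrite re_partD.
rewrite (_ : _ \o _ = (im_part \o f) \+ (im_part \o g)); first exact: measurable_funD.
by apply/funext => t /=; rewrite im_partD.
Qed.

Lemma scalar_measurableZ (a : K) (f : T -> K) :
  scalar_measurable f -> scalar_measurable (fun t => a * f t).
Proof.
move=> [rf jf]; split.
  rewrite (_ : _ \o _ = (cst (re_part a) \* (re_part \o f))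
                     \- (cst (im_part a) \* (im_part \o f))).
    by apply: measurable_funB; apply: measurable_funM.
  by apply/funext => t /=; rewrite re_partM.
rewrite (_ : _ \o _ = (cst (re_part a) \* (im_part \o f))
                   \+ (cst (im_part a) \* (re_part \o f))).
  by apply: measurable_funD; apply: measurable_funM.
by apply/funext => t /=; rewrite im_partM.
Qed.

Lemma measurable_rnorm (f : T -> K^o) :
  scalar_measurable f -> measurable_fun setT (fun t => rnorm (f t)).
Proof.
move=> [rf jf].
rewrite (_ : (fun t => _) = Num.sqrt \o
    ((fun t => (re_part \o f) t ^+ 2) \+ (fun t => (im_part \o f) t ^+ 2))).
  apply: measurableT_comp; first by apply: continuous_measurable_fun; exact: sqrt_continuous.
  by apply: measurable_funD; exact: measurable_funX.
by apply/funext => t /=; rewrite rnorm_scalarE.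
Qed.

Definition scalar_Lnorm (p : \bar R) (f : T -> K^o) : \bar R :=
  Lnorm mu p (fun t => (rnorm (f t))%:E).

Lemma ae_le_Lnorm (p : \bar R) (f g : T -> R) : (1 <= p)%E ->
  measurable_fun setT f -> measurable_fun setT g ->
  (\forall t \ae mu, `|f t| <= `|g t|) ->
  (Lnorm mu p (EFin \o f) <= Lnorm mu p (EFin \o g))%E.
Proof.
move=> p1 mf mg fg; rewrite unlock; case: p p1 => [r| |//] r1; last first.
  case: ifPn => // _; apply: le_ess_sup.
  by apply: filterS fg => t; rewrite /= lee_fin.
have r0 : 0 < r by rewrite (lt_le_trans ltr01).
apply: gt0_ler_poweR.
- by rewrite invr_ge0 ltW.
- by rewrite in_itv /= leey andbT; apply: integral_ge0 => t _; rewrite lee_fin powR_ge0.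
- by rewrite in_itv /= leey andbT; apply: integral_ge0 => t _; rewrite lee_fin powR_ge0.
have mh (h : T -> R) : measurable_fun setT h ->
    measurable_fun setT (fun t => (`|(EFin \o h) t| `^ r)%E).
  move=> mh; apply/measurable_EFinP.
  apply: (@measurableT_comp _ _ _ _ _ _ (@powR R ^~ r)) => //.
  exact: measurableT_comp.
apply: ae_ge0_le_integral => //; try exact: mh.
- by move=> t _; exact: poweR_ge0.
- by move=> t _; exact: poweR_ge0.
apply: filterS fg => t fgt _ /=.
by rewrite lee_fin ge0_ler_powR ?nnegrE// ltW.
Qed.

Lemma scalar_Lnorm_ge0 p f : (0 <= scalar_Lnorm p f)%E.
Proof. exact: Lnorm_ge0. Qed.

Lemma ae_eq_scalar_Lnorm p f g : (1 <= p)%E ->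
  scalar_measurable f -> scalar_measurable g ->
  (\forall t \ae mu, f t = g t) -> scalar_Lnorm p f = scalar_Lnorm p g.
Proof.
move=> p1 mf mg fg; apply/eqP; rewrite eq_le; apply/andP; split.
  apply: ae_le_Lnorm => //; try exact: measurable_rnorm.
  by apply: filterS fg => t ->.
apply: ae_le_Lnorm => //; try exact: measurable_rnorm.
by apply: filterS fg => t ->.
Qed.

Lemma scalar_LnormD p f g : (1 <= p)%E ->
  scalar_measurable f -> scalar_measurable g ->
  (scalar_Lnorm p (f \+ g)%R <= scalar_Lnorm p f + scalar_Lnorm p g)%E.
Proof.
move=> p1 mf mg.
have mf' := measurable_rnorm mf; have mg' := measurable_rnorm mg.
apply: le_trans (eminkowski mu mf' mg' p1).
apply: ae_le_Lnorm => //.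
- exact/measurable_rnorm/scalar_measurableD.
- exact: measurable_funD.
apply: nearW => t /=; rewrite !ger0_norm ?addr_ge0 ?rnorm_ge0//.
exact: ler_rnormD.
Qed.

Lemma scalar_LnormZ p a f : (1 <= p)%E -> scalar_measurable f ->
  (scalar_Lnorm p f < +oo)%E ->
  scalar_Lnorm p (a \*: f) = ((rnorm (a : K^o))%:E * scalar_Lnorm p f)%E.
Proof.
move=> p1 mf foo; have mf' := measurable_rnorm mf.
have fL : (fun t => rnorm (f t)) \in Lfun mu p.
  by apply/andP; split; rewrite inE//=; rewrite inE.
have := LnormZ (Lfun_Sub p1 fL) (rnorm (a : K^o)).
rewrite ger0_norm ?rnorm_ge0// => <-.
by apply: eq_Lnorm => t /=; rewrite rnormZ.
Qed.

Section Lp.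
Variables (p : \bar R) (p1 : (1 <= p)%E).

Definition is_Lpfun (f : T -> K^o) : Prop :=
  scalar_measurable f /\ (scalar_Lnorm p f < +oo)%E.
Definition Lpfun_pred of (1 <= p)%E : {pred T -> K^o} := fun f => `[< is_Lpfun f >].

Record Lpfun := LpFun { Lpfun_fun :> T -> K^o; LpfunP : Lpfun_fun \in Lpfun_pred p1 }.

HB.instance Definition _ := [isSub for Lpfun_fun].
HB.instance Definition _ := [Choice of Lpfun by <:].

Lemma Lpfun_submod_closed : submod_closed (Lpfun_pred p1).
Proof.
split=> [|a f g /asboolP[mf foo] /asboolP[mg goo]]; apply/asboolP; split.
- exact: scalar_measurable0.
- rewrite (_ : scalar_Lnorm _ _ = 0)%E ?ltry//.
  rewrite /scalar_Lnorm -[RHS](@Lnorm0 _ _ _ mu p).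
    by apply: eq_Lnorm => t /=; rewrite rnorm0.
  by rewrite gt_eqF// (lt_le_trans _ p1).
- exact: scalar_measurableD (scalar_measurableZ a mf) mg.
- rewrite (le_lt_trans (scalar_LnormD p1 (scalar_measurableZ a mf) mg))//.
  by rewrite lte_add_pinfty// (scalar_LnormZ a p1)// lte_mul_pinfty// lee_fin rnorm_ge0.
Qed.

HB.instance Definition _ :=
  GRing.isSubmodClosed.Build K _ (Lpfun_pred p1) Lpfun_submod_closed.
HB.instance Definition _ := [SubChoice_isSubLmodule of Lpfun by <:].

Definition null_pred : {pred Lpfun} := fun f => `[< \forall t \ae mu, f t = 0 >].

Lemma null_zmod_closed : zmod_closed null_pred.
Proof.
split=> [|f g /asboolP f0 /asboolP g0]; apply/asboolP; first exact: nearW.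
by apply: filterS2 f0 g0 => t; rewrite /= !fctE /= => -> ->; rewrite subr0.
Qed.
HB.instance Definition _ :=
  GRing.isZmodClosed.Build Lpfun null_pred null_zmod_closed.

Definition Lp : Type := @Quotient.quot Lpfun null_pred.
HB.instance Definition _ := GRing.Zmodule.on Lp.
HB.instance Definition _ := Quotient.on Lp.

Local Open Scope quotient_scope.

Definition Lp_class (f : Lpfun) : Lp := \pi_Lp f.
Definition Lp_fun (x : Lp) : Lpfun := repr x.

Lemma Lp_funK : cancel Lp_fun Lp_class.
Proof. exact: reprK. Qed.

Lemma Lp_classP (f g : Lpfun) :
  Lp_class f = Lp_class g <-> \forall t \ae mu, f t = g t.
Proof.
have fg : f - g \in null_pred <-> \forall t \ae mu, f t = g t.
  split=> [/asboolP|fg]; last apply/asboolP.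
    by apply: filterS => t /eqP; rewrite /= !fctE /= subr_eq0 => /eqP.
  by apply: filterS fg => t; rewrite /= !fctE /= => ->; rewrite subrr.
split=> [/eqP fgE|/fg]; first by apply/fg; rewrite Quotient.idealrBE.
by rewrite Quotient.idealrBE => /eqP.
Qed.

Lemma Lp_classD f g : Lp_class (f + g) = Lp_class f + Lp_class g.
Proof. exact: Quotient.pi_add. Qed.

Lemma Lp_class0 : Lp_class 0 = 0.
Proof.
by apply: (addrI (Lp_class 0)); rewrite -Lp_classD [RHS]addr0 addr0.
Qed.

Definition Lp_scale (a : K) (x : Lp) : Lp := Lp_class (a *: Lp_fun x).

Lemma Lp_classZ a f : Lp_class (a *: f) = Lp_scale a (Lp_class f).
Proof.
apply/Lp_classP; have /Lp_classP := Lp_funK (Lp_class f).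
by apply: filterS => t ft; rewrite /= !fctE ft.
Qed.

Lemma Lp_scaleA a b x : Lp_scale a (Lp_scale b x) = Lp_scale (a * b) x.
Proof. by rewrite -(Lp_funK x) -!Lp_classZ scalerA. Qed.

Lemma Lp_scale1 : left_id 1 Lp_scale.
Proof. by move=> x; rewrite -(Lp_funK x) -Lp_classZ scale1r. Qed.

Lemma Lp_scaleDr : right_distributive Lp_scale +%R.
Proof.
move=> a x y; rewrite -(Lp_funK x) -(Lp_funK y) -Lp_classD -!Lp_classZ.
by rewrite scalerDr Lp_classD.
Qed.

Lemma Lp_scaleDl x : {morph Lp_scale^~ x : a b / a + b}.
Proof.
move=> a b; rewrite -(Lp_funK x) -!Lp_classZ.
by rewrite scalerDl Lp_classD.
Qed.

HB.instance Definition _ := GRing.Zmodule_isLmodule.Build K Lp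
  Lp_scaleA Lp_scale1 Lp_scaleDr Lp_scaleDl.

Definition Lp_norm (x : Lp) : K := of_real (fine (scalar_Lnorm p (Lp_fun x))).

Lemma Lpfun_measurable (f : Lpfun) : scalar_measurable f.
Proof. by case: f => f /= /asboolP[]. Qed.

Lemma Lpfun_finite (f : Lpfun) : scalar_Lnorm p f \is a fin_num.
Proof.
by case: f => f /= /asboolP[_ foo]; rewrite ge0_fin_numE ?scalar_Lnorm_ge0.
Qed.

Lemma Lp_normE f : Lp_norm (Lp_class f) = of_real (fine (scalar_Lnorm p f)).
Proof.
rewrite /Lp_norm (@ae_eq_scalar_Lnorm _ _ f)//; try exact: Lpfun_measurable.
exact/Lp_classP/Lp_funK.
Qed.

Lemma Lp_normD x y : Lp_norm (x + y) <= Lp_norm x + Lp_norm y.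
Proof.
rewrite -(Lp_funK x) -(Lp_funK y) -Lp_classD !Lp_normE -of_realD ler_of_real.
rewrite -lee_fin EFinD !fineK ?Lpfun_finite//.
exact: scalar_LnormD p1 (Lpfun_measurable _) (Lpfun_measurable _).
Qed.

Lemma Lp_normZ a x : Lp_norm (a *: x) = `|a| * Lp_norm x.
Proof.
rewrite -(Lp_funK x) -[a *: _]Lp_classZ !Lp_normE.
rewrite -[`|a|](@of_real_rnorm R k K^o) -of_realM; congr of_real.
apply: EFin_inj; rewrite EFinM !fineK ?Lpfun_finite//.
apply: scalar_LnormZ => //; first exact: Lpfun_measurable.
by rewrite -ge0_fin_numE ?Lpfun_finite ?scalar_Lnorm_ge0.
Qed.

Lemma Lp_norm_eq0 x : Lp_norm x = 0 -> x = 0.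
Proof.
rewrite -(Lp_funK x) Lp_normE -of_real0 => /of_real_inj f0.
have {}f0 : scalar_Lnorm p (Lp_fun x) = 0%E by rewrite -[LHS]fineK ?Lpfun_finite// f0.
rewrite -[RHS]Lp_funK; apply/Lp_classP.
have /Lp_classP z0 : Lp_class (Lp_fun 0) = Lp_class 0 by rewrite Lp_funK Lp_class0.
have mf := measurable_rnorm (Lpfun_measurable (Lp_fun x)).
have {}mf : measurable_fun setT (EFin \o (fun t => rnorm (Lp_fun x t))).
  exact/measurable_EFinP.
have H := Lnorm_eq0_eq0 mf (lt_le_trans lte01 p1) f0.
apply: filterS2 H z0 => t /(_ I) [] /rnorm0_eq0 -> ->.
by [].
Qed.

HB.instance Definition _ :=
  Lmodule_isNormed.Build K Lp Lp_normD Lp_normZ Lp_norm_eq0.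

Lemma rnorm_Lp f : rnorm (Lp_class f : Lp) = fine (scalar_Lnorm p f).
Proof. by rewrite [LHS]/rnorm [X in re_part X]Lp_normE of_realK. Qed.

End Lp.
End LpSpace.

Section LpInclusion.
Context {R : realType} {k : scalar_kind}.
Local Notation K := (scalars R k).
Context {d : measure_display} {T : measurableType d}.
Variable mu : {finite_measure set T -> \bar R}.
Variables (q : \bar R) (q1 : (1 <= q)%E).

Lemma Linfty_incl_subproof (f : Lpfun (k := k) mu (leey 1)) :
  Lpfun_fun f \in Lpfun_pred mu q1.
Proof.
case: f => f /= /asboolP[mf foo]; apply/asboolP; split=> //.
have fL : (fun t => rnorm (f t)) \in Lfun mu +oo%E.
  by apply/andP; split; rewrite inE//=; first [exact: measurable_rnorm | rewrite inE].
have /(_ _ fL) := Lfun_subset q1 (leey 1) (fin_num_measure mu _ measurableT) (leey q).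
by rewrite inE => /andP[_]; rewrite inE.
Qed.

Definition Linfty_incl (x : Lp (k := k) mu (leey 1)) : Lp (k := k) mu q1 :=
  Lp_class (LpFun (Linfty_incl_subproof (Lp_fun x))).

Lemma Linfty_incl_ae (x : Lp (k := k) mu (leey 1)) :
  \forall t \ae mu, Lp_fun (Linfty_incl x) t = Lp_fun x t.
Proof.
by have /Lp_classP := Lp_funK (Linfty_incl x).
Qed.

End LpInclusion.

Section OperatorIdeals.
Context {R : realType} {k : scalar_kind}.
Local Notation K := (scalars R k).

Definition lp_norm {E : normedModType K} (p : \bar R) (x : nat -> E) : \bar R :=
  Lnorm counting p (fun n => (rnorm (x n))%:E).

Definition lp_summable {E : normedModType K} (p : \bar R) : set (nat -> E) :=
  [set x | (lp_norm p x < +oo)%E].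

Definition weakly_lp_summable {E : normedModType K} (p : \bar R) : set (nat -> E) :=
  [set x : nat -> E | forall phi : dual E, lp_summable p (phi \o x : nat -> K^o)].

Definition fin_lp_norm (p : \bar R) (n : nat) (a : 'I_n -> R) : R :=
  if p is r%:E then (\sum_(i < n) a i `^ r) `^ r^-1
  else \big[Num.max/0]_(i < n) a i.

(* The classes below make sense for all normed spaces; every space to which the
   polynomial ideals apply them is complete when E and F are. *)
Definition operator_ideal :=
  forall E F : normedModType K, set (lop E F).

Definition polynomial_ideal :=
  forall (m : nat) (E F : normedModType K), set (hpoly m E F).

(* For p = 1 the coefficients range over the unit ball of c_0 instead of that
   of l_oo. *)
Definition coefficient_ball (p : R) : set (nat -> K^o) :=
  [set alpha | (lp_norm (hoelder_conjugate p%:E) alpha <= 1)%E /\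
               (p = 1 -> alpha @ \oo --> 0)].

Definition compact_ideal (p : R) : operator_ideal := fun E F =>
  [set u | exists2 y : nat -> F, lp_summable p%:E y &
     forall x, closed_unit_ball x -> exists2 alpha, coefficient_ball p alpha &
       series (fun n => alpha n *: y n) @ \oo --> u x].

Definition nuclear_ideal (p : R) : operator_ideal := fun E F =>
  [set u | exists (phi : nat -> dual E) (y : nat -> F),
     [/\ lp_summable p%:E phi,
         weakly_lp_summable (hoelder_conjugate p%:E) y &
         forall x, series (fun n => phi n x *: y n) @ \oo --> u x]].

(* [q1] is bound only because [Lp] takes a proof that its exponent is at least
   1; [bidual_embedding F (u x)] is J_F (u x). *)
Definition integral_ideal (q : R) : operator_ideal := fun E F =>
  [set u | exists (q1 : (1 <= q%:E)%E) (d : measure_display)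
      (T : measurableType d) (mu : {finite_measure set T -> \bar R})
      (a : lop E (Lp mu (leey 1))) (b : lop (Lp mu q1) (dual (dual F))),
      forall x, bidual_embedding F (u x) = b (Linfty_incl q1 (a x))].

Definition cohen_ideal (p : \bar R) : operator_ideal := fun E F =>
  [set u | exists2 C : R, 0 <= C &
     forall (n : nat) (x : 'I_n -> E) (phi : 'I_n -> dual F),
       \sum_(i < n) rnorm (phi i (u (x i))) <=
       C * fin_lp_norm p (fun i => rnorm (x i)) *
       sup [set fin_lp_norm (hoelder_conjugate p) (fun i => rnorm (phi i y))
           | y in closed_unit_ball (E := F)]].

Definition polynomial_dual (I : operator_ideal) : polynomial_ideal :=
  fun m E F => [set P | I (dual F) (hpoly m E K^o) (hpoly_adjoint P)].

Definition composition_ideal (I : operator_ideal) : polynomial_ideal :=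
  fun m E F => [set P | exists (G : completeNormedModType K)
    (Q : hpoly m E G) (u : lop G F), I G F u /\ P = lop_hpoly u Q].

Definition injective_hull (Q : polynomial_ideal) : polynomial_ideal :=
  fun m E F => [set P |
    Q m E (linf R k (dual_ball F)) (lop_hpoly (linf_embedding F) P)].

End OperatorIdeals.
Arguments operator_ideal R k : clear implicits.
Arguments polynomial_ideal R k : clear implicits.
Arguments polynomial_dual {R k} I m E F.
Arguments composition_ideal {R k} I m E F.
Arguments injective_hull {R k} Q m E F.

(* Main.v *)
(* Let X be the space of scalar m-homogeneous polynomials on E, S its unit ball
   and Q : E -> l_oo(S) the evaluation polynomial. An operator u on l_oo(S) with
   u o Q = I_F o P plays the role of the linearization of P on a projective
   symmetric tensor product, so everything reduces to operators on l_oo(S).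

   K_p: if P^* maps B_{F^*} into {sum alpha_n y_n}, write y_n = |y_n| s_n with
   s_n in S; then sum_n |y_n| delta_{s_n} (x) (alpha_n(phi))_phi is a p-nuclear u.
   Conversely, uniform boundedness makes the coefficients e_phi(y_n) of a nuclear
   factorization bounded in l_{p^*}, uniformly in phi.

   D_p: if P^* is Cohen strongly p-summing, it satisfies a Pietsch domination by a
   positive functional on the bounded functions on S. This functional is a measure
   on the space of ultrafilters on S, where bounded functions extend by limits, and
   Hahn-Banach extends the functionals psi |-> psi(P^* phi), psi in X^*, from a
   subspace of L_q to L_q, which gives the integral factorization. Conversely,
   functionals on L_oo(mu) that are dominated by the L_q norm decompose as
   eta_i = sum_j b_j(i) zeta_j with finitely many b_j in the unit ball of l_p and
   sum_j |zeta_j| <= C |eta|_p, and each zeta_j is then tested on one element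
   of X. *)

Require Import Defs.
From HB Require Import structures.
From mathcomp Require Import all_boot all_order all_algebra.
From mathcomp Require Import complex.
From mathcomp Require Import all_classical all_reals all_analysis.
From mathcomp Require Import measurable_realfun ess_sup_inf.
From mathcomp Require Import ring lra.

Set Implicit Arguments.
Unset Strict Implicit.
Unset Printing Implicit Defensive.

Import Order.TTheory GRing.Theory Num.Theory.
Import numFieldNormedType.Exports.

Local Open Scope classical_set_scope.
Local Open Scope ring_scope.

(** * Hahn-Banach theorems *)

(** [composition_ideal] asks only for some complete space G and some u with u o Q = I_F o P, so
    l_oo(S) can stand in for a tensor product and P need not be linearized canonically. The
    injective hull supplies the range l_oo(B_{F^*}), and an operator into that space is a bounded
    family of functionals indexed by a bare set. Choices made separately for each phi are therefore
    harmless, although they are not linear in phi: the coefficients alpha_n(phi) in the p-compact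
    case, the Hahn-Banach extensions in the Cohen case. The weak norm in the definition of D_p is a
    supremum over the unit ball of X, which is S itself. A functional psi on X thus enters only
    through its restriction to S, and one mean on the functions on S serves all psi, with no
    topology on S. When the mean is turned into a measure, only a domination of the mean by an
    integral is used. In the converse direction for D_p, treating finitely many functionals at a
    time makes a description of the dual of L_oo(mu) unnecessary. *)

Section HahnBanach.
Context {R : realType} {k : scalar_kind}.
Local Notation K := (scalars R k).
Implicit Types V W : lmodType K.

Definition sublinear V (q : V -> R) :=
  (forall x y, q (x + y) <= q x + q y) /\
  (forall t x, 0 <= t -> q (of_real t *: x) = t * q x).

Definition real_linear V (g : V -> R) :=
  forall t x y, g (of_real t *: x + y) = t * g x + g y.

Lemma of_realN (x : R) : of_real (- x) = - of_real x :> K.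
Proof. by case: k => //=; apply: rmorphN. Qed.

Lemma sublinear0 V (q : V -> R) : sublinear q -> q 0 = 0.
Proof. by move=> [_ /(_ 0 0 (lexx _))]; rewrite scaler0 mul0r. Qed.

Lemma sublinear_geN V (q : V -> R) x : sublinear q -> - q (- x) <= q x.
Proof.
move=> sq; have := sq.1 x (- x); rewrite subrr (sublinear0 sq) => ?.
by rewrite lerNl -subr_ge0 opprK addrC.
Qed.

(** A pair c in C encodes the constraint g c.1 >= c.2 on the linear functional g that is sought. *)
Definition cone_inf V (q : V -> R) (C : set (V * R)) (x : V) : R :=
  inf [set q (x + c.1) - c.2 | c in C].

Section ConeInf.
Variables (V : lmodType K) (q : V -> R) (C : set (V * R)).
Hypotheses (sq : sublinear q) (C0 : C (0, 0)).
Hypothesis CD : forall c d, C c -> C d -> C (c.1 + d.1, c.2 + d.2).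
Hypothesis CZ : forall t c, 0 < t -> C c -> C (of_real t *: c.1, t * c.2).
Hypothesis Cq : forall c, C c -> c.2 <= q c.1.

Let lb x : has_lbound [set q (x + c.1) - c.2 | c in C].
Proof.
exists (- q (- x)) => _ [c Cc <-].
rewrite lerBrDr (le_trans _ (_ : q c.1 - q (- x) <= _))//.
  by rewrite addrC lerB// Cq.
by rewrite lerBlDr (le_trans _ (sq.1 _ _))// addrAC subrr add0r.
Qed.

Let cone_inf_lb x c : C c -> cone_inf q C x <= q (x + c.1) - c.2.
Proof. by move=> Cc; apply: ge_inf => //; exists c. Qed.

Let cone_inf_glb x r :
  (forall c, C c -> r <= q (x + c.1) - c.2) -> r <= cone_inf q C x.
Proof.
move=> rC; apply: lb_le_inf; first by exists (q (x + 0) - 0), (0, 0).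
by move=> _ [c Cc <-]; exact: rC.
Qed.

Lemma cone_inf_sublinear : sublinear (cone_inf q C).
Proof.
split=> [x y|t x]; last rewrite le_eqVlt => /predU1P[<-|t0].
- rewrite -lerBlDr; apply: cone_inf_glb => c Cc.
  rewrite lerBlDr -lerBlDl; apply: cone_inf_glb => d Cd.
  rewrite lerBlDl (le_trans (cone_inf_lb _ (CD Cc Cd)))//=.
  by rewrite [leRHS]addrACA -opprD lerD2r addrACA; exact: sq.1.
- rewrite of_real0 scale0r mul0r; apply/eqP; rewrite eq_le; apply/andP; split.
    by rewrite (le_trans (cone_inf_lb _ C0))//= subr0 addr0 (sublinear0 sq).
  by apply: cone_inf_glb => c Cc; rewrite add0r subr_ge0 Cq.
- apply/eqP; rewrite eq_le; apply/andP; split.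
    rewrite -ler_pdivrMl//; apply: cone_inf_glb => c Cc.
    rewrite ler_pdivrMl//.
    apply: le_trans (cone_inf_lb _ (CZ t0 Cc)) _ => /=.
    by rewrite -scalerDr sq.2 ?(ltW t0)// mulrBr.
  apply: cone_inf_glb => c Cc.
  have ti0 : 0 < t^-1 by rewrite invr_gt0.
  rewrite -ler_pdivlMl//; apply: le_trans (cone_inf_lb _ (CZ ti0 Cc)) _ => /=.
  rewrite mulrBr -sq.2 ?(ltW ti0)// scalerDr scalerA -of_realM mulVf ?gt_eqF//.
  by rewrite of_real1 scale1r.
Qed.

Lemma cone_inf_le x : cone_inf q C x <= q x.
Proof. by rewrite (le_trans (cone_inf_lb _ C0))//= subr0 addr0. Qed.

Lemma cone_inf_oppr c : C c -> cone_inf q C (- c.1) <= - c.2.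
Proof.
by move=> Cc; rewrite (le_trans (cone_inf_lb _ Cc))// addNr (sublinear0 sq) sub0r.
Qed.

End ConeInf.

(** Zorn for the reversed pointwise order. A chain is bounded by its pointwise infimum, which is
    finite because every sublinear h <= q satisfies h x >= - q (- x). *)
Lemma minimal_sublinear V (q : V -> R) : sublinear q ->
  exists2 g, sublinear g /\ (forall x, g x <= q x) &
    forall h, sublinear h -> (forall x, h x <= g x) -> h = g.
Proof.
move=> sq; pose T := {h : V -> R | sublinear h /\ forall x, h x <= q x}.
pose leT (s t : T) := `[< forall x, sval t x <= sval s x >].
have [|r s t /asboolP rs /asboolP st|[s Hs] [t Ht] /asboolP st /asboolP ts|A totA|] := @Zorn T leT.
- by move=> t; apply/asboolP.
- by apply/asboolP => x; exact: le_trans (st x) (rs x).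
- by apply: eq_exist; apply/funext => x; apply/eqP; rewrite eq_le ts st.
- have [->|/set0P[s0 As0]] := eqVneq A set0; first by exists (exist _ q (conj sq (fun=> lexx _))).
  pose B x := [set sval s x | s in A].
  have lbB x : has_lbound (B x).
    exists (- q (- x)) => _ [s As <-]; case: (svalP s) => ss sleq.
    by rewrite (le_trans _ (sublinear_geN x ss))// lerN2.
  have B0 x : B x !=set0 by exists (sval s0 x), s0.
  have Ble s x : A s -> inf (B x) <= sval s x by move=> As; apply: ge_inf => //; exists s.
  have leB x r : (forall s, A s -> r <= sval s x) -> r <= inf (B x).
    by move=> h; apply: lb_le_inf => // _ [s As <-]; exact: h.
  have sB : sublinear (fun x => inf (B x)).
    split=> [x y|t x].
      rewrite -lerBlDr; apply: (leB) => s As; rewrite lerBlDr -lerBlDl.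
      apply: (leB) => s' As'; rewrite lerBlDl.
      (* Of two members of the chain, the smaller one serves both summands. *)
      have [/asboolP ss'|/asboolP ss'] := totA _ _ As As'.
        rewrite (le_trans (Ble _ _ As'))// (le_trans ((svalP s').1.1 _ _))//.
        by rewrite lerD2r.
      rewrite (le_trans (Ble _ _ As))// (le_trans ((svalP s).1.1 _ _))//.
      by rewrite lerD2l.
    rewrite le_eqVlt => /predU1P[<-|t0].
      rewrite of_real0 scale0r mul0r; apply/eqP; rewrite eq_le; apply/andP; split.
        by rewrite (le_trans (Ble _ _ As0))// (sublinear0 (svalP s0).1).
      by apply: (leB) => s As; rewrite (sublinear0 (svalP s).1).
    apply/eqP; rewrite eq_le; apply/andP; split.
      rewrite -ler_pdivrMl//; apply: (leB) => s As; rewrite ler_pdivrMl//.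
      by rewrite (le_trans (Ble _ _ As))// (svalP s).1.2 ?(ltW t0).
    apply: (leB) => s As; rewrite (svalP s).1.2 ?(ltW t0)//.
    by rewrite ler_wpM2l ?(ltW t0)// Ble.
  have Bq x : inf (B x) <= q x by rewrite (le_trans (Ble _ _ As0))// (svalP s0).2.
  pose b : T := exist _ (fun x => inf (B x)) (conj sB Bq).
  exists b => s As; apply/asboolP => x /=; exact: Ble.
- move=> [g [sg gq]] gmax; exists g => // h sh hg.
  have hq x : h x <= q x := le_trans (hg x) (gq x).
  have /(_ _)/(congr1 sval) := gmax (exist _ h (conj sh hq)).
  by apply; apply/asboolP.
Qed.

(** For the ray C generated by (y, g y), [cone_inf g C] is sublinear and below g, hence equal to g.
    Its value at x is at most g (x + y) - g y, which is the missing half of additivity. *)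
Lemma minimal_sublinear_linear V (g : V -> R) : sublinear g ->
  (forall h, sublinear h -> (forall x, h x <= g x) -> h = g) -> real_linear g.
Proof.
move=> sg gmin.
have gD x y : g (x + y) = g x + g y.
  pose C := [set c : V * R | exists2 t, 0 <= t & c = (of_real t *: y, t * g y)].
  have C0 : C (0, 0) by exists 0; rewrite // of_real0 scale0r mul0r.
  have CD c d : C c -> C d -> C (c.1 + d.1, c.2 + d.2).
    move=> [t t0 ->] [u u0 ->] /=; exists (t + u); first exact: addr_ge0.
    by rewrite of_realD scalerDl mulrDl.
  have CZ t c : 0 < t -> C c -> C (of_real t *: c.1, t * c.2).
    move=> t0 [u u0 ->] /=; exists (t * u); first exact: mulr_ge0 (ltW _) _.
    by rewrite of_realM scalerA mulrA.
  have Cg c : C c -> c.2 <= g c.1 by move=> [t t0 ->] /=; rewrite sg.2.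
  have hg := gmin _ (cone_inf_sublinear sg C0 CD CZ Cg) (cone_inf_le sg C0 Cg).
  apply/eqP; rewrite eq_le sg.1 /= -lerBrDr -{1}hg.
  have Cy : C (y, g y) by exists 1; rewrite ?ler01// of_real1 scale1r mul1r.
  apply: ge_inf; last by exists (y, g y).
  exists (- g (- x)) => _ [c Cc <-].
  rewrite lerBrDr (le_trans _ (_ : g c.1 - g (- x) <= _))//.
    by rewrite addrC lerB// Cg.
  by rewrite lerBlDr (le_trans _ (sg.1 _ _))// addrAC subrr add0r.
have gN x : g (- x) = - g x.
  by apply/eqP; rewrite -subr_eq0 opprK -gD addNr (sublinear0 sg).
move=> t x y; rewrite gD; congr (_ + _).
have [t0|t0] := leP 0 t; first exact: sg.2.
have [u u0 ->] : exists2 u, 0 <= u & t = - u.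
  by exists (- t); rewrite ?opprK// oppr_ge0 ltW.
by rewrite of_realN scaleNr gN sg.2// mulNr.
Qed.

(* Mazur-Orlicz: the sublinear functional [x |-> inf_(c in C) q (x + c.1) - c.2]
   dominates a linear functional, and any such functional works. *)
Theorem mazur_orlicz V (q : V -> R) (C : set (V * R)) : sublinear q ->
  C (0, 0) ->
  (forall c d, C c -> C d -> C (c.1 + d.1, c.2 + d.2)) ->
  (forall t c, 0 < t -> C c -> C (of_real t *: c.1, t * c.2)) ->
  (forall c, C c -> c.2 <= q c.1) ->
  exists g : V -> R, [/\ real_linear g, forall x, g x <= q x &
    forall c, C c -> c.2 <= g c.1].
Proof.
move=> sq C0 CD CZ Cq; have sC := cone_inf_sublinear sq C0 CD CZ Cq.
have [g [sg gC] gmin] := minimal_sublinear sC.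
have lg := minimal_sublinear_linear sg gmin.
exists g; split=> // [x|c Cc].
  by rewrite (le_trans (gC x))// cone_inf_le.
have g0 := sublinear0 sg.
rewrite -lerN2 (le_trans _ (cone_inf_oppr sq Cq Cc))// (le_trans _ (gC _))//.
have := lg (-1) c.1 0.
by rewrite of_realN of_real1 scaleN1r addr0 mulN1r g0 addr0 => ->.
Qed.

(** The subspace is given as the image of L, and f <= p o L makes f factor through it. The
    constraints are the graph of f; those at w and - w together force equality. *)
Lemma hahn_banach_real V W (p : V -> R) (L : W -> V) (f : W -> R) :
  sublinear p -> linear L -> real_linear f -> (forall w, f w <= p (L w)) ->
  exists g : V -> R, [/\ real_linear g, forall w, g (L w) = f w &
    forall x, g x <= p x].
Proof.
move=> sp linL lf fp.
have L0 : L 0 = 0 by have := linL (-1) 0 0; rewrite scaleN1r addNr scaleN1r addNr.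
have f0 : f 0 = 0.
  by have := lf 1 0 0; rewrite scaler0 addr0 mul1r => /(canLR (addrK _)); rewrite subrr.
have LN w : L (- w) = - L w by have := linL (-1) w 0; rewrite !scaleN1r !addr0 L0 addr0.
have rN (U : lmodType K) (h : U -> R) : real_linear h -> forall u, h (- u) = - h u.
  move=> lh u; have := lh (-1) u 0; rewrite of_realN of_real1 scaleN1r mulN1r addr0 => ->.
  by have := lh 1 0 0; rewrite scaler0 addr0 mul1r => /(canLR (addrK _)); rewrite subrr => <-;
  rewrite addr0.
pose C := [set c : V * R | exists w, c = (L w, f w)].
have [||||g [lg gp gC]] := @mazur_orlicz V p C sp.
- by exists 0; rewrite L0 f0.
- move=> _ _ [v ->] [w ->] /=; exists (v + w).
  have := linL 1 v w; rewrite !scale1r => ->.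
  by have := lf 1 v w; rewrite of_real1 scale1r mul1r => ->.
- move=> t _ t0 [w ->] /=; exists (of_real t *: w).
  have := linL (of_real t) w 0; rewrite !addr0 L0 addr0 => ->.
  by have := lf t w 0; rewrite addr0 f0 addr0 => ->.
- by move=> _ [w ->] /=.
- exists g; split=> // w; apply/eqP; rewrite eq_le.
  have /= -> := gC (L w, f w) (ex_intro _ w erefl); rewrite andbT.
  have /= := gC (L (- w), f (- w)) (ex_intro _ (- w) erefl).
  by rewrite LN !rN// lerN2.
Qed.

End HahnBanach.

(** * Scalars, phases and Hahn-Banach over K *)

Section ScalarFacts.
Context {R : realType} {k : scalar_kind}.
Local Notation K := (scalars R k).
Implicit Types (a b z : K) (r : R).

Lemma rnormM a b : rnorm (a * b : K^o) = rnorm (a : K^o) * rnorm (b : K^o).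
Proof. by rewrite -rnormZ. Qed.

Lemma rnorm_of_real r : rnorm (of_real r : K^o) = `|r|.
Proof.
rewrite /rnorm; case: k => //=.
by rewrite expr0n addr0 sqrtr_sqr.
Qed.

Lemma re_part_of_real r : re_part (of_real r : K) = r.
Proof. exact: of_realK. Qed.

Lemma im_part_of_real r : im_part (of_real r : K) = 0.
Proof. by case: k. Qed.

Lemma re_partB a b : re_part (a - b) = re_part a - re_part b.
Proof.
rewrite re_partD; congr (_ + _); apply/eqP.
by rewrite -addr_eq0 -re_partD addNr -(@of_real0 R k) re_part_of_real.
Qed.

Lemma im_partB a b : im_part (a - b) = im_part a - im_part b.
Proof.
rewrite im_partD; congr (_ + _); apply/eqP.
by rewrite -addr_eq0 -im_partD addNr -(@of_real0 R k) im_part_of_real.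
Qed.

Lemma rnorm1 : rnorm (1 : K^o) = 1.
Proof. by rewrite -(@of_real1 R k) rnorm_of_real normr1. Qed.

Lemma rnorm_re_im z : rnorm (z : K^o) <= `|re_part z| + `|im_part z|.
Proof.
rewrite rnorm_scalarE -[leRHS]ger0_norm ?addr_ge0// -sqrtr_sqr ler_wsqrtr//.
rewrite sqrrD !real_normK ?num_real// -addrA lerD2l addrC lerDl.
by rewrite mulrn_wge0// mulr_ge0.
Qed.

Lemma norm_re_le z : `|re_part z| <= rnorm (z : K^o).
Proof. by rewrite rnorm_scalarE -sqrtr_sqr ler_wsqrtr// lerDl sqr_ge0. Qed.

Lemma norm_im_le z : `|im_part z| <= rnorm (z : K^o).
Proof. by rewrite rnorm_scalarE -sqrtr_sqr ler_wsqrtr// lerDr sqr_ge0. Qed.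

Lemma phase z : exists2 c : K, rnorm (c : K^o) <= 1 &
  c * z = of_real (rnorm (z : K^o)).
Proof.
have [->|z0] := eqVneq z 0.
  by exists 0; rewrite ?mulr0 ?rnorm0 ?of_real0.
have nz0 : rnorm (z : K^o) != 0 by apply: contra z0 => /eqP/rnorm0_eq0 ->.
exists (of_real (rnorm (z : K^o)) / z); last by rewrite divfK.
have /eqP := rnormM (of_real (rnorm (z : K^o)) / z) z.
rewrite divfK// rnorm_of_real ger0_norm ?rnorm_ge0// -{1}[rnorm _]mul1r.
by rewrite (inj_eq (mulIf nz0)) => /eqP <-.
Qed.

Lemma rnormN (E : normedModType K) (x : E) : rnorm (- x) = rnorm x.
Proof. by rewrite /rnorm normrN. Qed.

Lemma rnorm_sum (E : normedModType K) (I : finType) (f : I -> E) :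
  rnorm (\sum_i f i) <= \sum_i rnorm (f i).
Proof.
elim/big_ind2 : _ => [|x1 x2 y1 y2 xy1 xy2|//]; first by rewrite rnorm0.
by rewrite (le_trans (ler_rnormD _ _))// lerD.
Qed.

Lemma lopZ (E F : normedModType K) (u : lop E F) a x : u (a *: x) = a *: u x.
Proof. by rewrite lop_homogeneous expr1. Qed.

Lemma lop0 (E F : normedModType K) (u : lop E F) : u 0 = 0.
Proof. by have := lopZ u 0 0; rewrite !scale0r. Qed.

Lemma lopD (E F : normedModType K) (u : lop E F) x y : u (x + y) = u x + u y.
Proof. by have := lop_linear u 1 x y; rewrite !scale1r. Qed.

Lemma lop_sum (E F : normedModType K) (u : lop E F) (I : finType) (f : I -> E) :
  u (\sum_i f i) = \sum_i u (f i).
Proof. exact: (big_morph u (lopD u) (lop0 u)). Qed.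

End ScalarFacts.

Section HahnBanachScalars.
Context {R : realType}.

(** The real part of f is extended first. A K-linear functional is determined by its real part g,
    over the complex numbers by h v = g v - i g (i v). *)
Theorem hahn_banach {k : scalar_kind} (V W : lmodType (scalars R k))
    (p : V -> R) (L : W -> V) (f : W -> (scalars R k)^o) :
  (forall x y, p (x + y) <= p x + p y) ->
  (forall a x, p (a *: x) = rnorm (a : (scalars R k)^o) * p x) ->
  linear L -> linear f -> (forall w, rnorm (f w) <= p (L w)) ->
  exists g : V -> (scalars R k)^o, [/\ linear g, forall w, g (L w) = f w &
    forall x, rnorm (g x) <= p x].
Proof.
move=> pD pZ linL linf fp.
have p_ge0 x : 0 <= p x.
  have := pD x (- x).
  rewrite subrr -(scale0r 0) pZ rnorm0 mul0r -scaleN1r pZ.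
  rewrite -(@of_real1 R k) -of_realN rnorm_of_real normrN1 mul1r -mulr2n.
  by rewrite pmulrn_lge0.
have sp : sublinear p.
  by split=> // t x t0; rewrite pZ rnorm_of_real ger0_norm.
have rf : real_linear (re_part \o f).
  by move=> t x y; rewrite /= linf re_partD re_partM re_part_of_real im_part_of_real mul0r subr0.
have rfp w : (re_part \o f) w <= p (L w).
  by rewrite (le_trans _ (fp w))// (le_trans (ler_norm _))// norm_re_le.
have [g [lg gL gp]] := hahn_banach_real sp linL rf rfp.
(* Rotating h x to a nonnegative real number reduces the bound on its norm to the bound on its real
   part. *)
suff [h [lh hg hf]] : exists h : V -> (scalars R k)^o, [/\ linear h,
    forall v, re_part (h v) = g v & forall w, h (L w) = f w].
  exists h; split=> // x; have [c c1 hc] := phase (h x).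
  rewrite -[rnorm _](@re_part_of_real R k) -hc.
  have h0 : h 0 = 0 by have := lh (-1) 0 0; rewrite scaleN1r addNr scaleN1r addNr.
  have -> : c * h x = h (c *: x) by have := lh c x 0; rewrite addr0 h0 addr0 => ->.
  by rewrite hg (le_trans (gp _))// pZ ler_piMl.
clear p_ge0.
case: k V W p L f pD pZ linL linf fp sp rf rfp g lg gL gp => /=.
  move=> V W p L f _ _ _ linf _ _ _ _ g lg gL gp; exists g; split=> //.
move=> V W p L f _ _ linL linf _ _ _ _ g lg gL gp.
have g0 : g 0 = 0.
  by have := lg 1 0 0; rewrite scaler0 addr0 mul1r => /(canLR (addrK _)); rewrite subrr.
have gN x : g (- x) = - g x.
  have := lg (-1) x 0; rewrite !addr0 g0 addr0 mulN1r => <-; congr g.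
  by rewrite of_realN of_real1 scaleN1r.
have gD x y : g (x + y) = g x + g y.
  by have := lg 1 x y; rewrite of_real1 scale1r mul1r.
have gZ t x : g (t%:C%C *: x) = t * g x.
  by have := lg t x 0; rewrite !addr0 g0 addr0.
have gsplit a x : g (a *: x) = complex.Re a * g x + complex.Im a * g ('i%C *: x).
  case: a => a b /=; rewrite -!gZ -gD scalerA -scalerDl; congr (g (_ *: _)).
  by simpc.
exists (fun v => (g v +i* - g ('i%C *: v))%C); split=> //.
- move=> a x y; rewrite scalerDr scalerA !gD (gsplit (_ * _)) (gsplit a x).
  case: a => a b; rewrite /GRing.scale /=; simpc; congr (_ +i* _)%C.
  by rewrite [X in X - _]addrC.
- move=> w; have L0 : L 0 = 0 by have := linL (-1) 0 0; rewrite scaleN1r addNr scaleN1r addNr.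
  have -> : 'i%C *: L w = L ('i%C *: w) by have := linL 'i%C w 0; rewrite addr0 L0 addr0 => ->.
  rewrite !gL /=; have f0 : f 0 = 0 by have := linf (-1) 0 0; rewrite scaleN1r addNr scaleN1r addNr.
  have -> : f ('i%C *: w) = 'i%C * f w by have := linf 'i%C w 0; rewrite !addr0 f0 addr0 => ->.
  by case: (f w) => a b; simpc.
Qed.

End HahnBanachScalars.

(** * Polarization and the universal homogeneous polynomial *)

Section Polarization.
Context {R : realType} {k : scalar_kind}.
Local Notation K := (scalars R k).

Definition fcons {m} {T : Type} (u : T) (x : 'I_m -> T) (j : 'I_m.+1) : T :=
  if unlift ord0 j is Some i then x i else u.

Lemma big_ffun_recl (V : nmodType) m (I : finType) (G : ('I_m.+1 -> I) -> V) :
  \sum_(f : {ffun 'I_m.+1 -> I}) G f =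
  \sum_(i : I) \sum_(g : {ffun 'I_m -> I}) G (fcons i g).
Proof.
rewrite pair_big /=; pose h (p : I * {ffun 'I_m -> I}) := 
  [ffun j : 'I_m.+1 => fcons p.1 p.2 j].
rewrite (reindex h); last first.
  exists (fun f : {ffun 'I_m.+1 -> I} => (f ord0, [ffun j : 'I_m => f (lift ord0 j)]))
    => [[i g]|f] _ /=.
    rewrite /h; congr pair; first by rewrite ffunE /fcons unlift_none.
    by apply/ffunP => j; rewrite !ffunE /fcons liftK.
  apply/ffunP => j; rewrite /h ffunE /fcons /=.
  by case: unliftP => [j'|] ->; rewrite ?ffunE.
by apply: eq_bigr => p _; congr G; apply/funext => j; rewrite ffunE.
Qed.

Lemma multilinear_sum m (E F : normedModType K) (A : ('I_m -> E) -> F)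
    (I : finType) (c : 'I_m -> I -> K) (x : 'I_m -> I -> E) :
  multilinear A ->
  A (fun j => \sum_i c j i *: x j i) =
  \sum_(f : {ffun 'I_m -> I}) (\prod_j c j (f j)) *: A (fun j => x j (f j)).
Proof.
elim: m A c x => [|m IH] A c x mA.
  rewrite (big_pred1 (ffun0 (card_ord 0))).
    by rewrite big_ord0 scale1r; congr A; apply/funext => -[].
  by move=> f; apply/esym/eqP/ffunP => -[].
pose Y := fun j => \sum_i c j i *: x j i.
pose Y' := fun j => Y (lift ord0 j).
have consE T (u : 'I_m.+1 -> T) : u = fcons (u ord0) (fun j => u (lift ord0 j)).
  by apply/funext => j; rewrite /fcons; case: unliftP => [j'|] ->.
have lin0 : linear (fun u => A (fcons u Y')).
  have := mA ord0 Y.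
  rewrite (_ : (fun u => A (fun j => _)) = fun u => A (fcons u Y'))//.
  apply/funext => u; congr A; apply/funext => j; rewrite /fcons /Y'.
  by case: unliftP => [j'|] ->.
have A0 : A (fcons 0 Y') = 0.
  by have := lin0 (-1) 0 0; rewrite scaleN1r addNr scaleN1r addNr.
have Asum (r : seq I) : A (fcons (\sum_(i <- r) c ord0 i *: x ord0 i) Y') =
    \sum_(i <- r) c ord0 i *: A (fcons (x ord0 i) Y').
  elim: r => [|i r IHr]; first by rewrite !big_nil.
  by rewrite !big_cons lin0 IHr.
rewrite [X in A X]consE Asum.
rewrite (big_ffun_recl (fun f => (\prod_j c j (f j)) *: A (fun j => x j (f j)))).
apply: eq_bigr => i _.
rewrite (IH (fun z => A (fcons (x ord0 i) z))
  (fun j => c (lift ord0 j)) (fun j => x (lift ord0 j))); last first.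
  move=> j z; have := mA (lift ord0 j) (fcons (x ord0 i) z).
  rewrite (_ : (fun u => A (fun _ => _)) = fun u => A (fcons (x ord0 i)
    (fun j' => if j' == j then u else z j')))//.
  apply/funext => u; congr A; apply/funext => l; rewrite /fcons.
  case: unliftP => [j'|] -> //.
rewrite scaler_sumr; apply: eq_bigr => f _; rewrite scalerA; congr (_ *: A _).
  rewrite big_ord_recl /fcons unlift_none; congr (_ * _).
  by apply: eq_bigr => j _; rewrite liftK.
by apply/funext => j; rewrite /fcons; case: unliftP => [j'|] ->.
Qed.

(** The m-th difference of P at 0, which is m! times the symmetric form of P. The form in [is_hpoly]
    comes without a norm bound; this expression involves P alone and is controlled by its norm. *)
Definition polarization m (E F : normedModType K) (P : E -> F) (x : 'I_m -> E) : F :=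
  \sum_(e : {ffun 'I_m -> bool})
    (\prod_i (-1) ^+ (~~ e i)) *: P (\sum_i (e i)%:R *: x i).

(* The permutations of 'I_m, in the form that the sign sum of [polarization]
   detects. *)
Definition surjections m : {set {ffun 'I_m -> 'I_m}} :=
  [set f : {ffun 'I_m -> 'I_m} | [forall i, exists j, f j == i]].

Lemma surjections_inj m f : f \in surjections m -> injective f.
Proof.
rewrite inE => /forallP sf.
pose g i := xchoose (existsP (sf i)).
have gK i : f (g i) = i by apply/eqP; exact: (xchooseP (existsP (sf i))).
have [h hK Kh] := injF_bij (can_inj gK).
by move=> a b; rewrite -(Kh a) -(Kh b) !gK => ->.
Qed.

Lemma card_surjections m : (0 < #|surjections m|)%N.
Proof.
apply/card_gt0P; exists [ffun i => i]; rewrite inE.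
by apply/forallP => i; apply/existsP; exists i; rewrite ffunE.
Qed.

(** Grouping the factors by the fibres of f, the sum over e becomes a product over i of 1 - 0 ^ (n
    i), where n i is the size of the fibre over i. It vanishes as soon as one fibre is empty. *)
Lemma surjection_coef m (f : {ffun 'I_m -> 'I_m}) :
  \sum_(e : {ffun 'I_m -> bool})
    (\prod_i (-1) ^+ (~~ e i)) * (\prod_j (e (f j))%:R) =
  (f \in surjections m)%:R :> K.
Proof.
pose n i := #|[pred j | f j == i]|.
have cnt (e : {ffun 'I_m -> bool}) :
    \prod_j (e (f j))%:R = \prod_i (e i)%:R ^+ n i :> K.
  rewrite (partition_big f predT)//=; apply: eq_bigr => i _.
  by rewrite -prodr_const; apply: eq_big => // j /eqP ->.
under eq_bigr => e _ do rewrite cnt -big_split /=.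
rewrite -(bigA_distr_bigA (fun i (b : bool) => (-1) ^+ (~~ b) * b%:R ^+ n i : K)).
transitivity (\prod_(i : 'I_m) (n i != 0)%:R : K).
  apply: eq_bigr => i _; rewrite big_bool /= expr0 mul1r expr1n expr1 expr0n.
  by case: (n i) => [|?]; rewrite /= ?mulr1 ?subrr// mulr0 addr0.
have [|nf] := boolP (f \in surjections m).
  rewrite inE => /forallP sf; rewrite big1// => i _; rewrite -lt0n.
  suff -> : (0 < n i)%N by [].
  by apply/card_gt0P; have /existsP[j fj] := sf i; exists j.
move: nf; rewrite inE => /forallPn[i /existsPn fi].
by rewrite (bigD1 i)//= [n i](eq_card0 _) ?mul0r// => j; apply/negbTE/fi.
Qed.

Lemma polarizationE m (E F : normedModType K) (P : E -> F) (A : ('I_m -> E) -> F) :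
  multilinear A -> (forall x, P x = A (fun=> x)) ->
  forall x, polarization P x =
    \sum_(f in surjections m) A (fun j => x (f j)).
Proof.
move=> mA PA x; rewrite /polarization.
transitivity (\sum_(e : {ffun 'I_m -> bool}) \sum_(f : {ffun 'I_m -> 'I_m})
    ((\prod_i (-1) ^+ (~~ e i)) * (\prod_j (e (f j))%:R)) *: A (fun j => x (f j))).
  apply: eq_bigr => e _; rewrite PA.
  rewrite (multilinear_sum (fun _ i => (e i)%:R) (fun _ i => x i) mA) scaler_sumr.
  by apply: eq_bigr => f _; rewrite scalerA.
rewrite exchange_big /= [RHS]big_mkcond; apply: eq_bigr => f _.
by rewrite -scaler_suml surjection_coef; case: ifP; rewrite ?scale1r ?scale0r.
Qed.

(** A permutation takes the value i at exactly one place j0, so each summand depends on the i-th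
    argument through one slot of A. *)
Lemma polarization_multilinear m (E F : normedModType K) (P : E -> F)
    (A : ('I_m -> E) -> F) :
  multilinear A -> (forall x, P x = A (fun=> x)) -> multilinear (@polarization m E F P).
Proof.
move=> mA PA i x a u v; rewrite !(polarizationE mA PA) scaler_sumr -big_split /=.
apply: eq_bigr => f fS; have /forallP/(_ i)/existsP[j0 /eqP fj0] : [forall i, exists j, f j == i].
  by move: fS; rewrite inE.
have fE w : (fun j => if f j == i then w else x (f j)) =
            (fun j => if j == j0 then w else x (f j)).
  by apply/funext => j; rewrite -fj0 (inj_eq (surjections_inj fS)).
by rewrite !fE (mA j0 (fun j => x (f j))).
Qed.

Lemma polarization_diag m (E F : normedModType K) (P : E -> F)
    (A : ('I_m -> E) -> F) :
  multilinear A -> (forall x, P x = A (fun=> x)) ->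
  forall x, (#|surjections m|%:R)^-1 *: polarization P (fun _ : 'I_m => x) = P x.
Proof.
move=> mA PA x; rewrite (polarizationE mA PA) sumr_const -PA -[P x *+ _]scaler_nat scalerA.
by rewrite mulVf ?scale1r// pnatr_eq0 -lt0n card_surjections.
Qed.

Lemma locally_lipschitz_continuous (E F : normedModType K) (f : E -> F) x (C : R) :
  (forall y, rnorm (x - y) <= 1 -> rnorm (f x - f y) <= C * rnorm (x - y)) ->
  {for x, continuous f}.
Proof.
move=> fC; apply/cvgrPdist_le => /= e e0.
pose M : R := `|C| + 1.
have M0 : 0 < of_real M :> K.
  by rewrite lt_neqAle -!(@of_real0 R k) ler_of_real (inj_eq of_real_inj) -lt_neqAle ltr_wpDl.
near=> y.
have xy1 : rnorm (x - y) <= 1.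
  rewrite rnorm_le of_real1.
  by near: y; apply: (@cvgr_dist_le _ _ _ (nbhs x) _ id x).
rewrite -of_real_rnorm (le_trans (y := of_real (M * rnorm (x - y))))//.
  rewrite ler_of_real (le_trans (fC _ xy1))// ler_wpM2r ?rnorm_ge0//.
  by rewrite (le_trans (ler_norm _))// lerDl.
rewrite of_realM of_real_rnorm mulrC -ler_pdivlMr//.
by near: y; apply: (@cvgr_dist_le _ _ _ (nbhs x) _ id x) => //; rewrite divr_gt0.
Unshelve. all: by end_near. Qed.

(** The arguments x are replaced by y one at a time through the hybrids B n. Consecutive hybrids
    differ in one slot, in which A is linear, and the m differences telescope. *)
Lemma multilinear_diag_continuous m (E F : normedModType K)
    (A : ('I_m -> E) -> F) (c : R) : multilinear A ->
  (forall x, rnorm (A x) <= c * (\sum_i rnorm (x i)) ^+ m) ->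
  continuous (fun x => A (fun=> x)).
Proof.
move=> mA Ac x; pose r := rnorm x + 1.
have r1 : 1 <= r by rewrite lerDr rnorm_ge0.
have r0 : 0 <= r by rewrite (le_trans ler01).
pose M := `|c| * (m%:R * r) ^+ m.
apply: (@locally_lipschitz_continuous _ _ _ _ (m%:R * M)) => y xy.
have yr : rnorm y <= r.
  rewrite -[y](subrK x) (le_trans (ler_rnormD _ _))// addrC lerD2l.
  by rewrite -(rnormN (y - x)) opprB.
have xr : rnorm x <= r by rewrite lerDl.
pose B n : 'I_m -> E := fun i => if (i < n)%N then y else x.
have Br n i : rnorm (B n i) <= r by rewrite /B; case: ifP.
have A_le z : (forall i, rnorm (z i) <= r) -> rnorm (A z) <= M.
  move=> zr; rewrite (le_trans (Ac z))// (le_trans (y := `|c| * (\sum_i rnorm (z i)) ^+ m))//.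
    by rewrite ler_wpM2r ?exprn_ge0 ?sumr_ge0 ?ler_norm// => i _; exact: rnorm_ge0.
  rewrite ler_wpM2l// lerXn2r ?nnegrE ?sumr_ge0 ?mulr_ge0//.
    by move=> i _; exact: rnorm_ge0.
  by rewrite (le_trans (ler_sum _ (fun i _ => zr i)))// sumr_const card_ord mulr_natl.
have step (n : 'I_m) : rnorm (A (B n) - A (B n.+1)) <= M * rnorm (x - y).
  pose h u := A (fun j => if j == n then u else B n j).
  have lh : linear h by exact: mA.
  have BSn : B n.+1 = fun j => if j == n then y else B n j.
    by apply/funext => j; rewrite /B ltnS leq_eqVlt -val_eqE /=; case: eqVneq.
  have Bn : B n = fun j => if j == n then x else B n j.
    by apply/funext => j; case: eqVneq => // ->; rewrite /B ltnn.
  rewrite BSn [X in A X - _]Bn -/(h x) -/(h y).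
  have -> : h x - h y = h (x - y).
    by have := lh (-1) y x; rewrite !scaleN1r ![- _ + _]addrC => ->.
  have h0 : h 0 = 0 by have := lh (-1) 0 0; rewrite scaleN1r addNr scaleN1r addNr.
  have [->|xy0] := eqVneq (x - y) 0; first by rewrite h0 !rnorm0 mulr0.
  have nxy0 : `|x - y| != 0 by rewrite normr_eq0.
  (* The slot is filled with the unit vector along x - y, so all arguments keep norm at most r, as r
     >= 1. *)
  rewrite -{1}[x - y]scale1r -(divff nxy0) -scalerA.
  have := lh `|x - y| (`|x - y|^-1 *: (x - y)) 0; rewrite !addr0 h0 addr0 => ->.
  rewrite rnormZ mulrC -of_real_rnorm rnorm_of_real ger0_norm ?rnorm_ge0//.
  rewrite ler_wpM2r ?rnorm_ge0// A_le// => i; case: ifP => _ //.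
  rewrite (le_trans _ r1)// of_real_rnorm rnorm_le normrZ normrV ?unitfE//.
  by rewrite normr_id mulVf// of_real1.
have tele n : (n <= m)%N ->
    rnorm (A (B 0%N) - A (B n)) <= n%:R * (M * rnorm (x - y)).
  elim: n => [_|n IHn nm]; first by rewrite subrr rnorm0 mul0r.
  rewrite -[A (B 0%N)](subrK (A (B n))) -addrA (le_trans (ler_rnormD _ _))//.
  by rewrite -natr1 mulrDl mul1r lerD ?IHn ?(ltnW nm)// (step (Ordinal nm)).
have := tele m (leqnn m); rewrite mulrA; congr (rnorm (A _ - A _) <= _).
by apply/funext => i; rewrite /B ltn_ord.
Qed.

End Polarization.

(** * Completeness of l_oo(S) and of dual spaces *)

Section Completeness.
Context {R : realType} {k : scalar_kind}.
Local Notation K := (scalars R k).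

Lemma of_real_gt0 (e : R) : (0 < of_real e :> K) = (0 < e).
Proof. by rewrite !lt_def -!(@of_real0 R k) ler_of_real (inj_eq of_real_inj). Qed.

Lemma gt0_of_real (e : K) : 0 < e -> exists2 r : R, 0 < r & e = of_real r.
Proof.
move=> e0; exists (re_part e); last by rewrite re_partK// ltW.
by rewrite -of_real_gt0 re_partK// ltW.
Qed.

Lemma normr_lt_of_real (E : normedModType K) (x : E) (e : R) :
  (`|x| < of_real e) = (rnorm x < e).
Proof.
by rewrite -of_real_rnorm !lt_def ler_of_real (inj_eq of_real_inj).
Qed.

Definition rcauchy (E : normedModType K) (T : Type) (F : set_system T) (h : T -> E) :=
  forall e : R, 0 < e -> exists z, F [set t | rnorm (h t - z) <= e].

Definition rcvg (E : normedModType K) (T : Type) (F : set_system T) (h : T -> E) (z : E) :=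
  forall e : R, 0 < e -> F [set t | rnorm (h t - z) <= e].

Lemma rcvg_cvg (E : normedModType K) (T : Type) (F : set_system T) (h : T -> E) z :
  Filter F -> rcvg F h z -> h @ F --> z.
Proof.
move=> FF hz; apply/cvgrPdist_le => /= e /gt0_of_real[r r0 ->].
by apply: filterS (hz _ r0) => t /=; rewrite distrC -rnorm_le.
Qed.

Lemma cvg_rcvg (E : normedModType K) (T : Type) (F : set_system T) (h : T -> E) z :
  Filter F -> h @ F --> z -> rcvg F h z.
Proof.
move=> FF /cvgrPdist_le hz e e0; have e0' : 0 < of_real e :> K by rewrite of_real_gt0.
by apply: filterS (hz _ e0') => t /=; rewrite distrC -rnorm_le.
Qed.

Lemma complete_of_rcauchy (E : normedModType K) :
  (forall F : set_system E, ProperFilter F -> rcauchy F id -> exists z, rcvg F id z) ->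
  forall F : set_system E, ProperFilter F -> cauchy F -> cvg F.
Proof.
move=> H F FF /cauchyP Fc; have [|z Fz] := H F FF.
  move=> e e0; have [|z Fz] := Fc (of_real e); first by rewrite of_real_gt0.
  exists z; apply: filterS Fz => t; rewrite -ball_normE /= normr_lt_of_real.
  by rewrite -rnormN opprB => /ltW.
by apply/cvg_ex; exists z; exact: (@rcvg_cvg _ _ _ id).
Qed.

Lemma scalar_complete (T : Type) (F : set_system T) (h : T -> K^o) :
  ProperFilter F -> rcauchy F h -> exists z, rcvg F h z.
Proof.
move=> FF hc.
have real_limit (g : T -> R) (u : K -> R) : (forall t, g t = u (h t)) ->
    (forall a b : K, `|u a - u b| <= rnorm (a - b : K^o)) ->
    exists l, forall e, 0 < e -> F [set t | `|g t - l| <= e].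
  move=> gu ul; have /cvg_ex[l gl] : cvg (g @ F).
    apply: R_complete; apply: cauchy_exP => e e0.
    have [|z Fz] := hc (e / 2); first by rewrite divr_gt0.
    exists (u z); rewrite /fmap /=; apply: filterS Fz => t /= tz.
    rewrite -ball_normE /= gu distrC (le_lt_trans (ul _ _))// (le_lt_trans tz)//.
    by rewrite ltr_pdivrMr// ltr_pMr// ltr1n.
  exists l => e e0; have /cvgrPdist_le/(_ e e0) := gl.
  by apply: filterS => t /=; rewrite distrC.
have [|a Fa] := real_limit (re_part \o h) re_part (fun=> erefl).
  by move=> a b; rewrite -re_partB norm_re_le.
have [|b Fb] := real_limit (im_part \o h) im_part (fun=> erefl).
  by move=> c b; rewrite -im_partB norm_im_le.
(* Over the reals no scalar has imaginary part b unless b = 0; an inequality for the imaginary parts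
   covers both fields. *)
have [z [za zb]] : exists z : K, re_part z = a /\ forall t, `|im_part (h t - z)| <= `|im_part (h t) - b|.
  case: k h {hc real_limit} Fa Fb => h Fa Fb; first by exists a; split=> // t; rewrite /= normr0.
  exists (a +i* b)%C; split => // t /=.
  by case: (h t).
exists z => e e0; have e20 : 0 < e / 2 by rewrite divr_gt0.
apply: filterS2 (Fa _ e20) (Fb _ e20) => t /= ta tb.
rewrite (le_trans (rnorm_re_im _))// (splitr e) lerD//; last exact: le_trans (zb t) tb.
by rewrite re_partB za.
Qed.

Lemma rnorm_linf (S : Type) (f : linf R k S) : rnorm f = sup_norm [set: S] f.
Proof. exact: of_realK. Qed.

Lemma linf_le (S : Type) (f : linf R k S) s : rnorm (f s : K^o) <= rnorm f.
Proof. by rewrite rnorm_linf; apply: sup_norm_ub => //; exact: linf_bounded. Qed.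

Lemma linf_rnorm_le (S : Type) (f : linf R k S) (M : R) : 0 <= M ->
  (forall s, rnorm (f s : K^o) <= M) -> rnorm f <= M.
Proof. by move=> M0 fM; rewrite rnorm_linf; apply: sup_norm_le. Qed.

Lemma rdist_le (E : normedModType K) (x y z : E) :
  rnorm (x - y) <= rnorm (x - z) + rnorm (y - z).
Proof.
rewrite -(rnormN (y - z)) opprB (le_trans _ (ler_rnormD _ _))//.
by rewrite addrA subrK.
Qed.

(* Pointwise limits along a filter that is Cauchy for a (weighted) supremum norm
   are uniform. *)
Lemma uniform_limit (S T : Type) (w : S -> R) (F : set_system T) (h : T -> S -> K^o) :
  ProperFilter F -> (forall s, 0 <= w s) ->
  (forall e : R, 0 < e -> exists z : S -> K^o,
     F [set t | forall s, rnorm (h t s - z s) <= e * w s]) ->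
  exists l : S -> K^o, (forall s, rcvg F (h ^~ s) (l s)) /\
   (forall e : R, 0 < e -> F [set t | forall s, rnorm (h t s - l s) <= e * w s]).
Proof.
move=> FF w0 hc.
have /choice[l hl] s : exists l, rcvg F (h ^~ s) l.
  apply: (@scalar_complete _ F (h ^~ s) FF) => e e0.
  (* The weight may vanish at s, hence the 1. *)
  have w1 : 0 < w s + 1 by rewrite ltr_wpDl.
  have [z Fz] := hc _ (divr_gt0 e0 w1); exists (z s).
  apply: filterS Fz => t /(_ s)/le_trans; apply.
  by rewrite mulrAC ler_pdivrMr// ler_wpM2l ?(ltW e0)// lerDl.
exists l; split=> // e e0; have e20 : 0 < e / 2 by rewrite divr_gt0.
have [z Fz] := hc _ e20.
apply: filterS (Fz) => t tz s /=; apply/ler_addgt0Pr => d d0.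
have [u [/= uz ul]] := filter_ex (filterI Fz (hl s _ d0)).
rewrite (le_trans (rdist_le _ _ (z s)))// (splitr e) mulrDl -addrA lerD// ?tz//.
rewrite (le_trans (rdist_le _ _ (h u s)))// addrC lerD//.
  by rewrite -rnormN opprB.
by rewrite -rnormN opprB.
Qed.

(** Makes l_oo(S) admissible as the middle space of a composition ideal, and gives limits to series
    with values in l_oo(B_{F^*}). *)
Lemma linf_complete (S : Type) (F : set_system (linf R k S)) :
  ProperFilter F -> cauchy F -> cvg F.
Proof.
move: F; apply: complete_of_rcauchy => F FF Fc.
have [//||l [_ lu]] := @uniform_limit S _ (fun=> 1) F (fun f => f) FF.
  move=> e /Fc[z Fz]; exists z; apply: filterS Fz => f /= fz s.
  by rewrite mulr1 (le_trans _ fz)//; exact: linf_le (f - z) s.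
have lb : (l : S -> K^o) \in linf_pred S.
  apply/asboolP; have [f fl] := filter_ex (lu _ ltr01).
  exists (1 + rnorm f) => s _; rewrite -[l s](subrK (f s)).
  rewrite (le_trans (ler_rnormD _ _))// lerD ?linf_le//.
  by rewrite -rnormN opprB -[leRHS]mulr1 fl.
exists (Linf lb) => e e0; apply: filterS (lu _ e0) => f fl /=.
by apply: linf_rnorm_le => [|s]; [exact: ltW|rewrite -[leRHS]mulr1; exact: fl].
Qed.

HB.instance Definition _ (S : Type) := Uniform_isComplete.Build (linf R k S)
  (@linf_complete S).

(** The uniform boundedness principle is later applied on a dual space. *)
Lemma dual_complete (E : normedModType K) (F : set_system (dual E)) :
  ProperFilter F -> cauchy F -> cvg F.
Proof.
move: F; apply: complete_of_rcauchy => F FF Fc.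
have [||l [lp lu]] := @uniform_limit E _ rnorm F (fun f => f) FF.
- by move=> x; exact: rnorm_ge0.
- move=> e /Fc[z Fz]; exists z; apply: filterS Fz => f /= fz x.
  by rewrite (le_trans (lop_le (f - z) x))// ler_wpM2r ?rnorm_ge0.
have ll : linear l.
  move=> a x y; apply/eqP; rewrite -subr_eq0; apply/eqP/rnorm0_eq0/eqP.
  rewrite eq_le rnorm_ge0 andbT; apply/ler_addgt0Pr => e e0; rewrite add0r.
  (* The total weight of the errors made when l is replaced by a linear f at a x + y, x and y; the 1
     keeps it positive. *)
  pose w := rnorm (a *: x + y) + rnorm (a : K^o) * rnorm x + rnorm y + 1.
  have w0 : 0 < w by rewrite ltr_wpDl// !addr_ge0 ?mulr_ge0 ?rnorm_ge0.
  have [f fl] := filter_ex (lu _ (divr_gt0 e0 w0)).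
  have -> : l (a *: x + y) - (a *: l x + l y) =
      (a *: (f x - l x) + (f y - l y)) - (f (a *: x + y) - l (a *: x + y)).
    by rewrite lop_linear scalerBr addrACA [- (_ + _ - _)]opprB [RHS]addrC addrA subrK opprD.
  rewrite (le_trans (ler_rnormD _ _))// rnormN (le_trans (lerD (ler_rnormD _ _) (lexx _)))//.
  rewrite rnormZ (le_trans (lerD (lerD (ler_wpM2l (rnorm_ge0 _) (fl _)) (fl _)) (fl _)))//.
  rewrite mulrCA -!mulrDr mulrAC ler_pdivrMr// ler_wpM2l ?(ltW e0)//.
  by rewrite /w addrC addrA lerDl.
have [f fl] := filter_ex (lu _ ltr01).
have lP : (l : E -> K^o) \in lop_pred E K^o.
  apply: (@linear_bounded_is_lop _ _ _ _ _ (1 + rnorm f)) => // x.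
  rewrite -[l x](subrK (f x)) (le_trans (ler_rnormD _ _))// mulrDl lerD ?lop_le//.
  by rewrite -rnormN opprB fl.
exists (Lop lP) => e e0; apply: filterS (lu _ e0) => g gl /=.
rewrite [leLHS]rnorm_lop; apply: sup_norm_le => [|x Bx]; first exact: ltW.
by rewrite (le_trans (gl x))// ler_piMr// ltW.
Qed.

HB.instance Definition _ (E : normedModType K) :=
  Uniform_isComplete.Build (lop E K^o) (@dual_complete E).

End Completeness.

(** * The evaluation polynomial into l_oo of the ball of scalar polynomials *)

Section UniversalPolynomial.
Context {R : realType} {k : scalar_kind}.
Local Notation K := (scalars R k).
Variables (m : nat) (E : normedModType K).

Lemma hpoly_le (F : normedModType K) (P : hpoly m E F) x :
  rnorm (P x) <= rnorm P * rnorm x ^+ m.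
Proof.
have P1 y : closed_unit_ball y -> rnorm (P y) <= rnorm P.
  by move=> By; rewrite rnorm_hpoly; apply: sup_norm_ub => //; exact: hpoly_bounded.
have rX (a : K) n : rnorm (a ^+ n : K^o) = rnorm (a : K^o) ^+ n.
  elim: n => [|n IHn]; last by rewrite !exprS rnormM IHn.
  by rewrite !expr0 -(@of_real1 R k) rnorm_of_real normr1.
have [->|x0] := eqVneq x 0.
  have := hpoly_homogeneous P 0 0; rewrite scaler0 rnorm0 !expr0n.
  (* For m = 0 the polynomial is constant and [0 ^+ 0] is 1. *)
  case: eqP => _; first by rewrite mulr1 P1// /closed_unit_ball /= rnorm0.
  by rewrite scale0r mulr0 => ->; rewrite rnorm0.
have nx0 : `|x| != 0 by rewrite normr_eq0.
rewrite -{1}[x]scale1r -(divff nx0) -scalerA hpoly_homogeneous rnormZ rX.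
have -> : rnorm (`|x| : K^o) = rnorm x by rewrite /rnorm normr_id.
rewrite mulrC ler_wpM2r ?exprn_ge0 ?rnorm_ge0// P1//.
by rewrite /closed_unit_ball /= rnorm_le normrZ normrV ?unitfE// normr_id mulVf// of_real1.
Qed.

Definition poly_ball := {s : hpoly m E K^o | closed_unit_ball s}.

Lemma polarization_le (P : hpoly m E K^o) (x : 'I_m -> E) :
  rnorm (polarization P x) <= 2 ^+ m * (rnorm P * (\sum_i rnorm (x i)) ^+ m).
Proof.
have rb (b : bool) : rnorm (b%:R : K^o) <= 1.
  by case: b; rewrite /= ?mulr1n ?mulr0n ?rnorm0 ?rnorm1.
rewrite (le_trans (rnorm_sum _))//.
have -> : 2 ^+ m = \sum_(e : {ffun 'I_m -> bool}) (1 : R).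
  by rewrite sumr_const card_ffun card_bool card_ord natrX.
rewrite mulr_suml ler_sum// => e _; rewrite mul1r rnormZ.
have -> : rnorm (\prod_i (-1) ^+ (~~ e i) : K^o) = 1.
  elim/big_ind : _ => [|a b a1 b1|i _]; first by rewrite rnorm1.
    by rewrite rnormM a1 b1 mulr1.
  by case: (e i); rewrite ?expr0 ?expr1 ?rnormN rnorm1.
rewrite mul1r (le_trans (hpoly_le _ _))// ler_wpM2l ?rnorm_ge0//.
rewrite lerXn2r ?nnegrE ?rnorm_ge0 ?sumr_ge0//; first by move=> i _; exact: rnorm_ge0.
rewrite (le_trans (rnorm_sum _))// ler_sum// => i _.
by rewrite rnormZ ler_piMl ?rnorm_ge0.
Qed.

Lemma poly_ball_multilinear (s : poly_ball) : exists2 A : ('I_m -> E) -> K^o,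
  multilinear A & forall x, sval s x = A (fun=> x).
Proof. by case: s => -[P /= hP] _; move/asboolP: (hP) => [[A mA PA] _]; exists A. Qed.

Definition polarized (x : 'I_m -> E) (s : poly_ball) : K^o :=
  (#|surjections m|%:R)^-1 *: polarization (sval s) x.

Definition polarized_bound : R :=
  rnorm ((#|surjections m|%:R)^-1 : K^o) * 2 ^+ m.

Lemma polarized_le x s :
  rnorm (polarized x s) <= polarized_bound * (\sum_i rnorm (x i)) ^+ m.
Proof.
rewrite rnormZ /polarized_bound -mulrA ler_wpM2l ?rnorm_ge0//.
rewrite (le_trans (polarization_le _ _))// ler_wpM2l ?exprn_ge0//.
rewrite ler_piMl ?exprn_ge0 ?sumr_ge0//; first by move=> i _; exact: rnorm_ge0.
exact: (svalP s).
Qed.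

Lemma polarized_linf x : polarized x \in linf_pred poly_ball.
Proof.
by apply/asboolP; exists (polarized_bound * (\sum_i rnorm (x i)) ^+ m) => s _; exact: polarized_le.
Qed.

(** A single multilinear map into l_oo is required, so the forms of all s in the ball must be
    bounded together. Polarization chooses each form from s alone, with a constant depending only on
    m. *)
Lemma universal_hpoly : exists Q : hpoly m E (linf R k poly_ball),
  forall x s, Q x s = sval s x.
Proof.
pose A x := Linf (polarized_linf x).
have mA : multilinear A.
  move=> i x a u v; apply/val_inj/funext => s /=.
  have [B mB sB] := poly_ball_multilinear s.
  rewrite /polarized (polarization_multilinear mB sB i x a u v) scalerDr scalerA.
  by rewrite mulrC -scalerA.
have Ac x : rnorm (A x) <= polarized_bound * (\sum_i rnorm (x i)) ^+ m.
  apply: linf_rnorm_le => [|s]; last exact: polarized_le.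
  rewrite !mulr_ge0 ?rnorm_ge0 ?exprn_ge0 ?sumr_ge0// => i _; exact: rnorm_ge0.
have hP : (fun x => A (fun=> x)) \in hpoly_pred m E (linf R k poly_ball).
  apply/asboolP; split; first by exists A.
  exact: multilinear_diag_continuous mA Ac.
exists (Hpoly hP) => x s /=; have [B mB sB] := poly_ball_multilinear s.
by rewrite /polarized (polarization_diag mB sB).
Qed.

End UniversalPolynomial.

(** * The norms of l_p and its finite sections *)

Section FiniteLp.
Context {R : realType}.
Implicit Types (p q : \bar R) (r s : R).

(** A symmetric form of conjugacy that supports case analysis, with the two endpoint pairs kept
    apart from the powers. *)
Variant conjugate_exponents : \bar R -> \bar R -> Prop :=
| Conjugate1y : conjugate_exponents 1%E +oo%E
| Conjugatey1 : conjugate_exponents +oo%E 1%E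
| Conjugate_fin r s of 1 < r & 1 < s & r^-1 + s^-1 = 1 :
    conjugate_exponents r%:E s%:E.

Lemma conjugate_exponents_sym p q : conjugate_exponents p q -> conjugate_exponents q p.
Proof.
case=> [||r s r1 s1 rs]; [exact: Conjugatey1|exact: Conjugate1y|].
by apply: Conjugate_fin => //; rewrite addrC.
Qed.

Lemma conjugate_exponentsP p : (1 <= p)%E -> conjugate_exponents p (hoelder_conjugate p).
Proof.
case: p => [r| |//]; last by rewrite hoelder_conjugatey => _; exact: Conjugatey1.
rewrite lee_fin le_eqVlt => /predU1P[<-|r1].
  by rewrite hoelder_conjugate1; exact: Conjugate1y.
have r0 : 0 < r by rewrite (lt_trans ltr01).
have rN1 : 0 < r - 1 by rewrite subr_gt0.
have -> : hoelder_conjugate r%:E = (r / (r - 1))%:E.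
  rewrite /hoelder_conjugate/= gt_eqF ?lte_fin// -EFinD inver gt_eqF//.
apply: Conjugate_fin => //.
  by rewrite ltr_pdivlMr// mul1r ltrBlDl ltrDr.
by rewrite invf_div -{1}[r^-1]mul1r -mulrDl addrC subrK divff// gt_eqF.
Qed.

Lemma conjugate_exponents_ge1 p q : conjugate_exponents p q -> (1 <= p)%E.
Proof. by case=> // [|r s r1 _ _]; rewrite ?leey// lee_fin ltW. Qed.

Lemma sum_powR_ge0 r n (a : 'I_n -> R) : 0 <= \sum_(i < n) a i `^ r.
Proof. by apply: sumr_ge0 => i _; exact: powR_ge0. Qed.

Lemma fin_lp_norm1 n (a : 'I_n -> R) : (forall i, 0 <= a i) ->
  fin_lp_norm 1%E a = \sum_(i < n) a i.
Proof.
move=> a0; rewrite /fin_lp_norm invr1 powRr1 ?sum_powR_ge0//.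
by apply: eq_bigr => i _; rewrite powRr1.
Qed.

Lemma fin_lp_norm_ge0 p n (a : 'I_n -> R) : 0 <= fin_lp_norm p a.
Proof.
by case: p => [r| |]; [exact: powR_ge0|exact: bigmax_ge_id|exact: bigmax_ge_id].
Qed.

Lemma fin_lp_norm_le p n (a b : 'I_n -> R) : (1 <= p)%E ->
  (forall i, 0 <= a i <= b i) -> fin_lp_norm p a <= fin_lp_norm p b.
Proof.
move=> p1 ab; have a0 i : 0 <= a i by have /andP[] := ab i.
have le_ab i : a i <= b i by have /andP[] := ab i.
case: p p1 => [r r1| _|//]; last first.
  apply: bigmax_le => [|i _]; first exact: (fin_lp_norm_ge0 +oo%E).
  by rewrite (le_trans (le_ab i))//; exact: le_bigmax.
have r0 : 0 <= r by rewrite (le_trans ler01).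
rewrite /fin_lp_norm ge0_ler_powR ?invr_ge0 ?nnegrE ?sum_powR_ge0//.
by apply: ler_sum => i _; rewrite ge0_ler_powR ?nnegrE ?(le_trans (a0 i) (le_ab i)).
Qed.

Lemma fin_lp_normZ p n (a : 'I_n -> R) (c : R) : (1 <= p)%E -> 0 <= c ->
  (forall i, 0 <= a i) -> fin_lp_norm p (fun i => c * a i) = c * fin_lp_norm p a.
Proof.
move=> p1 c0 a0; case: p p1 => [r r1| _|//]; last first.
  rewrite /fin_lp_norm; elim/big_ind2 : _ => [|x y z w -> ->|//]; first by rewrite mulr0.
  by rewrite maxr_pMr.
have r0 : r != 0 by rewrite gt_eqF// (lt_le_trans ltr01).
rewrite /fin_lp_norm; under eq_bigr => i _ do rewrite (powRM r c0 (a0 i)).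
rewrite -mulr_sumr powRM ?powR_ge0 ?sum_powR_ge0//.
by rewrite -powRrM mulfV// powRr1.
Qed.

Lemma fin_lp_norm0 p n : (1 <= p)%E -> fin_lp_norm p (fun _ : 'I_n => 0) = 0 :> R.
Proof.
move=> p1; have := @fin_lp_normZ p n (fun=> 0) 0 p1 (lexx 0) (fun=> lexx 0).
by rewrite !mul0r.
Qed.

Lemma fin_lp_norm_eq0 r n (a : 'I_n -> R) : 1 <= r -> (forall i, 0 <= a i) ->
  fin_lp_norm r%:E a = 0 -> forall i, a i = 0.
Proof.
move=> r1 a0 /eqP; have r0 : r != 0 by rewrite gt_eqF// (lt_le_trans ltr01).
rewrite /fin_lp_norm powR_eq0 => /andP[+ _].
rewrite psumr_eq0; last by move=> i _; exact: powR_ge0.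
by move=> /allP a_eq0 i; have := a_eq0 i; rewrite mem_index_enum powR_eq0 => /(_ isT)/andP[/eqP].
Qed.

Lemma fin_lp_norm_powR r n (a : 'I_n -> R) : 1 <= r ->
  fin_lp_norm r%:E a `^ r = \sum_(i < n) a i `^ r.
Proof.
move=> r1; have r0 : r != 0 by rewrite gt_eqF// (lt_le_trans ltr01).
by rewrite /fin_lp_norm -powRrM mulVf// powRr1// sum_powR_ge0.
Qed.

(** For finite exponents, Young's inequality for the normalized vectors; vanishing norms are treated
    apart because they cannot be divided by. *)
Lemma fin_hoelder p q n (a b : 'I_n -> R) : conjugate_exponents p q ->
  (forall i, 0 <= a i) -> (forall i, 0 <= b i) ->
  \sum_(i < n) a i * b i <= fin_lp_norm p a * fin_lp_norm q b.
Proof.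
move=> pq; move: a b.
have H1 (a b : 'I_n -> R) : (forall i, 0 <= a i) -> (forall i, 0 <= b i) ->
    \sum_(i < n) a i * b i <= fin_lp_norm 1%E a * fin_lp_norm +oo%E b.
  move=> a0 b0; rewrite fin_lp_norm1// mulr_suml ler_sum// => i _.
  by rewrite ler_wpM2l//; exact: le_bigmax.
case: pq => [a b a0 b0|a b a0 b0|r s r1 s1 rs a b a0 b0].
- exact: H1.
- by under eq_bigr do rewrite mulrC; rewrite mulrC H1.
have [r0 s0] : 0 < r /\ 0 < s by split; exact: lt_trans ltr01 _.
have [A0|A0] := eqVneq (fin_lp_norm r%:E a) 0.
  rewrite A0 mul0r big1// => i _.
  by rewrite (fin_lp_norm_eq0 (ltW r1) a0 A0) mul0r.
have [B0|B0] := eqVneq (fin_lp_norm s%:E b) 0.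
  rewrite B0 mulr0 big1// => i _.
  by rewrite (fin_lp_norm_eq0 (ltW s1) b0 B0) mulr0.
have {}A0 : 0 < fin_lp_norm r%:E a by rewrite lt_def A0 fin_lp_norm_ge0.
have {}B0 : 0 < fin_lp_norm s%:E b by rewrite lt_def B0 fin_lp_norm_ge0.
have AB0 := mulr_gt0 A0 B0.
rewrite -[X in _ <= X]mul1r -(ler_pdivrMr _ _ AB0) mulr_suml -[X in _ <= X]rs.
have normalized t (c : 'I_n -> R) : 1 < t -> (forall i, 0 <= c i) -> 0 < fin_lp_norm t%:E c ->
    \sum_(i < n) (c i / fin_lp_norm t%:E c) `^ t / t = t^-1.
  move=> t1 c0 C0; have t0 : t != 0 by rewrite gt_eqF// (lt_trans ltr01).
  rewrite -mulr_suml -[RHS]mul1r; congr (_ * _).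
  under eq_bigr do rewrite powRM ?invr_ge0 ?(ltW C0)//.
  rewrite -mulr_suml -fin_lp_norm_powR ?(ltW t1)// -powRM ?invr_ge0 ?(ltW C0)//.
  by rewrite divff ?gt_eqF// powR1.
rewrite -{1}(normalized _ _ r1 a0 A0) -{1}(normalized _ _ s1 b0 B0) -big_split /=.
apply: ler_sum => i _; rewrite invfM mulrACA.
exact: (conjugate_powR (divr_ge0 (a0 i) (ltW A0)) (divr_ge0 (b0 i) (ltW B0)) r0 s0 rs).
Qed.

(** Equality in Hoelder: a coordinate vector at the maximum, the constant 1, or (a_i / A)^(s - 1)
    with A the norm of a, whose r-th powers are (a_i / A)^s because (s - 1) r = s. *)
Lemma fin_lp_dual p q n (a : 'I_n -> R) : conjugate_exponents p q ->
  (forall i, 0 <= a i) ->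
  exists b : 'I_n -> R, [/\ forall i, 0 <= b i, fin_lp_norm p b <= 1 &
    \sum_(i < n) b i * a i = fin_lp_norm q a].
Proof.
case=> [||r s r1 s1 rs] a0.
- have [m0|[i0 _ mi]] := bigmax_geP _ _ _ _ (lexx (\big[Num.max/0]_(i < n) a i)).
    exists (fun=> 0); rewrite fin_lp_norm1// !big1 ?ler01//; last by move=> i _; rewrite mul0r.
    split=> //; apply/eqP; rewrite eq_le; apply/andP; split; last exact: m0.
    exact: (fin_lp_norm_ge0 +oo%E).
  have b0 (i : 'I_n) : 0 <= (i == i0)%:R :> R by rewrite ler0n.
  exists (fun i => (i == i0)%:R); split=> //.
    by rewrite fin_lp_norm1// (bigD1 i0)//= eqxx big1 ?addr0// => i /negPf ->.
  rewrite (bigD1 i0)//= eqxx mul1r big1 ?addr0 => [|i /negPf ->]; last by rewrite mul0r.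
  by apply/eqP; rewrite eq_le mi andbT; exact: le_bigmax.
- exists (fun=> 1); split=> //; first by apply: bigmax_le.
  by rewrite fin_lp_norm1//; apply: eq_bigr => i _; rewrite mul1r.
have [r0 s0] : 0 < r /\ 0 < s by split; exact: lt_trans ltr01 _.
have [A0|A0] := eqVneq (fin_lp_norm s%:E a) 0.
  exists (fun=> 0); split=> //.
    by rewrite fin_lp_norm0 ?ler01// lee_fin ltW.
  by rewrite A0 big1// => i _; rewrite mul0r.
have {}A0 : 0 < fin_lp_norm s%:E a by rewrite lt_def A0 fin_lp_norm_ge0.
set A := fin_lp_norm s%:E a in A0 *.
have sr : (s - 1) * r = s.
  have rE : r^-1 = (s - 1) / s by rewrite mulrBl divff ?gt_eqF// mul1r -rs addrK.
  by rewrite -[r]invrK rE invf_div mulrC divfK// gt_eqF// subr_gt0.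
have sumA : \sum_(i < n) (a i / A) `^ s = 1.
  under eq_bigr do rewrite powRM ?invr_ge0 ?(ltW A0)//.
  rewrite -mulr_suml -fin_lp_norm_powR ?(ltW s1)// -powRM ?invr_ge0 ?(ltW A0)//.
  by rewrite divff ?gt_eqF// powR1.
exists (fun i => (a i / A) `^ (s - 1)); split=> [i||].
- exact: powR_ge0.
- rewrite /fin_lp_norm; under eq_bigr do rewrite -powRrM sr.
  by rewrite sumA powR1.
- rewrite -[RHS]mul1r -[X in _ = X * _]sumA mulr_suml; apply: eq_bigr => i _.
  have [->|ai] := eqVneq (a i) 0.
    by rewrite mulr0 mul0r powR0 ?mul0r// gt_eqF.
  have aA : 0 < a i / A by rewrite divr_gt0// lt_def ai a0.
  rewrite -[in RHS](subrK 1 s) [in RHS]powRD; last by apply/implyP => _; exact: lt0r_neq0.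
  by rewrite powRr1 ?(ltW aA)// -mulrA divfK// gt_eqF.
Qed.

Lemma fin_lp_normD p n (a b : 'I_n -> R) : (1 <= p)%E ->
  (forall i, 0 <= a i) -> (forall i, 0 <= b i) ->
  fin_lp_norm p (fun i => a i + b i) <= fin_lp_norm p a + fin_lp_norm p b.
Proof.
move=> p1 a0 b0; have pq := conjugate_exponents_sym (conjugate_exponentsP p1).
have [c [c0 c1 <-]] := @fin_lp_dual _ _ n (fun i => a i + b i) pq (fun i => addr_ge0 (a0 i) (b0 i)).
have le1 (x : 'I_n -> R) : (forall i, 0 <= x i) -> \sum_(i < n) c i * x i <= fin_lp_norm p x.
  move=> x0; apply: (le_trans (fin_hoelder pq c0 x0)).
  by rewrite ler_piMl ?fin_lp_norm_ge0.
by under eq_bigr do rewrite mulrDr; rewrite big_split /= lerD ?le1.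
Qed.

End FiniteLp.

(** * Summable sequences through their initial sections *)

Section SequenceLp.
Context {R : realType} {k : scalar_kind}.
Local Notation K := (scalars R k).
Variable E : normedModType K.
Implicit Types (x : nat -> E) (p : \bar R).

Lemma counting_ae (P : nat -> Prop) :
  (\forall n \ae (@counting nat R), P n) -> forall n, P n.
Proof.
move=> [A [mA A0 PA]] n; apply: contrapT => nP.
have : (counting [set n] <= counting A :> \bar R)%E.
  by apply: le_measure; rewrite ?inE// => _ ->; exact: PA.
rewrite A0 /counting /=; case: asboolP => [_|]; last by move/(_ (finite_set1 n)).
by rewrite fset_set1 finmap.cardfs1 lee_fin ler10.
Qed.

Lemma countingT : counting [set: nat] = +oo%E :> \bar R.
Proof. by rewrite /counting; case: asboolP => // fN; have := infinite_nat fN. Qed.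

(** The norm is an integral or an essential supremum for the counting measure, whose only null set
    is empty. This passes to the finite norms in which the estimates are made. *)
Lemma lp_norm_le p x (C : R) : (1 <= p)%E -> 0 <= C ->
  (lp_norm p x <= C%:E)%E <->
  forall n, fin_lp_norm p (fun i : 'I_n => rnorm (x i)) <= C.
Proof.
move=> p1 C0; rewrite /lp_norm; case: p p1 => [r r1|_|//]; last first.
  rewrite unlock ifT; last first.
    by have := countingT => /= ->; exact: lt0y.
  split=> [/ess_supP/counting_ae xC n|xC].
    by apply: bigmax_le => // i _; have := xC i; rewrite /= lee_fin ger0_norm ?rnorm_ge0.
  apply/ess_supP; apply: nearW => n /=; rewrite lee_fin ger0_norm ?rnorm_ge0//.
  by rewrite (le_trans _ (xC n.+1))//; exact: (le_bigmax _ (fun i : 'I_n.+1 => rnorm (x i)) ord_max).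
have r0 : 0 < r by rewrite (lt_le_trans ltr01).
rewrite Lnorm_counting//.
set T := (\sum_(i <oo) _)%E.
have T0 : (0 <= T)%E by apply: nneseries_ge0 => n _ _; exact: poweR_ge0.
have TE : T = (\sum_(i <oo) (rnorm (x i) `^ r)%:E)%E.
  by apply: eq_eseriesr => i _; rewrite /= ger0_norm ?rnorm_ge0.
have partial n : (\sum_(0 <= i < n) (rnorm (x i) `^ r)%:E <= T)%E.
  by rewrite TE; apply: nneseries_lim_ge => i _ _; rewrite lee_fin powR_ge0.
have H1 : (T `^ r^-1 <= C%:E)%E <-> (T <= (C `^ r)%:E)%E.
  split=> [TC|TC].
    have -> : T = ((T `^ r^-1) `^ r)%E by rewrite -poweRrM mulVf ?gt_eqF// poweRe1.
    rewrite -poweR_EFin; apply: gt0_ler_poweR; last exact: TC.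
    - exact: ltW.
    - by rewrite in_itv /= leey andbT poweR_ge0.
    - by rewrite in_itv /= leey andbT lee_fin.
  have -> : C%:E = ((C `^ r)%:E `^ r^-1)%E.
    by rewrite poweR_EFin -powRrM mulfV ?gt_eqF// powRr1.
  apply: gt0_ler_poweR; last exact: TC.
  - by rewrite invr_ge0 ltW.
  - by rewrite in_itv /= leey andbT.
  - by rewrite in_itv /= leey andbT lee_fin powR_ge0.
have H2 n : fin_lp_norm r%:E (fun i : 'I_n => rnorm (x i)) <= C <->
    \sum_(i < n) rnorm (x i) `^ r <= C `^ r.
  split=> xC.
    rewrite -(fin_lp_norm_powR (fun i : 'I_n => rnorm (x i)) r1).
    by rewrite ge0_ler_powR ?(ltW r0)// nnegrE fin_lp_norm_ge0.
  rewrite -[C](powRr1 C0) -(mulfV (lt0r_neq0 r0)) powRrM.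
  by rewrite ge0_ler_powR ?invr_ge0 ?(ltW r0) ?nnegrE ?powR_ge0 ?sum_powR_ge0.
split=> [/H1 TC n|xC].
  apply/H2; rewrite -lee_fin (le_trans _ TC)// (le_trans _ (partial n))//.
  by rewrite big_mkord sumEFin.
apply/H1; rewrite TE; apply: lime_le.
  by apply: is_cvg_nneseries => n _ _; rewrite lee_fin powR_ge0.
apply: nearW => n; rewrite big_mkord sumEFin lee_fin; apply/H2; exact: xC.
Qed.

Lemma lp_summableP p x : (1 <= p)%E ->
  lp_summable p x <->
  exists2 C, 0 <= C & forall n, fin_lp_norm p (fun i : 'I_n => rnorm (x i)) <= C.
Proof.
move=> p1; split=> [xoo|[C C0 xC]]; last first.
  have /(lp_norm_le x p1 C0) H := xC.
  by rewrite /lp_summable /= (le_lt_trans H)// ltry.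
have x0 : (0 <= lp_norm p x)%E by exact: Lnorm_ge0.
have xfin : lp_norm p x \is a fin_num by rewrite ge0_fin_numE.
exists (fine (lp_norm p x)); first exact: fine_ge0.
by apply/(lp_norm_le x p1); rewrite ?fine_ge0// fineK.
Qed.

(** The partial sums of the r-th powers increase and are bounded; N is an index at which they come
    within e^r of their supremum. *)
Lemma lp_summable_tail (r : R) x : 1 <= r -> lp_summable r%:E x ->
  forall e : R, 0 < e -> exists N, forall n,
  fin_lp_norm r%:E (fun i : 'I_n => if (N <= i)%N then rnorm (x i) else 0) <= e.
Proof.
move=> r1 /lp_summableP -/(_ r1)[C C0 xC] e e0.
have r0 : 0 < r by rewrite (lt_le_trans ltr01).
pose u n := \sum_(i < n) rnorm (x i) `^ r.
have uC n : u n <= C `^ r.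
  rewrite /u -(fin_lp_norm_powR (fun i : 'I_n => rnorm (x i)) r1).
  by rewrite ge0_ler_powR ?(ltW r0)// ?nnegrE ?fin_lp_norm_ge0.
have supu : has_sup (range u).
  by split; [exists (u 0%N), 0%N|exists (C `^ r) => _ [n _ <-]].
have [_ [N _ <-] uN] := sup_adherent (powR_gt0 r e0) supu.
exists N => n; rewrite -[e](powRr1 (ltW e0)) -(mulfV (lt0r_neq0 r0)) powRrM /fin_lp_norm.
rewrite ge0_ler_powR ?invr_ge0 ?(ltW r0) ?nnegrE ?powR_ge0 ?sum_powR_ge0//.
have [nN|Nn] := leqP n N.
  rewrite big1 ?powR_ge0// => i _; rewrite leqNgt (leq_trans (ltn_ord i) nN) powR0//.
  exact: lt0r_neq0.
have un : u n <= sup (range u) by apply: ub_le_sup; [exact: supu.2|exists n].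
apply: (@le_trans _ _ (u n - u N)); last first.
  by rewrite lerBlDr (le_trans un)// -lerBlDl ltW.
rewrite /u -(big_mkord predT (fun i => rnorm (x i) `^ r)) (big_cat_nat (leq0n N) (ltnW Nn))//=.
rewrite big_mkord addrAC subrr add0r.
rewrite -(big_mkord predT (fun i => (if (N <= i)%N then rnorm (x i) else 0) `^ r)).
rewrite (big_cat_nat (leq0n N) (ltnW Nn))//= [X in X + _]big_nat big1 ?add0r => [|i /andP[_ iN]].
  by apply: ler_sum_nat => i /andP[-> _].
by rewrite leqNgt iN powR0//; exact: lt0r_neq0.
Qed.

End SequenceLp.

(** * Finitely additive measures on the space of ultrafilters *)

Section StoneSpace.
Variables (S : Type) (s0 : S).

(* The point [s0] only serves to make the space of ultrafilters pointed. *)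
Definition stone of S : Type := {U : set_system S | UltraFilter U}.
Local Notation T := (stone s0).

HB.instance Definition _ := gen_eqMixin T.
HB.instance Definition _ := gen_choiceMixin T.

Definition principal (s : S) : T := exist _ _ (principal_filter_ultra s).

HB.instance Definition _ := isPointed.Build T (principal s0).

Definition clopen (A : set S) : set T := [set U | sval U A].

Let proper (U : T) : ProperFilter (sval U).
Proof. by case: U => U /= UU; exact: ultra_proper. Qed.

Lemma clopenP (U : T) (A : set S) : ~ sval U A -> sval U (~` A).
Proof. by case: U => U /= UU nUA; have [] := in_ultra_setVsetC A UU. Qed.

Lemma clopenN (U : T) (A : set S) : sval U (~` A) -> ~ sval U A.
Proof.
move=> UnA UA; have UF := proper U.
by have [s []] := filter_ex (filterI UA UnA).
Qed.

Lemma clopen0 : clopen set0 = set0.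
Proof.
rewrite -subset0 => U /= U0; apply: (clopenN _ U0); rewrite setC0.
by have UF := proper U; apply: filterT.
Qed.

Lemma clopenC A : clopen (~` A) = ~` clopen A.
Proof. by apply/seteqP; split=> U /=; [exact: clopenN|exact: clopenP]. Qed.

Lemma clopenU A B : clopen (A `|` B) = clopen A `|` clopen B.
Proof.
apply/seteqP; split=> U /= UAB; have UF := proper U; last first.
  by case: UAB => U'; apply: filterS U' => s; [left|right].
apply: contrapT => /not_orP[/clopenP UA /clopenP UB].
by apply: (clopenN _ UAB); rewrite setCU; exact: filterI.
Qed.

Lemma principal_clopen A s : clopen A (principal s) = A s.
Proof. by apply/propext; split => [|As t ->//]; apply. Qed.

Definition trace (X : set T) : set S := [set s | X (principal s)].

Lemma clopenK A : trace (clopen A) = A.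
Proof. by apply/funext => s; rewrite /trace /mkset principal_clopen. Qed.

Lemma clopen_algebra_setU : setU_closed (range clopen).
Proof. by move=> _ _ [A _ <-] [B _ <-]; exists (A `|` B) => //; rewrite clopenU. Qed.

Lemma clopen_algebra_setC : setC_closed (range clopen).
Proof. by move=> _ [A _ <-]; exists (~` A) => //; rewrite clopenC. Qed.

Lemma clopen_algebra_set0 : range clopen set0.
Proof. by exists set0 => //; exact: clopen0. Qed.

Fact stone_display : measure_display. Proof. exact. Qed.

HB.instance Definition _ := isAlgebraOfSets.Build stone_display T
  clopen_algebra_set0 clopen_algebra_setU clopen_algebra_setC.

Lemma measurable_clopen A : measurable (clopen A : set T).
Proof. by exists A. Qed.

(** If no finite union covered A, the decreasing nonempty sets D n would generate a proper filter.
    An ultrafilter refining it lies in [clopen A] but in no [clopen (B n)]. *)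
Lemma stone_compact (A : set S) (B : (set S)^nat) :
  clopen A `<=` \bigcup_n clopen (B n) ->
  exists N, A `<=` \bigcup_(n < N) B n.
Proof.
move=> AB; apply: contrapT => /forallNP noN.
pose D n := A `\` \bigcup_(i < n) B i.
have D0 n : D n !=set0.
  apply/set0P/eqP => Dn0; apply: (noN n) => s As; apply: contrapT => nBs.
  by have : D n s by []; rewrite Dn0.
have Ddec n p : (n <= p)%N -> D p `<=` D n.
  move=> np s [As nB]; split=> // -[i /= iN Bi]; apply: nB; exists i => //=.
  exact: leq_trans np.
have FD : ProperFilter (filter_from setT D).
  apply: filter_from_proper => [|n _]; last exact: D0.
  apply: filter_from_filter => [|n p _ _]; first by exists 0%N.
  by exists (maxn n p) => // s Ds; split; apply: Ddec Ds; rewrite ?leq_maxl ?leq_maxr.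
have [U [UU DU]] := ultraFilterLemma FD.
pose u : T := exist _ U UU; have uF := proper u.
have uA : clopen A u.
  by apply: DU; exists 0%N => // s [].
have [n _ uBn] := AB _ uA.
have : ~ clopen (B n) u; last exact.
apply: clopenN; apply: DU; exists n.+1 => // s [_ nB] Bs; apply: nB.
by exists n => /=.
Qed.

End StoneSpace.

Record finitely_additive (R : realType) (S : Type) := FinitelyAdditive {
  fa_fun :> set S -> R ;
  fa_ge0 : forall A, 0 <= fa_fun A ;
  faU : forall A B, A `&` B = set0 -> fa_fun (A `|` B) = fa_fun A + fa_fun B }.

Section StoneMeasure.
Context {R : realType} {S : Type} (s0 : S) (m : finitely_additive R S).
Local Notation T := (stone s0).

Lemma fa0 : m set0 = 0.
Proof. by have /(canLR (addrK _)) := faU m (set0I set0); rewrite setU0 subrr. Qed.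

Lemma fa_bigcup (B : (set S)^nat) N : trivIset setT B ->
  m (\bigcup_(n < N) B n) = \sum_(n < N) m (B n).
Proof.
move=> tB; elim: N => [|N IHN]; first by rewrite bigcup_mkord !big_ord0 fa0.
rewrite bigcup_mkord !big_ord_recr /= -IHN -bigcup_mkord faU//.
rewrite -subset0 => s [[i /= iN Bi] BN].
by have /= iE := tB i N I I (ex_intro _ s (conj Bi BN)); rewrite iE ltnn in iN.
Qed.

(** Made total by [trace]; a clopen set is recovered from its trace, so on the algebra this is the
    value of m. *)
Definition stone_content (X : set T) : \bar R := (m (trace X))%:E.

Lemma stone_content_clopen A : stone_content (clopen A) = (m A)%:E.
Proof. by rewrite /stone_content clopenK. Qed.

Lemma stone_content0 : stone_content set0 = 0%E.
Proof. by rewrite -clopen0 stone_content_clopen fa0. Qed.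

Lemma stone_content_ge0 X : (0 <= stone_content X)%E.
Proof. by rewrite lee_fin fa_ge0. Qed.

(* By compactness only finitely many members of a disjoint sequence of clopen sets
   with clopen union are nonempty. *)
Lemma stone_content_sigma_additive : semi_sigma_additive stone_content.
Proof.
move=> X mX tX [A _ XA].
have XE n : clopen (trace (X n)) = X n by have [B _ <-] := mX n; rewrite clopenK.
pose B n := trace (X n).
have tB : trivIset setT B.
  by move=> i j _ _ [s [Bi Bj]]; apply: (tX i j I I); exists (principal s0 s).
have AE : A = \bigcup_n B n.
  rewrite -(clopenK s0 A) XA; apply/seteqP; split=> s [n _ Xs]; by exists n.
have [N AN] : exists N, A `<=` \bigcup_(n < N) B n.
  apply: (@stone_compact S s0); rewrite XA => U [n _ XU]; exists n => //.
  by rewrite XE.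
have ANE : A = \bigcup_(n < N) B n.
  by apply/seteqP; split=> // s [n _ Bs]; rewrite AE; exists n.
have B0 n : (N <= n)%N -> B n = set0.
  move=> Nn; rewrite -subset0 => s Bs.
  have : A s by rewrite AE; exists n.
  rewrite ANE => -[i /= iN Bi].
  by have /= iE := tB i n I I (ex_intro _ s (conj Bi Bs)); rewrite -iE leqNgt iN in Nn.
rewrite -XA stone_content_clopen ANE fa_bigcup//.
apply: cvg_near_cst; exists N => // n /= Nn; rewrite -sumEFin big_mkord.
rewrite -(subnKC Nn) big_split_ord /= [X in (_ + X)%E]big1 ?adde0//.
by move=> i _; rewrite /stone_content -/(B (N + i)%N) B0 ?leq_addr// fa0.
Qed.

HB.instance Definition _ := isMeasure.Build _ _ _ stone_content
  stone_content0 stone_content_ge0 stone_content_sigma_additive.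

Definition stone_measurable : measurableType _ :=
  g_sigma_algebraType (@measurable _ T).

Definition stone_measure : set stone_measurable -> \bar R :=
  measure_extension stone_content.

HB.instance Definition _ := Measure.on stone_measure.

Lemma stone_measure_clopen A : stone_measure (clopen A) = (m A)%:E.
Proof.
rewrite /stone_measure /measure_extension measurable_mu_extE.
  exact: stone_content_clopen.
exact: measurable_clopen.
Qed.

Lemma stone_measure_finite : fin_num_fun stone_measure.
Proof.
apply: lty_fin_num_fun.
have clopenT : clopen setT = setT :> set T.
  by rewrite -[in LHS]setC0 clopenC clopen0 setC0.
by have := stone_measure_clopen setT; rewrite clopenT => /= ->; rewrite ltry.
Qed.

HB.instance Definition _ := Measure_isFinite.Build _ _ _ stone_measure
  stone_measure_finite.

End StoneMeasure.

(** * Limits along ultrafilters and the extension of bounded functions *)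

Section UltraLimits.
Context {R : realType} {k : scalar_kind}.
Local Notation K := (scalars R k).

Lemma rcvg_unique (E : normedModType K) (T : Type) (F : set_system T) (h : T -> E) y z :
  ProperFilter F -> rcvg F h y -> rcvg F h z -> y = z.
Proof.
move=> FF hy hz; apply/eqP; rewrite -subr_eq0; apply/eqP/rnorm0_eq0/eqP.
rewrite eq_le rnorm_ge0 andbT; apply/ler_addgt0Pr => e e0; rewrite add0r.
have e20 : 0 < e / 2 by rewrite divr_gt0.
have [t [/= ty tz]] := filter_ex (filterI (hy _ e20) (hz _ e20)).
rewrite (le_trans (rdist_le _ _ (h t)))// (splitr e) lerD//.
  by rewrite -rnormN opprB.
by rewrite -rnormN opprB.
Qed.

Lemma rcvg_linear (E : normedModType K) (T : Type) (F : set_system T) (g h : T -> E) a y z :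
  Filter F -> rcvg F g y -> rcvg F h z -> rcvg F (fun t => a *: g t + h t) (a *: y + z).
Proof.
move=> FF gy hz; apply: cvg_rcvg; apply: cvgD; last exact: rcvg_cvg.
by apply: cvgZl_tmp; exact: rcvg_cvg.
Qed.

(** The limit is the supremum of the levels c for which the set where c <= g belongs to U. For a
    higher level the complement belongs to U. *)
Lemma ultra_limit_real (S : Type) (U : set_system S) (g : S -> R) (M : R) :
  UltraFilter U -> (forall s, `|g s| <= M) ->
  exists l, forall e, 0 < e -> U [set s | `|g s - l| <= e].
Proof.
move=> UU gM; have UF : ProperFilter U by exact: ultra_proper.
pose D := [set c | U [set s | c <= g s]].
have DM c : D c -> c <= M.
  move=> /filter_ex[s /= cs]; rewrite (le_trans cs)// (le_trans _ (gM s))//.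
  exact: ler_norm.
have supD : has_sup D.
  split; last by exists M => c /DM.
  exists (- M); rewrite /D /=; apply: filterE => s /=.
  by have := gM s; rewrite ler_norml => /andP[].
exists (sup D) => e e0.
have [c Dc cs] := sup_adherent e0 supD.
have nD : ~ D (sup D + e).
  move=> /(ub_le_sup supD.2); apply/negP; rewrite -ltNge ltrDl//.
have [//|nU] := in_ultra_setVsetC [set s | sup D + e <= g s] UU.
apply: filterS2 Dc nU => s /= cg /negP; rewrite -ltNge => gs.
move: (sup D) cs cg gs => l cs /= cg gs.
by rewrite ler_norml; apply/andP; split; lra.
Qed.

Lemma ultra_rcvg (S : Type) (U : set_system S) (f : linf R k S) :
  UltraFilter U -> exists z, rcvg U (f : S -> K^o) z.
Proof.
move=> UU; have UF : ProperFilter U by exact: ultra_proper.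
apply: scalar_complete => e e0.
have e40 : 0 < e / 2 / 2 by rewrite !divr_gt0.
have [a Ua] : exists a, forall e, 0 < e -> U [set s | `|re_part (f s) - a| <= e].
  by apply: (@ultra_limit_real _ _ _ (rnorm f)) => // s; rewrite (le_trans (norm_re_le _))// linf_le.
have [b Ub] : exists b, forall e, 0 < e -> U [set s | `|im_part (f s) - b| <= e].
  by apply: (@ultra_limit_real _ _ _ (rnorm f)) => // s; rewrite (le_trans (norm_im_le _))// linf_le.
have [s0 [/= sa sb]] := filter_ex (filterI (Ua _ e40) (Ub _ e40)).
exists (f s0); apply: filterS2 (Ua _ e40) (Ub _ e40) => s /= ta tb.
have dist (x y z : R) : `|x - z| <= e / 2 / 2 -> `|y - z| <= e / 2 / 2 -> `|x - y| <= e / 2.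
  move=> xz yz; rewrite -(subrK z x) -addrA (le_trans (ler_normD _ _))//.
  by rewrite (splitr (e / 2)) lerD// distrC.
rewrite (le_trans (rnorm_re_im _))// (splitr e) re_partB im_partB lerD//.
  exact: dist ta sa.
exact: dist tb sb.
Qed.

End UltraLimits.

Section StoneExtension.
Context {R : realType} {k : scalar_kind} {S : Type} (s0 : S).
Local Notation K := (scalars R k).
Local Notation T := (stone_measurable s0).
Implicit Types f g : linf R k S.

Definition stone_ext f (U : T) : K^o := xget 0 [set z | rcvg (sval (U : stone s0)) (f : S -> K^o) z].

Let proper (U : stone s0) : ProperFilter (sval U).
Proof. by case: U => U /= UU; exact: ultra_proper. Qed.

Lemma stone_extP f (U : T) : rcvg (sval (U : stone s0)) (f : S -> K^o) (stone_ext f U).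
Proof.
apply: (@xgetPex _ 0 [set z | rcvg (sval (U : stone s0)) (f : S -> K^o) z]).
by case: U => U UU; exact: ultra_rcvg.
Qed.

Lemma stone_ext_linear f g a U :
  stone_ext (a *: f + g) U = a *: stone_ext f U + stone_ext g U.
Proof.
have UF := proper U.
apply: (@rcvg_unique _ _ _ _ _ (a *: f + g : S -> K^o) _ _ UF); first exact: stone_extP.
by have := rcvg_linear a _ (stone_extP f U) (stone_extP g U); apply.
Qed.

Lemma stone_ext_le f U : rnorm (stone_ext f U) <= rnorm f.
Proof.
have UF := proper U; apply/ler_addgt0Pl => e e0.
have [s /= fs] := filter_ex (stone_extP f U e0).
rewrite -[stone_ext f U](subrK (f s)) (le_trans (ler_rnormD _ _))// lerD ?linf_le//.
by rewrite -rnormN opprB.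
Qed.

Lemma stone_ext_ge f U (c : R) : sval (U : stone s0) [set s | c <= rnorm (f s : K^o)] ->
  c <= rnorm (stone_ext f U).
Proof.
move=> Uc; have UF := proper U; apply/ler_addgt0Pl => e e0.
have [s [/= fs cs]] := filter_ex (filterI (stone_extP f U e0) Uc).
rewrite (le_trans cs)// -[f s](subrK (stone_ext f U)).
by rewrite (le_trans (ler_rnormD _ _))// lerD.
Qed.

(** Since G U is the limit of g along U, the set where G > a is the countable union of the clopen
    sets given by g >= a + 1/(n+1). *)
Lemma measurable_stone_limit (g : S -> R) (G : T -> R) :
  (forall U e, 0 < e -> sval (U : stone s0) [set s | `|g s - G U| <= e]) ->
  measurable_fun setT G.
Proof.
move=> gG; apply: (measurability _ (RGenOInfty.measurableE R)) => _ [_ [a ->] <-].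
rewrite setTI; have -> : G @^-1` `]a, +oo[ =
    \bigcup_n clopen [set s | a + n.+1%:R^-1 <= g s].
  apply/seteqP; split=> U /=; rewrite in_itv /= andbT.
    move=> aG; pose d := (G U - a) / 2.
    have d0 : 0 < d by rewrite divr_gt0// subr_gt0.
    have [n nd] : exists n, n.+1%:R^-1 < d.
      exists (Num.truncn d^-1); rewrite -ltf_pV2 ?(posrE,invr_gt0)// invrK truncnS_gt//.
    exists n => //; have UF := proper U.
    apply: filterS (gG U _ d0) => s /=; rewrite ler_norml => /andP[gs _].
    rewrite (le_trans (lerD (lexx a) (ltW nd)))//.
    have -> : a + d = - d + G U by rewrite /d; lra.
    by rewrite -lerBrDr.
  move=> [n _ Un]; have UF := proper U.
  have n0 : 0 < n.+1%:R^-1 / 2 :> R by rewrite divr_gt0// invr_gt0.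
  have [s [/= ngs]] := filter_ex (filterI Un (gG U _ n0)).
  rewrite ler_norml => /andP[_]; rewrite lerBlDr.
  by move: n0 ngs; set r : R := n.+1%:R^-1; lra.
apply: bigcupT_measurable => n; apply: sub_sigma_algebra; exact: measurable_clopen.
Qed.

Lemma stone_ext_measurable f : scalar_measurable (stone_ext f).
Proof.
split.
  apply: (@measurable_stone_limit (fun s => re_part (f s))) => U e e0.
  have UF := proper U.
  apply: filterS (stone_extP f U e0) => s /= fs.
  by rewrite -re_partB (le_trans _ fs)// norm_re_le.
apply: (@measurable_stone_limit (fun s => im_part (f s))) => U e e0.
have UF := proper U.
apply: filterS (stone_extP f U e0) => s /= fs.
by rewrite -im_partB (le_trans _ fs)// norm_im_le.
Qed.

Variable mu : {finite_measure set T -> \bar R}.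

Lemma stone_ext_Linfty_norm f : (scalar_Lnorm mu +oo (stone_ext f) <= (rnorm f)%:E)%E.
Proof.
rewrite /scalar_Lnorm unlock; case: ifPn => _; last by rewrite lee_fin rnorm_ge0.
apply/ess_supP; apply: nearW => U /=.
by rewrite lee_fin ger0_norm ?rnorm_ge0// stone_ext_le.
Qed.

Lemma stone_ext_Lpfun f : stone_ext f \in Lpfun_pred mu (leey 1).
Proof.
apply/asboolP; split; first exact: stone_ext_measurable.
by rewrite (le_lt_trans (stone_ext_Linfty_norm f))// ltry.
Qed.

Definition stone_Linfty f : Lp (k := k) mu (leey 1) := Lp_class (LpFun (stone_ext_Lpfun f)).

Lemma stone_Linfty_is_lop : stone_Linfty \in lop_pred (linf R k S) (Lp (k := k) mu (leey 1)).
Proof.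
apply: (@linear_bounded_is_lop _ _ _ _ _ 1) => [a f g|f].
  transitivity (Lp_class (a *: LpFun (stone_ext_Lpfun f) + LpFun (stone_ext_Lpfun g))).
    2: by rewrite Lp_classD Lp_classZ.
  by congr Lp_class; apply/val_inj/funext => U; exact: stone_ext_linear.
rewrite mul1r rnorm_Lp -lee_fin fineK ?Lpfun_finite//.
exact: stone_ext_Linfty_norm.
Qed.

End StoneExtension.

(** * Domination of a mean by an integral over the ultrafilters *)

Section FloorSums.
Context {R : realType}.

(** The sum counts the integers from 1 to K that are at most x. This bound and the next one are the
    two sides of a layer-cake approximation with unit steps. *)
Lemma sum_le_indic (x : R) K : 0 <= x ->
  \sum_(i < K) (i.+1%:R <= x)%R%:R <= x.
Proof.
(* The bound by K carries the induction: if K + 1 <= x, a count of at most K + 1 is at most x. *)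
move=> x0; suff [] : \sum_(i < K) (i.+1%:R <= x)%R%:R <= K%:R :> R /\
  \sum_(i < K) (i.+1%:R <= x)%R%:R <= x by [].
elim: K => [|K [IH1 IH2]]; first by rewrite big_ord0.
rewrite big_ord_recr /=; have [Kx|_] := boolP (K.+1%:R <= x); last first.
  by rewrite addr0; split=> //; rewrite (le_trans IH1)// ler_nat.
have H : \sum_(i < K) (i.+1%:R <= x)%R%:R + 1 <= K.+1%:R :> R by rewrite -natr1 lerD2r.
by split=> //; exact: le_trans H Kx.
Qed.

Lemma sum_ge_indic (x : R) K : x <= K%:R ->
  x - 1 <= \sum_(i < K) (i.+1%:R <= x)%R%:R.
Proof.
move=> xK; suff [KS|//] : K%:R <= \sum_(i < K) (i.+1%:R <= x)%R%:R :> R \/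
    x - 1 <= \sum_(i < K) (i.+1%:R <= x)%R%:R.
  by rewrite lerBlDr (le_trans xK)// (le_trans KS)// lerDl.
elim: K {xK} => [|K IH]; first by left; rewrite big_ord0.
rewrite big_ord_recr /=; have [Kx|] := boolP (K.+1%:R <= x).
  case: IH => IH; [left|right]; first by rewrite -natr1 lerD2r.
  by rewrite (le_trans IH)// lerDl.
rewrite -ltNge addr0 => xK; right; case: IH => // IH.
by rewrite (le_trans _ IH)// lerBlDr natr1 ltW.
Qed.

End FloorSums.

Section PositiveFunctional.
Context {R : realType} {S : Type}.
Local Notation V := (linf R real_scalars S).
Variable L : V -> R.
Hypotheses (linL : real_linear L)
  (L_le : forall (f : V) (c : R), (forall s, f s <= c) -> L f <= c).

Lemma functional0 : L 0 = 0.
Proof.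
by have := linL 1 0 0; rewrite scaler0 addr0 mul1r => /(canLR (addrK _)); rewrite subrr.
Qed.

Lemma functionalZ (t : R) f : L ((t : scalars R real_scalars) *: f) = t * L f.
Proof. by have := linL t f 0; rewrite !addr0 functional0 addr0. Qed.

Lemma functionalD f g : L (f + g) = L f + L g.
Proof. by have := linL 1 f g; rewrite /= scale1r mul1r. Qed.

Lemma functional_ge0 (f : V) : (forall s, 0 <= f s) -> 0 <= L f.
Proof.
move=> f0; rewrite -oppr_le0 -mulN1r -functionalZ scaleN1r L_le// => s.
by rewrite /= fctE oppr_le0.
Qed.

Lemma bounded_indic (A : set S) : (\1_A : S -> (scalars R real_scalars)^o) \in linf_pred S.
Proof.
by apply/asboolP; exists 1 => s _; rewrite /rnorm /= indicE; case: (_ \in _); rewrite ?normr1 ?normr0.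
Qed.

Definition functional_fun (A : set S) : R := L (Linf (bounded_indic A)).

Lemma functional_fun_ge0 A : 0 <= functional_fun A.
Proof. by apply: functional_ge0 => s /=; rewrite indicE ler0n. Qed.

Lemma functional_funU A B : A `&` B = set0 ->
  functional_fun (A `|` B) = functional_fun A + functional_fun B.
Proof.
move=> AB; rewrite -functionalD; congr L; apply/val_inj/funext => s /=.
rewrite fctE !indicE in_setU -natrD; congr (_%:R).
have [sA|//] := boolP (s \in A); have [sB|//] := boolP (s \in B).
have : (A `&` B) s by split; exact/set_mem.
by rewrite AB.
Qed.

Definition functional_fa : finitely_additive R S :=
  FinitelyAdditive functional_fun_ge0 functional_funU.

Variable s0 : S.
Local Notation T := (stone_measurable s0).
Local Notation mu := (@stone_measure R S s0 functional_fa).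

(** With step n = 1/N < e, let X be n times the sum of the indicators of the sets A i where g >= (i
    + 1) n. Then g - X <= n, so L g is at most n plus the sum of n m(A i), where m is the additive
    set function of L. The measure gives [clopen (A i)] the mass m(A i), and G >= (i + 1) n there,
    so the matching sum of indicators of clopen sets lies below G. *)
Theorem functional_le_integral (g : V) (G : T -> R) :
  (forall s, 0 <= g s) -> measurable_fun setT G -> (forall U, 0 <= G U) ->
  (forall c U, 0 <= c -> sval (U : stone s0) [set s | c <= g s] -> c <= G U) ->
  ((L g)%:E <= \int[mu]_U (G U)%:E)%E.
Proof.
move=> g0 mG G0 gG; apply/lee_addgt0Pr => e e0.
pose N := (Num.truncn e^-1).+1.
have N0 : 0 < N%:R :> R by [].
have Ne : N%:R^-1 < e by rewrite invf_plt// ?posrE// truncnS_gt.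
pose n : R := N%:R^-1; have n0 : 0 < n by rewrite invr_gt0.
(* Enough levels of height n to exceed the norm of g. *)
pose K := (Num.truncn (N%:R * rnorm g)).+1.
pose A (i : nat) := [set s | i.+1%:R * n <= g s].
have AE i s : (s \in A i)%:R = (i.+1%:R <= N%:R * g s)%R%:R :> R.
  rewrite mulrC -ler_pdivrMr//; congr (nat_of_bool _)%:R.
  by apply/idP/idP; rewrite inE.
have L1 : L g <= n + \sum_(i < K) n * functional_fa (A i).
  pose X : V := \sum_(i < K) (n : scalars R real_scalars) *: Linf (bounded_indic (A i)).
  have LX : L X = \sum_(i < K) n * functional_fa (A i).
    rewrite /X; elim/big_ind2 : _ => [|a b c d <- <-|i _]; first exact: functional0.
      exact: functionalD.
    by rewrite functionalZ.
  have XE s : X s = n * \sum_(i < K) (i.+1%:R <= N%:R * g s)%R%:R.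
    rewrite mulr_sumr /X.
    elim/big_ind2 : _ => [//|a b c d <- <- //|i _].
    by rewrite -AE -indicE.
  rewrite -[g](subrK X) functionalD LX lerD2r; apply: L_le => s.
  rewrite -[leLHS]/(g s - X s) XE.
  rewrite lerBlDr -{1}[n]mulr1 -mulrDr /n mulrC ler_pdivlMr// mulrC.
  rewrite addrC -lerBlDr; apply: sum_ge_indic.
  rewrite (le_trans _ (ltW (truncnS_gt _)))// ler_wpM2l ?(ltW N0)//.
  by have := linf_le g s; rewrite /rnorm /= ger0_norm.
have L2 : (\sum_(i < K) (n * functional_fa (A i))%:E <= \int[mu]_U (G U)%:E)%E.
  have mA i : measurable (clopen (A i) : set T).
    by apply: sub_sigma_algebra; exact: measurable_clopen.
  have mE i : measurable_fun setT (fun U : T => (n * \1_(clopen (A i) : set T) U)%:E).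
    apply: measurableT_comp => //; apply: measurable_funM => //.
  have -> : (\sum_(i < K) (n * functional_fa (A i))%:E =
      \int[mu]_U (\sum_(i < K) (n * \1_(clopen (A i) : set T) U)%:E))%E.
    rewrite ge0_integral_sum//; last first.
      by move=> i U _; rewrite lee_fin mulr_ge0 ?(ltW n0)// indicE ler0n.
    apply: eq_bigr => i _; under eq_integral do rewrite EFinM.
    rewrite ge0_integralZl//; last 2 first.
    - exact: measurableT_comp.
    - by rewrite lee_fin ltW.
    by rewrite integral_indic// setIT [X in (_ * X)%E]stone_measure_clopen EFinM.
  apply: ge0_le_integral => //.
  - by move=> U _; apply: sume_ge0 => i _; rewrite lee_fin mulr_ge0 ?(ltW n0)// indicE ler0n.
  - by apply: emeasurable_sum => i; exact: mE.
  - exact: measurableT_comp.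
  move=> U _; rewrite sumEFin lee_fin -mulr_sumr /n mulrC ler_pdivrMr// mulrC.
  apply: le_trans (sum_le_indic K (mulr_ge0 (ltW N0) (G0 U))).
  apply: ler_sum => i _; rewrite indicE ler_nat.
  have [|//] := boolP (U \in _); rewrite inE => /= UA.
  suff -> : i.+1%:R <= N%:R * G U by [].
  rewrite mulrC -ler_pdivrMr//; apply: gG => //.
rewrite (le_trans (y := (n + \sum_(i < K) n * functional_fa (A i))%:E)) ?lee_fin//.
rewrite addeC EFinD leeD// ?lee_fin ?(ltW Ne)// -sumEFin.
exact: L2.
Qed.

End PositiveFunctional.

(** * Norm estimates for the inclusion of L_oo in L_q *)

Section LpInclusionNorms.
Context {R : realType} {k : scalar_kind} {d : measure_display} {T : measurableType d}.
Local Notation K := (scalars R k).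
Variable mu : {finite_measure set T -> \bar R}.
Local Notation Linfty := (Lp (k := k) mu (leey 1)).

Lemma rnorm_LpE (p : \bar R) (p1 : (1 <= p)%E) (x : Lp (k := k) mu p1) :
  (rnorm x)%:E = scalar_Lnorm mu p (Lp_fun x).
Proof. by rewrite -{1}(Lp_funK x) rnorm_Lp fineK// Lpfun_finite. Qed.

Lemma Linfty_ae_le (x : Linfty) : \forall t \ae mu, rnorm (Lp_fun x t) <= rnorm x.
Proof.
have := rnorm_LpE x; rewrite /scalar_Lnorm unlock.
case: ifPn => [_ xE|]; last first.
  rewrite -leNgt measure_le0 => /eqP mu0 _.
  by exists setT; split=> //; exact: measurableT.
have : (ess_sup mu (abse \o (fun t => (rnorm (Lp_fun x t))%:E)) <= (rnorm x)%:E)%E.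
  by rewrite xE.
move=> /ess_supP; apply: filterS => t /=.
by rewrite lee_fin ger0_norm ?rnorm_ge0.
Qed.

Variables (q : R) (q1 : (1 <= q%:E)%E).
Let q0 : 0 < q.
Proof. by rewrite (lt_le_trans ltr01)// -lee_fin. Qed.

Lemma scalar_Lnorm_powR (f : T -> K^o) :
  (scalar_Lnorm mu q%:E f `^ q = \int[mu]_t (rnorm (f t) `^ q)%:E)%E.
Proof.
rewrite /scalar_Lnorm (poweR_Lnorm _ _ (lt0r_neq0 q0)).
by apply: eq_integral => t _; rewrite /= ger0_norm ?rnorm_ge0.
Qed.

Lemma Linfty_incl_powR (x : Linfty) :
  ((rnorm (Linfty_incl q1 x) `^ q)%:E = \int[mu]_t (rnorm (Lp_fun x t) `^ q)%:E)%E.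
Proof.
by rewrite rnorm_Lp -scalar_Lnorm_powR -poweR_EFin fineK// Lpfun_finite.
Qed.

Lemma Linfty_incl_class_powR (f : Lpfun (k := k) mu (leey 1)) :
  ((rnorm (Linfty_incl q1 (Lp_class f)) `^ q)%:E = \int[mu]_t (rnorm (f t) `^ q)%:E)%E.
Proof.
rewrite Linfty_incl_powR -!scalar_Lnorm_powR; congr (_ `^ _)%E.
apply: ae_eq_scalar_Lnorm => //; try exact: Lpfun_measurable.
by apply/Lp_classP; rewrite Lp_funK.
Qed.

(** The sum of the q-th powers of the L_q norms is the integral of the pointwise sum, so an almost
    everywhere bound on the tuple can be integrated. *)
Lemma Linfty_incl_fin_norm n (x : 'I_n -> Linfty) (M : R) : 0 <= M ->
  (\forall t \ae mu, fin_lp_norm q%:E (fun i => rnorm (Lp_fun (x i) t)) <= M) ->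
  fin_lp_norm q%:E (fun i => rnorm (Linfty_incl q1 (x i))) <=
  M * fine (mu setT) `^ q^-1.
Proof.
move=> M0 xM; have muT : mu setT = (fine (mu setT))%:E.
  by rewrite fineK// fin_num_measure.
have muT0 : 0 <= fine (mu setT) by rewrite fine_ge0.
suff H : \sum_(i < n) rnorm (Linfty_incl q1 (x i)) `^ q <= M `^ q * fine (mu setT).
  have -> : M * fine (mu setT) `^ q^-1 = (M `^ q * fine (mu setT)) `^ q^-1.
    by rewrite powRM ?powR_ge0// -powRrM mulfV ?gt_eqF// powRr1.
  by rewrite ge0_ler_powR ?invr_ge0 ?(ltW q0)// nnegrE ?sum_powR_ge0 ?mulr_ge0 ?powR_ge0.
have mf i : measurable_fun setT (fun t => (rnorm (Lp_fun (x i) t) `^ q)%:E).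
  apply: measurableT_comp => //.
  apply: (@measurableT_comp _ _ _ _ _ _ (@powR R ^~ q)) => //.
  exact/measurable_rnorm/Lpfun_measurable.
rewrite -lee_fin -sumEFin; under eq_bigr do rewrite Linfty_incl_powR.
rewrite -ge0_integral_sum//; last by move=> i t _; rewrite lee_fin powR_ge0.
rewrite EFinM -muT -(integral_cst mu measurableT).
apply: ae_ge0_le_integral => //.
- by move=> t _; apply: sume_ge0 => i _; rewrite lee_fin powR_ge0.
- exact: emeasurable_sum.
- by move=> t _; rewrite lee_fin powR_ge0.
apply: filterS xM => t tM _; rewrite sumEFin lee_fin.
rewrite -(fin_lp_norm_powR (fun i => rnorm (Lp_fun (x i) t))); last by rewrite -lee_fin.
by rewrite ge0_ler_powR ?(ltW q0) ?nnegrE ?fin_lp_norm_ge0.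
Qed.

Lemma Linfty_incl_le (x : Linfty) :
  rnorm (Linfty_incl q1 x) <= fine (mu setT) `^ q^-1 * rnorm x.
Proof.
have fin1 (c : R) : 0 <= c -> fin_lp_norm q%:E (fun _ : 'I_1 => c) = c.
  by move=> c0; rewrite /fin_lp_norm big_ord1 -powRrM mulfV ?gt_eqF// powRr1.
rewrite -(fin1 (rnorm (Linfty_incl q1 x))) ?rnorm_ge0// mulrC.
apply: (@Linfty_incl_fin_norm 1 (fun=> x)); first exact: rnorm_ge0.
by apply: filterS (Linfty_ae_le x) => t tx; rewrite fin1 ?rnorm_ge0.
Qed.

Lemma Linfty_incl_linear : linear (Linfty_incl (k := k) (mu := mu) q1).
Proof.
move=> a x y.
transitivity (Lp_class (a *: LpFun (Linfty_incl_subproof q1 (Lp_fun x)) +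
                        LpFun (Linfty_incl_subproof q1 (Lp_fun y)))).
  2: by rewrite Lp_classD Lp_classZ.
apply/Lp_classP; have : Lp_class (Lp_fun (a *: x + y)) = Lp_class (a *: Lp_fun x + Lp_fun y).
  by rewrite Lp_funK Lp_classD Lp_classZ !Lp_funK.
by move=> /Lp_classP; apply: filterS => t /= ->.
Qed.

End LpInclusionNorms.

(** * Pietsch domination and integral operators *)

Section Suprema.
Context {R : realType} {S : Type} (s0 : S).
Local Notation V := (linf R real_scalars S).

Definition supremum (f : V) : R := sup (range f).

Lemma supremum_ub (f : V) s : f s <= supremum f.
Proof.
apply: ub_le_sup; last by exists s.
exists (rnorm f) => _ [t _ <-]; rewrite (le_trans (ler_norm _))//.
exact: (linf_le f t).
Qed.

Lemma supremum_le (f : V) (c : R) : (forall s, f s <= c) -> supremum f <= c.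
Proof. by move=> fc; apply: ge_sup; [exists (f s0), s0|move=> _ [s _ <-]]. Qed.

Lemma supremum_sublinear : sublinear supremum.
Proof.
split=> [f g|t f t0].
  by apply: supremum_le => s; exact: lerD (supremum_ub f s) (supremum_ub g s).
apply/eqP; rewrite eq_le; apply/andP; split.
  by apply: supremum_le => s; apply: ler_wpM2l t0 _ _ (supremum_ub f s).
have [->|tn0] := eqVneq t 0.
  rewrite mul0r; have := supremum_ub (of_real 0 *: f) s0.
  by rewrite [X in X <= _]mul0r.
have {tn0}t0 : 0 < t by rewrite lt_def tn0.
rewrite -ler_pdivlMl//; apply: supremum_le => s; rewrite ler_pdivlMl//.
exact: (supremum_ub (of_real t *: f) s).
Qed.

End Suprema.

(** * Summing adjoints and Pietsch domination *)

Section CohenSumming.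
Context {R : realType} {k : scalar_kind}.
Local Notation K := (scalars R k).

Lemma conjugate_exponents_hoelder (p q : \bar R) :
  conjugate_exponents p q -> hoelder_conjugate p = q.
Proof.
case=> [||r s r1 s1 rs]; [exact: hoelder_conjugate1|by []|].
have [r0 s0] : 0 < r /\ 0 < s by split; exact: lt_trans ltr01 _.
have invE (t : R) : 0 < t -> (t%:E^-1 = (t^-1)%:E)%E by move=> t0; rewrite inver gt_eqF.
have rn0 : r%:E != 0%E by apply/eqP => -[] /eqP; rewrite gt_eqF.
apply/esym; apply/(hoelder_conjugateP _ (ltNyr r) rn0).
by rewrite !invE// -EFinD rs.
Qed.

Variables (D X : normedModType K) (v : lop D X) (p : \bar R) (q : R).
Hypothesis (pq : conjugate_exponents p q%:E) (cv : cohen_ideal p v).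

Let q1 : (1 <= q%:E)%E := conjugate_exponents_ge1 (conjugate_exponents_sym pq).
Let q0 : 0 < q.
Proof. by rewrite (lt_le_trans ltr01)// -lee_fin. Qed.
Let p1 : (1 <= p)%E := conjugate_exponents_ge1 pq.

Local Notation ball := {y : X | closed_unit_ball y}.

Let ball0 : ball.
Proof. by exists 0; rewrite /closed_unit_ball /= rnorm0. Qed.

(** The weak l_q norm of a tuple in X^*; for functionals the supremum over the ball of X itself is
    enough. *)
Definition weak_norm n (psi : 'I_n -> dual X) :=
  sup [set fin_lp_norm q%:E (fun i => rnorm (psi i y)) | y in closed_unit_ball (E := X)].

Lemma weak_norm_ub n (psi : 'I_n -> dual X) (y : ball) :
  fin_lp_norm q%:E (fun i => rnorm (psi i (sval y))) <= weak_norm psi.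
Proof.
apply: ub_le_sup; last by exists (sval y) => //; exact: (svalP y).
exists (fin_lp_norm q%:E (fun i => rnorm (psi i))) => _ [z Bz <-].
apply: fin_lp_norm_le => // i; rewrite rnorm_ge0 /= (le_trans (lop_le _ _))//.
by rewrite ler_piMr ?rnorm_ge0.
Qed.

Lemma weak_norm_le n (psi : 'I_n -> dual X) (c : R) :
  (forall y : ball, fin_lp_norm q%:E (fun i => rnorm (psi i (sval y))) <= c) ->
  weak_norm psi <= c.
Proof.
move=> H; apply: ge_sup => [|_ [y By <-]]; last exact: (H (exist _ y By)).
exists (fin_lp_norm q%:E (fun i => rnorm (psi i (sval ball0)))), (sval ball0) => //.
exact: (svalP ball0).
Qed.

(* The adjoint of a Cohen strongly [p]-summing operator is [q]-summing. *)
Lemma cohen_adjoint_summing : exists2 C : R, 0 < C &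
  forall n (psi : 'I_n -> dual X) (phi : 'I_n -> D),
    (forall i, closed_unit_ball (phi i)) ->
    fin_lp_norm q%:E (fun i => rnorm (psi i (v (phi i)))) <= C * weak_norm psi.
Proof.
case: cv => C C0 vC; exists (C + 1) => [|n psi phi Bphi]; first by rewrite ltr_wpDl.
have W0 : 0 <= weak_norm psi by rewrite (le_trans _ (weak_norm_ub psi ball0))// fin_lp_norm_ge0.
(* The norming weights b_i are moved into the arguments b_i phi_i, whose l_p norm is then at most
   1. *)
have [b [b0 b1 <-]] := fin_lp_dual pq (fun i => rnorm_ge0 (psi i (v (phi i)))).
have rb i : rnorm (of_real (b i) : K^o) = b i by rewrite rnorm_of_real ger0_norm.
have := vC n (fun i => of_real (b i) *: phi i) psi.
rewrite (conjugate_exponents_hoelder pq) -/(weak_norm psi).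
under eq_bigr do rewrite !lopZ rnormZ rb.
move=> /le_trans; apply; rewrite ler_wpM2r//.
apply: (@le_trans _ _ (C * 1)); last by rewrite mulr1 lerDl.
rewrite ler_wpM2l// (le_trans _ b1)// fin_lp_norm_le// => i.
rewrite rnorm_ge0 rnormZ rb ler_piMr//; exact: Bphi.
Qed.

Lemma restrict_ball_subproof (psi : dual X) :
  (fun y : ball => psi (sval y)) \in linf_pred ball.
Proof.
apply/asboolP; exists (rnorm psi) => y _; rewrite (le_trans (lop_le _ _))//.
by rewrite ler_piMr ?rnorm_ge0//; exact: (svalP y).
Qed.
Definition restrict_ball (psi : dual X) : linf R k ball := Linf (restrict_ball_subproof psi).

Lemma restrict_ball_linear : linear restrict_ball.
Proof. by move=> a f g; exact/val_inj. Qed.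

Lemma power_ball_subproof (psi : dual X) :
  (fun y : ball => rnorm (psi (sval y)) `^ q : (scalars R real_scalars)^o) \in linf_pred ball.
Proof.
apply/asboolP; exists (rnorm psi `^ q) => y _.
rewrite /rnorm /= ger0_norm ?powR_ge0// ge0_ler_powR ?nnegrE ?(ltW q0) ?rnorm_ge0//.
by rewrite (le_trans (lop_le _ _))// ler_piMr ?rnorm_ge0//; exact: (svalP y).
Qed.
Definition power_ball (psi : dual X) : linf R real_scalars ball := Linf (power_ball_subproof psi).

(** Pietsch's separation argument with a mean L in place of a probability measure, so the ball
    remains a bare set. *)
Theorem pietsch_domination : exists C : R, exists2 L : linf R real_scalars ball -> R,
  [/\ 0 < C, real_linear L &
    forall (f : linf R real_scalars ball) (c : R), (forall s, f s <= c) -> L f <= c] &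
  forall (psi : dual X) (phi : D), closed_unit_ball phi ->
    rnorm (psi (v phi)) `^ q <= C `^ q * L (power_ball psi).
Proof.
have [C C0 vC] := cohen_adjoint_summing.
pose V := linf R real_scalars ball.
have one_linf : (fun=> 1 : (scalars R real_scalars)^o) \in linf_pred ball.
  by apply/asboolP; exists 1 => s _; rewrite /rnorm /= normr1.
pose one : V := Linf one_linf.
pose term (c : dual X * D) : V :=
  (C `^ q : scalars R real_scalars) *: power_ball c.1 -
  (rnorm (c.1 (v c.2)) `^ q : scalars R real_scalars) *: one.
have termE c y : term c y = C `^ q * rnorm (c.1 (sval y)) `^ q - rnorm (c.1 (v c.2)) `^ q.
  by rewrite -[X in _ = _ - X]mulr1.
have sum_termE (r : seq (dual X * D)) y : (\sum_(x <- r) term x) y =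
    C `^ q * (\sum_(x <- r) rnorm (x.1 (sval y)) `^ q) -
    \sum_(x <- r) rnorm (x.1 (v x.2)) `^ q.
  elim: r => [|c r IHr]; first by rewrite !big_nil mulr0 subr0.
  by rewrite !big_cons mulrDr opprD addrACA -IHr -termE.
(* The summing inequality says that every function in the cone has a nonnegative
   supremum, so Mazur-Orlicz gives a mean that is nonnegative on it. *)
pose cone := [set c : V * R | exists r : seq (dual X * D),
  (forall x, x \in r -> closed_unit_ball x.2) /\ c = (\sum_(x <- r) term x, 0)].
have [||||L [linL Lsup Lcone]] := @mazur_orlicz R real_scalars V (@supremum R ball) cone
  (supremum_sublinear ball0).
- by exists [::]; rewrite big_nil; split.
- move=> _ _ [r [Br ->]] [r' [Br' ->]] /=; exists (r ++ r'); rewrite big_cat addr0; split=> // x.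
  by rewrite mem_cat => /orP[/Br|/Br'].
- move=> t _ t0 [r [Br ->]] /=.
  (* The functions [term] are homogeneous of degree q in the functional, hence the root of t. *)
  exists [seq (of_real (t `^ q^-1) *: x.1, x.2) | x <- r]; split.
    by move=> _ /mapP[x xr ->] /=; exact: Br.
  rewrite mulr0 big_map scaler_sumr; congr pair; apply: eq_bigr => c _.
  have tq (z : K^o) : rnorm (of_real (t `^ q^-1) * z : K^o) `^ q = t * rnorm z `^ q.
    rewrite rnormM rnorm_of_real ger0_norm ?powR_ge0// powRM ?powR_ge0 ?rnorm_ge0//.
    by rewrite -powRrM mulVf ?gt_eqF// powRr1// ltW.
  apply/val_inj/funext => y; rewrite [RHS]termE /= !tq mulrCA -mulrBr.
  by rewrite -termE.
- move=> _ [r [Br ->]] /=.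
  pose psi i := (tnth (in_tuple r) i).1; pose phi i := (tnth (in_tuple r) i).2.
  have Bphi i : closed_unit_ball (phi i) by apply: Br; exact: mem_tnth.
  pose f : V := \sum_(x <- r) term x; rewrite -/f; set M := supremum f.
  have [A AE] : exists A, A = fin_lp_norm q%:E (fun i => rnorm (psi i (v (phi i)))) by eexists.
  have q1' : 1 <= q by rewrite -lee_fin.
  (* Taking the supremum over y bounds (C W)^q by M + A^q, where W is the weak norm. The summing
     inequality A <= C W then gives A^q <= M + A^q, that is M >= 0. *)
  have Mle (y : ball) : C `^ q * fin_lp_norm q%:E (fun i => rnorm (psi i (sval y))) `^ q <= M + A `^ q.
    rewrite -lerBlDr.
    rewrite (fin_lp_norm_powR (fun i => rnorm (psi i (sval y))) q1').
    rewrite AE (fin_lp_norm_powR (fun i => rnorm (psi i (v (phi i)))) q1').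
    have := @supremum_ub R ball f y; rewrite -/M [f y]sum_termE.
    by rewrite !(big_tnth _ _ r).
  have Cq0 : 0 < C `^ q by rewrite powR_gt0.
  have MA0 : 0 <= M + A `^ q.
    by rewrite (le_trans _ (Mle ball0))// mulr_ge0 ?powR_ge0.
  have W : weak_norm psi <= ((M + A `^ q) / C `^ q) `^ q^-1.
    apply: weak_norm_le => y.
    rewrite -[leLHS](powRr1 (fin_lp_norm_ge0 _ _)) -(mulfV (lt0r_neq0 q0)) powRrM.
    rewrite ge0_ler_powR ?invr_ge0 ?(ltW q0) ?nnegrE ?powR_ge0 ?divr_ge0 ?powR_ge0//.
    by rewrite ler_pdivlMr// mulrC.
  have AW : A `^ q <= M + A `^ q.
    have W0 : 0 <= weak_norm psi by rewrite (le_trans _ (weak_norm_ub psi ball0))// fin_lp_norm_ge0.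
    have A0 : 0 <= A by rewrite AE fin_lp_norm_ge0.
    have := vC _ psi phi Bphi; rewrite -AE => A_le.
    rewrite (le_trans (y := (C * weak_norm psi) `^ q))//.
      by rewrite ge0_ler_powR ?(ltW q0) ?nnegrE ?mulr_ge0 ?(ltW C0).
    rewrite powRM ?(ltW C0)// mulrC -ler_pdivlMr//.
    rewrite -[leRHS](powRr1 (divr_ge0 MA0 (ltW Cq0))) -(mulVf (lt0r_neq0 q0)) powRrM.
    by rewrite ge0_ler_powR ?(ltW q0) ?nnegrE ?powR_ge0.
  by rewrite -(lerD2r (A `^ q)) add0r.
have L_le (f : V) (c : R) : (forall s, f s <= c) -> L f <= c.
  by move=> fc; rewrite (le_trans (Lsup f))// (supremum_le ball0).
exists C, L; first by split.
move=> psi phi Bphi.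
have Lterm : 0 <= L (term (psi, phi)).
  apply: (Lcone (term (psi, phi), 0)); exists [:: (psi, phi)]; rewrite big_seq1; split=> // x.
  by rewrite inE => /eqP ->.
have LN f : L (- f) = - L f.
  by have := functionalZ linL (-1) f; rewrite scaleN1r mulN1r.
have L1 : 1 <= L one by rewrite -lerN2 -LN L_le.
move: Lterm; rewrite /term (functionalD linL) LN !(functionalZ linL) /= subr_ge0.
by apply: le_trans; rewrite ler_peMr ?powR_ge0.
Qed.

End CohenSumming.

(** * From Cohen strongly summing adjoints to integral factorizations *)

Section CohenToIntegral.
Context {R : realType} {k : scalar_kind}.
Local Notation K := (scalars R k).

Lemma poly_eval_subproof m (E : normedModType K) (x : E) :
  (fun s : hpoly m E K^o => s x) \in lop_pred (hpoly m E K^o) K^o.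
Proof.
apply: (@linear_bounded_is_lop _ _ _ _ _ (rnorm x ^+ m)) => // s.
by rewrite mulrC; exact: hpoly_le.
Qed.
Definition poly_eval m (E : normedModType K) (x : E) : dual (hpoly m E K^o) :=
  Lop (poly_eval_subproof m x).

Lemma linear_lop (E F : normedModType K) (u : E -> F) (C : R) : linear u ->
  (forall x, rnorm (u x) <= C * rnorm x) -> exists v : lop E F, forall x, v x = u x.
Proof. by move=> lu uC; exists (Lop (linear_bounded_is_lop lu uC)). Qed.

Theorem cohen_dual_integral (m : nat) (E F : completeNormedModType K)
    (p : \bar R) (q : R) : conjugate_exponents p q%:E ->
  polynomial_dual (cohen_ideal p) m E F `<=`
  injective_hull (composition_ideal (integral_ideal q)) m E F.
Proof.
move=> pq P cP.
have q1 : (1 <= q%:E)%E := conjugate_exponents_ge1 (conjugate_exponents_sym pq).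
have q0 : 0 < q by rewrite (lt_le_trans ltr01)// -lee_fin.
pose X : normedModType K := hpoly m E K^o.
pose v : lop (dual F) X := hpoly_adjoint P.
have [C [L [C0 linL L_le] domL]] := pietsch_domination pq cP.
pose S := {s : X | closed_unit_ball s}.
have s0 : S by exists 0; rewrite /closed_unit_ball /= rnorm0.
pose mu := @stone_measure R S s0 (functional_fa linL L_le).
pose aop : lop (linf R k S) (Lp (k := k) mu (leey 1)) := Lop (stone_Linfty_is_lop mu).
pose iota (f : linf R k S) : Lp (k := k) mu q1 := Linfty_incl q1 (aop f).
have iota_lin : linear iota.
  by move=> a f g; rewrite /iota lop_linear Linfty_incl_linear.
have dom (psi : dual X) (phi : dual F) : closed_unit_ball phi ->
    rnorm (psi (v phi)) <= C * rnorm (iota (restrict_ball psi)).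
  move=> Bphi; pose f := restrict_ball psi.
  have powE : (rnorm (iota f) `^ q)%:E = (\int[mu]_U (rnorm (stone_ext f U) `^ q)%:E)%E.
    exact: (Linfty_incl_class_powR q1 (LpFun (stone_ext_Lpfun mu f))).
  have Lle : L (power_ball pq psi) <= rnorm (iota f) `^ q.
    rewrite -lee_fin powE.
    apply: (@functional_le_integral R S L linL L_le s0 (power_ball pq psi)
      (fun U => rnorm (stone_ext f U) `^ q)) => [s||U|c U c0 Uc].
    - exact: powR_ge0.
    - apply: (@measurableT_comp _ _ _ _ _ _ (@powR R ^~ q)) => //.
      exact/measurable_rnorm/stone_ext_measurable.
    - exact: powR_ge0.
    - rewrite -[c](powRr1 c0) -(mulVf (lt0r_neq0 q0)) powRrM.
      rewrite ge0_ler_powR ?(ltW q0) ?nnegrE ?powR_ge0 ?rnorm_ge0//.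
      apply: stone_ext_ge; have UF : ProperFilter (sval U) by case: U {Uc} => U ?; exact: ultra_proper.
      apply: filterS Uc => s /= cs.
      rewrite -[leRHS](powRr1 (rnorm_ge0 _)) -(mulfV (lt0r_neq0 q0)) powRrM.
      by rewrite ge0_ler_powR ?invr_ge0 ?(ltW q0) ?nnegrE ?powR_ge0.
  have := domL psi phi Bphi.
  move=> /le_trans/(_ (ler_wpM2l (powR_ge0 _ _) Lle)).
  rewrite -powRM ?(ltW C0) ?rnorm_ge0// => H.
  rewrite -[leLHS](powRr1 (rnorm_ge0 _)) -[leRHS](powRr1 (mulr_ge0 (ltW C0) (rnorm_ge0 _))).
  rewrite -(mulfV (lt0r_neq0 q0)) !powRrM.
  by rewrite ge0_ler_powR ?invr_ge0 ?(ltW q0) ?nnegrE ?powR_ge0.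
(* By [dom], psi (v phi) depends only on the image of psi in L_q. The extension bound C is the same
   for all phi, so the g phi are the coordinates of one operator into l_oo(B_{F^*}). *)
have /choice[g gP] (phi : dual_ball F) : exists g : Lp (k := k) mu q1 -> K^o,
    [/\ linear g, forall psi, g (iota (restrict_ball psi)) = psi (v (sval phi)) &
      forall x, rnorm (g x) <= C * rnorm x].
  case: phi => phi Bphi.
  apply: (@hahn_banach R k (Lp (k := k) mu q1) (dual X) (fun x => C * rnorm x)
    (fun psi => iota (restrict_ball psi)) (fun psi => psi (v phi))) => //.
  - by move=> x y; rewrite -mulrDr ler_wpM2l ?(ltW C0)// ler_rnormD.
  - by move=> a x; rewrite rnormZ mulrCA.
  - by move=> a x y; rewrite restrict_ball_linear iota_lin.
  - by move=> psi; exact: dom.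
have glinf x : (fun phi => g phi x) \in linf_pred (dual_ball F).
  by apply/asboolP; exists (C * rnorm x) => phi _; have [_ _] := gP phi; exact.
have [b0 b0E] : exists b0 : lop (Lp (k := k) mu q1) (linf R k (dual_ball F)),
    forall x, b0 x = Linf (glinf x).
  apply: (@linear_lop _ _ (fun x => Linf (glinf x)) C) => [a x y|x].
    by apply/val_inj/funext => phi; have [lg _ _] := gP phi; exact: lg.
  apply: linf_rnorm_le => [|phi]; first by rewrite mulr_ge0 ?(ltW C0) ?rnorm_ge0.
  by have [_ _] := gP phi; exact.
have [u uE] : exists u : lop (linf R k S) (linf R k (dual_ball F)),
    forall f, u f = b0 (iota f).
  apply: (@linear_lop _ _ (fun f => b0 (iota f))
    (rnorm b0 * (fine (mu setT) `^ q^-1 * rnorm aop))) => [a f h|f].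
    by rewrite iota_lin lop_linear.
  rewrite -mulrA (le_trans (lop_le _ _))// ler_wpM2l ?rnorm_ge0//.
  rewrite (le_trans (Linfty_incl_le _ _))// -mulrA ler_wpM2l ?powR_ge0//.
  exact: lop_le.
have [Q QE] := universal_hpoly m E.
exists (linf R k S), Q, u; split; last first.
  apply/val_inj/funext => x; apply/val_inj/funext => phi /=.
  rewrite uE b0E /=; have [_ gE _] := gP phi.
  (* Evaluation at x is a functional on X whose restriction to the ball is Q x; on it g phi returns
     P^* phi at x. *)
  rewrite (_ : Q x = restrict_ball (poly_eval m x)) ?gE//.
  by apply/val_inj/funext => s; exact: QE.
exists q1, _, _, mu, aop, (lop_comp (bidual_embedding _) b0) => f.
by rewrite /= uE.
Qed.

End CohenToIntegral.

(** * Integral factorizations have Cohen strongly summing adjoints *)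

Section FiniteNorming.
Context {R : realType}.

Lemma fin_lp_norm_coord (p : \bar R) n (a : 'I_n -> R) i : (1 <= p)%E ->
  (forall i, 0 <= a i) -> a i <= fin_lp_norm p a.
Proof.
move=> p1 a0; case: p p1 => [r|_|//]; last exact: le_bigmax.
rewrite lee_fin => r1; have r0 : 0 < r by rewrite (lt_le_trans ltr01).
rewrite -[leLHS](powRr1 (a0 i)) -(mulfV (lt0r_neq0 r0)) powRrM.
rewrite ge0_ler_powR ?invr_ge0 ?(ltW r0) ?nnegrE ?powR_ge0 ?sum_powR_ge0//.
by rewrite (bigD1 i)//= lerDl sumr_ge0// => j _; exact: powR_ge0.
Qed.

(** The family consists of the signed points of mesh 1/M in the unit ball of l_p. Rounding the
    norming vector of |t| down to the grid stays in the ball and loses at most n/M of the norm,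
    since each |t i| is at most the norm. With M = 2n + 1 the loss is below one half, hence the
    factor 2. *)
Lemma norming_real (p q : \bar R) n : conjugate_exponents p q ->
  exists (J : finType) (b : J -> 'I_n -> R),
    (forall j, fin_lp_norm p (fun i => `|b j i|) <= 1) /\
    forall t : 'I_n -> R, exists j,
      fin_lp_norm q (fun i => `|t i|) <= 2 * `|\sum_(i < n) b j i * t i|.
Proof.
move=> pq; have p1 := conjugate_exponents_ge1 pq.
have q1 := conjugate_exponents_ge1 (conjugate_exponents_sym pq).
pose M := (2 * n).+1; have M0 : 0 < M%:R :> R by [].
pose J : finType := {ffun 'I_n -> bool * 'I_M.+1}.
pose raw (j : J) (i : 'I_n) : R := (-1) ^+ (j i).1 * ((j i).2%:R / M%:R).
(* Grid points outside the ball are replaced by 0, so that the index type does not depend on the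
   norm. *)
pose b (j : J) : 'I_n -> R :=
  if fin_lp_norm p (fun i => `|raw j i|) <= 1 then raw j else fun=> 0.
have nraw j i : `|raw j i| = (j i).2%:R / M%:R.
  by rewrite normrM normrX normrN1 expr1n mul1r ger0_norm// divr_ge0.
exists J, b; split=> [j|t].
  rewrite /b; case: ifPn => // _.
  have -> : (fun _ : 'I_n => `|0 : R|) = fun=> 0 by apply/funext => i; rewrite normr0.
  by rewrite fin_lp_norm0.
have [a [a0 a1 aE]] := @fin_lp_dual R p q n (fun i => `|t i|) pq (fun i => normr_ge0 (t i)).
have [Nt NtE] : exists Nt, Nt = fin_lp_norm q (fun i => `|t i|) by eexists.
rewrite -NtE in aE *.
have a_le1 i : a i <= 1 by rewrite (le_trans _ a1)// fin_lp_norm_coord.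
have Ma0 i : 0 <= M%:R * a i by rewrite mulr_ge0// ltW.
have trunc_lt i : (Num.truncn (M%:R * a i) < M.+1)%N.
  rewrite ltnS -(ler_nat R); apply: (@le_trans _ _ (M%:R * a i)); first by rewrite truncn_le.
  by rewrite ler_piMr// ltW.
pose j : J := [ffun i => (t i < 0, Ordinal (trunc_lt i))].
pose c i : R := (Num.truncn (M%:R * a i))%:R / M%:R.
have ca i : c i <= a i by rewrite /c ler_pdivrMr// [leRHS]mulrC truncn_le Ma0.
have ac i : a i - M%:R^-1 <= c i.
  rewrite lerBlDr /c -[X in _ + X]mul1r -mulrDl ler_pdivlMr// [leLHS]mulrC natr1.
  exact/ltW/truncnS_gt.
have c0 i : 0 <= c i by rewrite divr_ge0// ltW.
have rawc i : `|raw j i| = c i by rewrite nraw ffunE.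
have bE : b j = raw j.
  rewrite /b ifT// (le_trans _ a1)// fin_lp_norm_le// => l.
  by rewrite normr_ge0 rawc ca.
exists j; have -> : \sum_(i < n) b j i * t i = \sum_(i < n) c i * `|t i|.
  apply: eq_bigr => i _; rewrite bE /raw ffunE /= mulrAC mulrC normrEsign.
  by rewrite -/(c i).
rewrite ger0_norm; last by apply: sumr_ge0 => i _; rewrite mulr_ge0.
have Nt0 : 0 <= Nt by rewrite NtE fin_lp_norm_ge0.
have tN i : `|t i| <= Nt.
  by rewrite NtE; exact: (@fin_lp_norm_coord q n (fun i => `|t i|) i q1 (fun i => normr_ge0 (t i))).
have H : Nt - n%:R * (M%:R^-1 * Nt) <= \sum_(i < n) c i * `|t i|.
  rewrite -{1}aE mulr_natl -[X in _ *+ X]card_ord -sumr_const -sumrB.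
  apply: ler_sum => i _; rewrite (le_trans _ (ler_wpM2r (normr_ge0 _) (ac i)))//.
  by rewrite mulrBl lerD2l lerN2 ler_wpM2l ?invr_ge0 ?(ltW M0).
rewrite -ler_pdivrMl//; apply: le_trans H.
rewrite mulrA lerBrDr -lerBrDl -{2}[Nt]mul1r -mulrBl ler_wpM2r//.
have ME : M%:R = 2 * n%:R + 1 :> R by rewrite /M -natr1 natrM.
rewrite ler_pdivrMr// ME; have : 0 <= n%:R :> R by [].
by move: (n%:R : R) => r r0; lra.
Qed.

End FiniteNorming.

Section Norming.
Context {R : realType} {k : scalar_kind}.
Local Notation K := (scalars R k).

Lemma re_part_sum n (f : 'I_n -> K) : re_part (\sum_i f i) = \sum_i re_part (f i).
Proof.
elim/big_ind2 : _ => [|_ x _ y <- <-|//]; last by rewrite re_partD.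
by rewrite -(@of_real0 R k) re_part_of_real.
Qed.

Lemma im_part_sum n (f : 'I_n -> K) : im_part (\sum_i f i) = \sum_i im_part (f i).
Proof.
elim/big_ind2 : _ => [|_ x _ y <- <-|//]; last by rewrite im_partD.
by rewrite -(@of_real0 R k) im_part_of_real.
Qed.

(* Rounding the coordinates of a functional that norms [t] gives one of finitely
   many functionals, independent of [t], that norm it up to a factor. *)
Lemma finite_norming (p q : \bar R) n : conjugate_exponents p q ->
  exists (J : finType) (b : J -> 'I_n -> R),
    (forall j, fin_lp_norm p (fun i => `|b j i|) <= 1) /\
    forall t : 'I_n -> K^o, exists j,
      fin_lp_norm q (fun i => rnorm (t i)) <= 4 * rnorm (\sum_(i < n) of_real (b j i) * t i : K^o).
Proof.
move=> pq; have q1 := conjugate_exponents_ge1 (conjugate_exponents_sym pq).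
have [J [b [b1 bt]]] := norming_real n pq; exists J, b; split=> // t.
have split_le : fin_lp_norm q (fun i => rnorm (t i)) <=
    fin_lp_norm q (fun i => `|re_part (t i)|) + fin_lp_norm q (fun i => `|im_part (t i)|).
  apply: le_trans (fin_lp_normD q1 (fun i => normr_ge0 _) (fun i => normr_ge0 _)).
  by apply: fin_lp_norm_le => // i; rewrite rnorm_ge0 rnorm_re_im.
have [j1 j1E] := bt (re_part \o t); have [j2 j2E] := bt (im_part \o t).
have rE j : `|\sum_(i < n) b j i * (re_part \o t) i| <= rnorm (\sum_(i < n) of_real (b j i) * t i : K^o).
  rewrite (le_trans _ (norm_re_le _))// re_part_sum.
  by under [in leRHS]eq_bigr do rewrite re_partM re_part_of_real im_part_of_real mul0r subr0.
have iE j : `|\sum_(i < n) b j i * (im_part \o t) i| <= rnorm (\sum_(i < n) of_real (b j i) * t i : K^o).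
  rewrite (le_trans _ (norm_im_le _))// im_part_sum.
  by under [in leRHS]eq_bigr do rewrite im_partM re_part_of_real im_part_of_real mul0r addr0.
(* One factor 2 is the loss of rounding, the other comes from keeping only the larger of the real
   and imaginary parts. *)
have four (x y s r : R) : x <= y -> y <= 2 * s -> s <= r -> x + y <= 4 * r by lra.
have [le_ri|/ltW le_ir] := leP (fin_lp_norm q (fun i => `|re_part (t i)|))
    (fin_lp_norm q (fun i => `|im_part (t i)|)).
  by exists j2; rewrite (le_trans split_le)//; exact: four le_ri j2E (iE j2).
by exists j1; rewrite (le_trans split_le)// addrC; exact: four le_ir j1E (rE j1).
Qed.

End Norming.

(** * Functionals dominated by the L_q norm, and the converse inclusion for D_p *)

Section IntegralToCohen.
Context {R : realType} {k : scalar_kind}.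
Local Notation K := (scalars R k).

Lemma ae_forall_fin d (T : measurableType d) (mu : {measure set T -> \bar R})
    (J : finType) (P : J -> T -> Prop) :
  (forall j, \forall t \ae mu, P j t) -> \forall t \ae mu, forall j, P j t.
Proof.
move=> aeP; have : forall r : seq J, \forall t \ae mu, forall j, j \in r -> P j t.
  elim=> [|j r IHr]; first exact: nearW.
  by apply: filterS2 (aeP j) IHr => t Pj Pr i; rewrite inE => /predU1P[->//|/Pr].
by move=> /(_ (enum J)); apply: filterS => t H j; apply: H; rewrite mem_enum.
Qed.

Lemma Lp_fun_sum_ae d (T : measurableType d) (mu : {finite_measure set T -> \bar R})
    (p : \bar R) (p1 : (1 <= p)%E) n (c : 'I_n -> K) (w : 'I_n -> Lp (k := k) mu p1) :
  \forall t \ae mu, Lp_fun (\sum_i c i *: w i) t = \sum_i c i * Lp_fun (w i) t :> K^o.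
Proof.
have clsE : Lp_class (Lp_fun (\sum_i c i *: w i)) = Lp_class (\sum_i c i *: Lp_fun (w i)).
  rewrite Lp_funK (big_morph (@Lp_class _ _ _ _ mu p p1) (@Lp_classD _ _ _ _ mu p p1) (Lp_class0 mu p1)).
  by apply: eq_bigr => i _; rewrite Lp_classZ Lp_funK.
have /Lp_classP := clsE; apply: filterS => t ->.
have : forall r : seq 'I_n, Lpfun_fun (\sum_(i <- r) c i *: Lp_fun (w i)) t =
    \sum_(i <- r) c i * Lp_fun (w i) t.
  by elim=> [|i r IHr]; rewrite ?big_nil// !big_cons -IHr.
exact.
Qed.

Lemma lop_norm_approx (E F : normedModType K) (u : lop E F) (e : R) : 0 < e ->
  exists2 x, closed_unit_ball x & rnorm u <= rnorm (u x) + e.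
Proof.
move=> e0; have supu : has_sup [set rnorm (u x) | x in closed_unit_ball (E := E)].
  split; first by exists (rnorm (u 0)), 0 => //; rewrite /closed_unit_ball /= rnorm0.
  by have [M uM] := lop_bounded u; exists M => _ [x Bx <-]; exact: uM.
have [_ [x Bx <-] ux] := sup_adherent e0 supu; exists x => //.
by rewrite rnorm_lop -lerBlDr ltW.
Qed.

Section Decomposition.
Context {d : measure_display} {T : measurableType d}.
Variable mu : {finite_measure set T -> \bar R}.
Variables (p : \bar R) (q : R) (pq : conjugate_exponents p q%:E) (q1 : (1 <= q%:E)%E).
Local Notation Linfty := (Lp (k := k) mu (leey 1)).

(* Hahn-Banach along [w |-> (\sum_i b_j(i) w_i)_j] into J-tuples of L_oo functions;
   by [finite_norming] the maximum norm of the image controls the l_q(L_q) norm of w. *)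
Lemma Linfty_functionals_decomposition n (eta : 'I_n -> Linfty -> K^o) (rho : 'I_n -> R) :
  (forall i, linear (eta i)) -> (forall i, 0 <= rho i) ->
  (forall i f, rnorm (eta i f) <= rho i * rnorm (Linfty_incl q1 f)) ->
  exists (J : finType) (b : J -> 'I_n -> R) (zeta : J -> dual Linfty), [/\
    forall j, fin_lp_norm p (fun i => `|b j i|) <= 1,
    forall i f, eta i f = \sum_j of_real (b j i) * zeta j f :> K &
    \sum_j rnorm (zeta j) <= 4 * fine (mu setT) `^ q^-1 * fin_lp_norm p rho].
Proof.
move=> lin_eta rho0 eta_le.
have [J [b [b1 b_norming]]] := @finite_norming R k p q%:E n pq.
exists J, b.
set C := 4 * _ * _.
have C0 : 0 <= C by rewrite !mulr_ge0 ?powR_ge0 ?fin_lp_norm_ge0.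
pose pmax (z : J -> Linfty) : R := C * \big[Num.max/0]_j rnorm (z j).
pose Lmap (w : 'I_n -> Linfty) (j : J) : Linfty := \sum_i of_real (b j i) *: w i.
pose f (w : 'I_n -> Linfty) : K^o := \sum_i eta i (w i).
have fp w : rnorm (f w) <= pmax (Lmap w).
  have -> : pmax (Lmap w) = fin_lp_norm p rho *
      ((4 * \big[Num.max/0]_j rnorm (Lmap w j)) * fine (mu setT) `^ q^-1).
    by rewrite /pmax /C; ring.
  have f_le : rnorm (f w) <= \sum_i rho i * rnorm (Linfty_incl q1 (w i)).
    rewrite /f (le_trans (rnorm_sum _))//.
    by apply: ler_sum => i _; exact: eta_le.
  apply: (le_trans f_le).
  apply: (le_trans (@fin_hoelder R p q%:E n rho (fun i => rnorm (Linfty_incl q1 (w i)))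
    pq rho0 (fun i => rnorm_ge0 _))).
  rewrite ler_wpM2l ?fin_lp_norm_ge0//.
  (* For almost every t the norming family bounds the l_q norm of (w_i(t))_i by 4 times the largest
     norm of a component of [Lmap w]. *)
  apply: Linfty_incl_fin_norm; first by rewrite mulr_ge0// bigmax_ge_id.
  have ae1 : \forall t \ae mu, forall j,
      Lp_fun (Lmap w j) t = \sum_i of_real (b j i) * Lp_fun (w i) t :> K^o.
    by apply: ae_forall_fin => j; exact: Lp_fun_sum_ae.
  have ae2 : \forall t \ae mu, forall j, rnorm (Lp_fun (Lmap w j) t) <= rnorm (Lmap w j).
    by apply: ae_forall_fin => j; exact: Linfty_ae_le.
  apply: filterS2 ae1 ae2 => t t1 t2.
  have [j] := b_norming (fun i => Lp_fun (w i) t); move=> /le_trans; apply.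
  by rewrite ler_wpM2l// -t1 (le_trans (t2 j))//; exact: (le_bigmax 0 (fun j => rnorm (Lmap w j)) j).
have [|||||g [lg gL gp]] := @hahn_banach R k (J -> Linfty) ('I_n -> Linfty) pmax Lmap f.
- move=> x y; rewrite -mulrDr ler_wpM2l//; apply: bigmax_le => [|j _].
    by rewrite addr_ge0// bigmax_ge_id.
  rewrite (le_trans (ler_rnormD _ _))// lerD//.
    exact: (le_bigmax 0 (fun j => rnorm (x j)) j).
  exact: (le_bigmax 0 (fun j => rnorm (y j)) j).
- move=> a x; rewrite /pmax mulrCA; congr (_ * _).
  elim/big_ind2 : _ => [|x1 x2 y1 y2 -> ->|j _]; first by rewrite mulr0.
    by rewrite maxr_pMr ?rnorm_ge0.
  exact: rnormZ.
- move=> a x y; apply/funext => j; rewrite /Lmap /= !fctE scaler_sumr -big_split /=.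
  by apply: eq_bigr => i _; rewrite scalerDr !scalerA mulrC.
- move=> a x y; rewrite /f scaler_sumr -big_split /=.
  by apply: eq_bigr => i _; exact: lin_eta.
- exact: fp.
(* A J-tuple is the sum of its coordinates, so g splits into the functionals zeta j. *)
pose delta (j : J) (h : Linfty) : J -> Linfty := fun j' => if j' == j then h else 0.
have g0 : g 0 = 0 by have := lg (-1) 0 0; rewrite scaleN1r addNr scaleN1r addNr.
have gD x y : g (x + y) = g x + g y by have := lg 1 x y; rewrite !scale1r.
have gZ a x : g (a *: x) = a *: g x by have := lg a x 0; rewrite !addr0 g0 addr0.
have gsum (x : J -> Linfty) : g x = \sum_j g (delta j (x j)).
  have {1}-> : x = \sum_j delta j (x j).
    apply/funext => j; rewrite fct_sumE (bigD1 j)//= /delta eqxx big1 ?addr0// => j' /negPf jj'.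
    by rewrite eq_sym jj'.
  by rewrite (big_morph g gD g0).
have zl j : linear (fun h => g (delta j h)).
  move=> a x y; rewrite -lg; congr g; apply/funext => j'; rewrite !fctE /delta.
  by case: eqP => // _; rewrite scaler0 addr0.
have zC j h : rnorm (g (delta j h)) <= C * rnorm h.
  rewrite (le_trans (gp _))// ler_wpM2l//; apply: bigmax_le => [|j' _]; first exact: rnorm_ge0.
  by rewrite /delta; case: ifP => // _; rewrite rnorm0 rnorm_ge0.
have /choice[zeta zetaE] (j : J) : exists z : dual Linfty, forall h, z h = g (delta j h).
  exact: (linear_lop (zl j) (zC j)).
exists zeta; split=> //.
- move=> i h; pose w : 'I_n -> Linfty := fun i' => if i' == i then h else 0.
  have <- : f w = eta i h.
    rewrite /f (bigD1 i)//= /w eqxx big1 ?addr0// => i' /negPf ->.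
    by have := lin_eta i' (-1) 0 0; rewrite scaleN1r addNr scaleN1r addNr.
  rewrite -gL gsum; apply: eq_bigr => j _; rewrite zetaE.
  have -> : Lmap w j = of_real (b j i) *: h.
    rewrite /Lmap (bigD1 i)//= /w eqxx big1 ?addr0// => i' /negPf ->.
    by rewrite scaler0.
  rewrite -[RHS]gZ; congr g; apply/funext => j'; rewrite fctE /delta.
  by case: eqP => // _; rewrite scaler0.
(* The dual of the maximum norm is a sum of norms: g is tested on a tuple of almost norming vectors,
   rotated so that all contributions are nonnegative. The error e is shared among the indices in
   J. *)
apply/ler_addgt0Pr => e e0.
pose e' := e / #|J|.+1%:R; have e'0 : 0 < e' by rewrite divr_gt0.
have /choice[x xP] (j : J) : exists x : Linfty,
    closed_unit_ball x /\ rnorm (zeta j) <= rnorm (zeta j x) + e'.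
  by have [x Bx xe] := lop_norm_approx (zeta j) e'0; exists x.
have /choice[c cP] (j : J) : exists c : K, rnorm (c : K^o) <= 1 /\
    c * zeta j (x j) = of_real (rnorm (zeta j (x j))).
  by have [c c1 cE] := phase (zeta j (x j)); exists c.
pose z (j : J) := c j *: x j.
have gz : g z = of_real (\sum_j rnorm (zeta j (x j))).
  rewrite gsum (big_morph (@of_real R k) (@of_realD R k) (@of_real0 R k)).
  apply: eq_bigr => j _; have [_ <-] := cP j.
  by rewrite -zetaE /z lop_homogeneous expr1.
have zmax : \big[Num.max/0]_j rnorm (z j) <= 1.
  apply: bigmax_le => // j _; have [c1 _] := cP j; have [x1 _] := xP j.
  by rewrite /z rnormZ mulr_ile1 ?rnorm_ge0.
have zC' : \sum_j rnorm (zeta j (x j)) <= C.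
  have := gp z; rewrite gz rnorm_of_real ger0_norm; last first.
    by apply: sumr_ge0 => j _; exact: rnorm_ge0.
  by move=> /le_trans; apply; rewrite /pmax ler_piMr.
apply: (@le_trans _ _ (\sum_j (rnorm (zeta j (x j)) + e'))).
  by apply: ler_sum => j _; have [_] := xP j.
rewrite big_split /= lerD// sumr_const -[_ *+ _]mulr_natl /e' mulrCA ler_piMr ?(ltW e0)//.
by rewrite ler_pdivrMr// mul1r ler_nat.
Qed.

End Decomposition.

Lemma unit_multiple (E : normedModType K) (x : E) :
  exists2 y, closed_unit_ball y & x = of_real (rnorm x) *: y.
Proof.
have [->|x0] := eqVneq x 0.
  by exists 0; rewrite ?scaler0// /closed_unit_ball /= rnorm0.
have nx0 : `|x| != 0 by rewrite normr_eq0.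
exists (`|x|^-1 *: x); last by rewrite of_real_rnorm scalerA mulfV// scale1r.
by rewrite /closed_unit_ball /= rnorm_le normrZ normrV ?unitfE// normr_id mulVf// of_real1.
Qed.

Lemma weak_norm_scale (X : normedModType K) (p : \bar R) (q : R) :
  conjugate_exponents p q%:E -> forall n (psi : 'I_n -> dual X) (y : X),
  fin_lp_norm q%:E (fun i => rnorm (psi i y)) <= rnorm y * weak_norm q psi.
Proof.
move=> pq n psi y; have q1 := conjugate_exponents_ge1 (conjugate_exponents_sym pq).
have [z Bz yE] := unit_multiple y.
have -> : (fun i => rnorm (psi i y)) = (fun i => rnorm y * rnorm (psi i z)).
  apply/funext => i; rewrite {1}yE lop_homogeneous expr1 rnormZ rnorm_of_real.
  by rewrite ger0_norm ?rnorm_ge0.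
rewrite fin_lp_normZ ?rnorm_ge0// => [|i]; last exact: rnorm_ge0.
by rewrite ler_wpM2l ?rnorm_ge0//; exact: (weak_norm_ub pq psi (exist _ z Bz)).
Qed.

Lemma lop_rnorm_le (E F : normedModType K) (u : lop E F) (C : R) : 0 <= C ->
  (forall x, rnorm (u x) <= C * rnorm x) -> rnorm u <= C.
Proof.
move=> C0 uC; rewrite rnorm_lop; apply: sup_norm_le => // x Bx.
by rewrite (le_trans (uC x))// ler_piMr.
Qed.

Lemma lop_hpoly_le m (E F G : normedModType K) (u : lop F G) (P : hpoly m E F) :
  rnorm (lop_hpoly u P) <= rnorm u * rnorm P.
Proof.
rewrite rnorm_hpoly; apply: sup_norm_le => [|x Bx]; first by rewrite mulr_ge0 ?rnorm_ge0.
rewrite (le_trans (lop_le _ _))// ler_wpM2l ?rnorm_ge0// rnorm_hpoly.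
by apply: sup_norm_ub => //; exact: hpoly_bounded.
Qed.

Lemma hpoly_sumE m (E F : normedModType K) (I : finType) (f : I -> hpoly m E F) x :
  (\sum_i f i) x = \sum_i f i x.
Proof. by elim/big_ind2 : _ => // _ y _ z <- <-. Qed.

Theorem integral_dual_cohen (m : nat) (E F : completeNormedModType K)
    (p : \bar R) (q : R) : conjugate_exponents p q%:E ->
  injective_hull (composition_ideal (integral_ideal q)) m E F `<=`
  polynomial_dual (cohen_ideal p) m E F.
Proof.
move=> pq P [G [Q [u [[q1 [d [T [mu [a [b ub]]]]]] PQ]]]].
have p1 := conjugate_exponents_ge1 pq.
pose X : normedModType K := hpoly m E K^o.
pose B := 4 * fine (mu setT) `^ q^-1.
exists (B * rnorm b * (rnorm a * rnorm Q)).
  by rewrite !mulr_ge0 ?powR_ge0 ?rnorm_ge0.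
move=> n phi psi; rewrite (conjugate_exponents_hoelder pq) -/(weak_norm q psi).
(* The coordinates of l_oo(B_{F^*}) are indexed by the ball, so phi i is normalized and its norm
   becomes part of the weight rho i. *)
have /choice[phi' phi'E] (i : 'I_n) : exists f : dual_ball F, phi i = of_real (rnorm (phi i)) *: sval f.
  by have [f Bf fE] := unit_multiple (phi i); exists (exist _ f Bf).
have /choice[e eE] (i : 'I_n) : exists e : dual (linf R k (dual_ball F)),
    (forall f, e f = f (phi' i)) /\ rnorm e <= 1.
  have e1 (f : linf R k (dual_ball F)) : rnorm (f (phi' i) : K^o) <= 1 * rnorm f.
    by rewrite mul1r linf_le.
  have [e eE] := @linear_lop R k (linf R k (dual_ball F)) K^o
    (fun f => f (phi' i)) 1 (fun _ _ _ => erefl) e1.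
  by exists e; split=> //; apply: lop_rnorm_le => // f; rewrite eE.
have /choice[c cE] (i : 'I_n) : exists c : K, rnorm (c : K^o) <= 1 /\
    c * psi i (hpoly_adjoint P (phi i)) = of_real (rnorm (psi i (hpoly_adjoint P (phi i)))).
  by have [c c1 cE] := phase (psi i (hpoly_adjoint P (phi i))); exists c.
pose eta i (f : Lp (k := k) mu (leey 1)) : K^o :=
  c i *: (of_real (rnorm (phi i)) *: (b (Linfty_incl q1 f) : dual (dual _)) (e i)).
have lin_eta i : linear (eta i).
  move=> s f g; rewrite /eta Linfty_incl_linear lop_linear /= !fctE.
  by rewrite !scalerDr !scalerA; congr (_ *: _ + _); ring.
have eta_le i f : rnorm (eta i f) <= (rnorm b * rnorm (phi i)) * rnorm (Linfty_incl q1 f).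
  rewrite /eta !rnormZ rnorm_of_real ger0_norm ?rnorm_ge0//.
  have [_ e1] := eE i; have [c1 _] := cE i.
  rewrite (le_trans (ler_piMl _ c1)) ?mulr_ge0 ?rnorm_ge0//.
  rewrite mulrAC [leRHS]mulrC ler_wpM2l ?rnorm_ge0// (le_trans (lop_le _ _))//.
  by rewrite (le_trans (ler_piMr _ e1)) ?rnorm_ge0// lop_le.
have rho0 i : 0 <= rnorm b * rnorm (phi i) by rewrite mulr_ge0 ?rnorm_ge0.
have [J [be [zeta [be1 etaE zetaC]]]] :=
  Linfty_functionals_decomposition pq lin_eta rho0 eta_le.
pose r j : X := lop_hpoly (zeta j) (lop_hpoly a Q).
(* Up to phases, all the P^* phi_i are combinations of the same polynomials r j, and the index i
   survives only in the scalar coefficients. *)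
have adjE i : c i *: hpoly_adjoint P (phi i) = \sum_j of_real (be j i) *: r j.
  apply/val_inj/funext => x; transitivity (eta i (a (Q x))).
    rewrite /eta; change (c i *: (phi i (P x)) =
      c i *: (of_real (rnorm (phi i)) *: (b (Linfty_incl q1 (a (Q x))) : dual (dual _)) (e i))).
    congr (_ *: _); rewrite {1}phi'E.
    change (of_real (rnorm (phi i)) *: (lop_hpoly (linf_embedding F) P x : linf R k (dual_ball F)) (phi' i) =
      of_real (rnorm (phi i)) *: (b (Linfty_incl q1 (a (Q x))) : dual (dual _)) (e i)).
    rewrite PQ -ub /=; congr (_ *: _); have [-> _] := eE i; by [].
  rewrite etaE -[RHS]/((\sum_j of_real (be j i) *: r j) x) hpoly_sumE.
  by [].
have W0 : 0 <= weak_norm q psi.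
  have B0 : closed_unit_ball (0 : X) by rewrite /closed_unit_ball /= rnorm0.
  by rewrite (le_trans _ (weak_norm_ub pq psi (exist _ 0 B0)))// fin_lp_norm_ge0.
have sumE : of_real (\sum_(i < n) rnorm (psi i (hpoly_adjoint P (phi i)))) =
    \sum_j \sum_(i < n) of_real (be j i) * psi i (r j) :> K^o.
  rewrite (big_morph (@of_real R k) (@of_realD R k) (@of_real0 R k)) exchange_big /=.
  apply: eq_bigr => i _; have [_ <-] := cE i.
  rewrite -[LHS](lopZ (psi i)) adjE lop_sum; apply: eq_bigr => j _.
  by rewrite lopZ.
have -> : \sum_(i < n) rnorm (psi i (hpoly_adjoint P (phi i))) =
    rnorm (\sum_j \sum_(i < n) of_real (be j i) * psi i (r j) : K^o).
  rewrite -sumE rnorm_of_real ger0_norm//.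
  by apply: sumr_ge0 => i _; exact: rnorm_ge0.
rewrite (le_trans (rnorm_sum _))//.
(* For fixed j, Hoelder with the l_p bound on b_j leaves the l_q norm of (psi_i (r_j))_i, which is
   the weak norm tested on one element of X. *)
apply: (@le_trans _ _ (\sum_j rnorm (r j) * weak_norm q psi)).
  apply: ler_sum => j _; rewrite (le_trans (rnorm_sum _))//.
  apply: (@le_trans _ _ (\sum_(i < n) `|be j i| * rnorm (psi i (r j)))).
    by apply: ler_sum => i _; rewrite rnormM rnorm_of_real.
  apply: (le_trans (@fin_hoelder R p q%:E n (fun i => `|be j i|) (fun i => rnorm (psi i (r j)))
    pq (fun i => normr_ge0 _) (fun i => rnorm_ge0 _))).
  rewrite (le_trans (ler_wpM2r (fin_lp_norm_ge0 _ _) (be1 j)))// mul1r.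
  exact: (weak_norm_scale pq psi (r j)).
rewrite -mulr_suml ler_wpM2r//.
have r_le j : rnorm (r j) <= rnorm (zeta j) * (rnorm a * rnorm Q).
  by rewrite (le_trans (lop_hpoly_le _ _))// ler_wpM2l ?rnorm_ge0// lop_hpoly_le.
apply: (le_trans (ler_sum _ (fun j _ => r_le j))).
rewrite -mulr_suml mulrAC ler_wpM2r ?mulr_ge0 ?rnorm_ge0//.
rewrite (le_trans zetaC)// fin_lp_normZ ?rnorm_ge0// => [|i]; last exact: rnorm_ge0.
by rewrite mulrA.
Qed.

End IntegralToCohen.

(** * Nuclear operators and uniform boundedness *)

Section NuclearOperators.
Context {R : realType} {k : scalar_kind}.
Local Notation K := (scalars R k).

Lemma rcauchy_rcvg (E : completeNormedModType K) (T : Type) (F : set_system T) (h : T -> E) :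
  ProperFilter F -> rcauchy F h -> exists z, rcvg F h z.
Proof.
move=> FF hc; suff /cvg_ex[z hz] : cvg (h @ F) by exists z; exact: cvg_rcvg.
apply: cauchy_cvg; apply: cauchy_exP => _ /gt0_of_real[r r0 ->].
have [z Fz] := hc _ (divr_gt0 r0 (ltr0Sn _ 1)); exists z; rewrite /fmap /=.
apply: filterS Fz => t /= tz; rewrite -ball_normE /= normr_lt_of_real.
rewrite -rnormN opprB (le_lt_trans tz)//.
by rewrite ltr_pdivrMr// ltr_pMr// ltr1n.
Qed.

Lemma rcvg_le (E : normedModType K) (T : Type) (F : set_system T) (h : T -> E) z (C : R) :
  ProperFilter F -> rcvg F h z -> F [set t | rnorm (h t) <= C] -> rnorm z <= C.
Proof.
move=> FF hz FC; apply/ler_addgt0Pl => e e0.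
have [t [/= tz tC]] := filter_ex (filterI (hz _ e0) FC).
rewrite -[z](subrK (h t)) (le_trans (ler_rnormD _ _))// lerD//.
by rewrite -rnormN opprB.
Qed.

Variables (G : normedModType K) (Y : normedModType K).
Variables (r : R) (p : \bar R) (rp : conjugate_exponents r%:E p).
Variables (phi : nat -> dual G) (y : nat -> Y).

Let r1 : (1 <= r%:E)%E := conjugate_exponents_ge1 rp.
Let p1 : (1 <= p)%E := conjugate_exponents_ge1 (conjugate_exponents_sym rp).

(** Dual form of the statement that the weak l_p norm of y is at most W; it applies directly to
    partial sums of a nuclear series. *)
Definition synthesis_bound (W : R) := forall n (b : 'I_n -> K^o),
  rnorm (\sum_(i < n) b i *: y i) <= W * fin_lp_norm r%:E (fun i => rnorm (b i)).

Lemma synthesis_weakly_summable W : 0 <= W -> synthesis_bound W -> weakly_lp_summable p y.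
Proof.
move=> W0 yW psi; apply/(lp_summableP _ p1); exists (rnorm psi * W); first by rewrite mulr_ge0 ?rnorm_ge0.
move=> n; have [b [b0 b1 <-]] := @fin_lp_dual _ _ _ n (fun i => rnorm (psi (y i))) rp
  (fun i => rnorm_ge0 _).
have /choice[c cP] (i : 'I_n) : exists c : K, rnorm (c : K^o) <= 1 /\
    c * psi (y i) = of_real (rnorm (psi (y i))).
  by have [c c1 cE] := phase (psi (y i)); exists c.
have -> : \sum_(i < n) b i * rnorm (psi (y i)) =
    rnorm (psi (\sum_(i < n) (of_real (b i) * c i : K^o) *: y i)).
  rewrite lop_sum; transitivity (rnorm (of_real (\sum_(i < n) b i * rnorm (psi (y i))) : K^o)).
    rewrite rnorm_of_real ger0_norm// sumr_ge0// => i _.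
    by rewrite mulr_ge0 ?rnorm_ge0.
  congr rnorm; rewrite (big_morph (@of_real R k) (@of_realD R k) (@of_real0 R k)).
  apply: eq_bigr => i _; have [_ cE] := cP i.
  by rewrite lopZ of_realM -cE mulrA.
rewrite (le_trans (lop_le _ _))// ler_wpM2l ?rnorm_ge0//.
apply: (le_trans (yW _ _)); rewrite -[leRHS]mulr1; apply: ler_wpM2l W0 _ _ _.
apply: le_trans b1.
apply: fin_lp_norm_le => // i; have [c1 _] := cP i.
by rewrite rnorm_ge0 rnormM rnorm_of_real ger0_norm// ler_piMr.
Qed.

Hypothesis phi_lp : lp_summable r%:E phi.

Let series_tail (x : G) n N : (N <= n)%N ->
  series (fun i => phi i x *: y i) n - series (fun i => phi i x *: y i) N =
  \sum_(i < n) (if (N <= i)%N then phi i x else 0 : K^o) *: y i.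
Proof.
move=> Nn; rewrite /series /= sub_series_geq//.
rewrite -(big_mkord predT (fun i => (if (N <= i)%N then phi i x else 0 : K^o) *: y i)).
rewrite [RHS](big_cat_nat (leq0n N) Nn) /= [X in _ = X + _](_ : _ = 0) ?add0r.
  by apply: eq_big_nat => i /andP[-> _].
by rewrite big_nat big1// => i /andP[_ iN]; rewrite leqNgt iN scale0r.
Qed.

(** The index N comes from the l_r tail of phi alone, so the series converges uniformly for x in
    bounded sets. *)
Lemma synthesis_tail_le W (e : R) : 0 <= W -> synthesis_bound W -> 0 < e ->
  exists N, forall n (x : G), (N <= n)%N ->
    rnorm (series (fun i => phi i x *: y i) n - series (fun i => phi i x *: y i) N) <=
    W * (rnorm x * e).
Proof.
move=> W0 yW e0; have [N phiN] := lp_summable_tail r1 phi_lp e0.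
exists N => n x Nn; rewrite series_tail// (le_trans (yW _ _))// ler_wpM2l//.
rewrite (le_trans (y := rnorm x * fin_lp_norm r%:E
  (fun i : 'I_n => if (N <= i)%N then rnorm (phi i) else 0)))//.
  have mask0 (i : 'I_n) : 0 <= (if (N <= i)%N then rnorm (phi i) else 0).
    by case: ifP => // _; exact: rnorm_ge0.
  rewrite -(fin_lp_normZ r1 (rnorm_ge0 x) mask0).
  apply: fin_lp_norm_le => // i; rewrite rnorm_ge0 /=; case: ifP => _.
    by rewrite mulrC lop_le.
  by rewrite rnorm0 mulr0.
by rewrite ler_wpM2l ?rnorm_ge0.
Qed.

End NuclearOperators.

Section NuclearExistence.
Context {R : realType} {k : scalar_kind}.
Local Notation K := (scalars R k).
Variables (G : normedModType K) (Y : completeNormedModType K).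
Variables (r : R) (rp : conjugate_exponents r%:E (hoelder_conjugate r%:E)).
Variables (phi : nat -> dual G) (y : nat -> Y) (W : R).
Hypotheses (phi_lp : lp_summable r%:E phi) (W0 : 0 <= W) (yW : synthesis_bound r y W).

Lemma nuclear_operator : exists u : lop G Y, nuclear_ideal r u /\
  forall x, series (fun i => phi i x *: y i) @ \oo --> u x.
Proof.
have r1 : (1 <= r%:E)%E := conjugate_exponents_ge1 rp.
pose S x := series (fun i => phi i x *: y i).
have SE x n : S x n = \sum_(i < n) phi i x *: y i by rewrite /S /series /= big_mkord.
have /choice[u uS] x : exists z, rcvg \oo (S x) z.
  apply: rcauchy_rcvg => e e0.
  have We : 0 < e / (W * rnorm x + 1) by rewrite divr_gt0// ltr_wpDl// mulr_ge0// rnorm_ge0.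
  have [N tailN] := synthesis_tail_le rp phi_lp W0 yW We.
  exists (S x N), N => // n /= Nn; rewrite (le_trans (tailN n x Nn))//.
  have Wx0 : 0 <= W * rnorm x by rewrite mulr_ge0 ?rnorm_ge0.
  have -> : W * (rnorm x * (e / (W * rnorm x + 1))) = e * ((W * rnorm x) / (W * rnorm x + 1)) by ring.
  by rewrite ler_piMr ?(ltW e0)// ler_pdivrMr ?ltr_wpDl// mul1r lerDl.
have /(lp_summableP _ r1)[A A0 phiA] := phi_lp.
have ulin : linear u.
  move=> a x z; apply: (@rcvg_unique _ _ _ _ _ (S (a *: x + z))) (uS _) _.
  have -> : S (a *: x + z) = fun n => a *: S x n + S z n.
    apply/funext => n; rewrite !SE scaler_sumr -big_split /=.
    by apply: eq_bigr => i _; rewrite lop_linear scalerDl scalerA.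
  exact: (rcvg_linear a _ (uS x) (uS z)).
have u_le x : rnorm (u x) <= (W * A) * rnorm x.
  apply: (rcvg_le _ (uS x)); exists 0%N => // n _ /=.
  rewrite SE (le_trans (yW _))// -mulrA ler_wpM2l// mulrC.
  apply: le_trans (ler_wpM2l (rnorm_ge0 x) (phiA n)).
  rewrite -(@fin_lp_normZ R r%:E n (fun i => rnorm (phi i)) _ r1 (rnorm_ge0 x) (fun i => rnorm_ge0 _)).
  by apply: fin_lp_norm_le => // i; rewrite rnorm_ge0 /= mulrC lop_le.
have [v vE] := linear_lop ulin u_le.
have vcvg x : S x @ \oo --> v x by rewrite vE; apply: rcvg_cvg; exact: uS.
exists v; split=> //; exists phi, y; split=> //.
exact: (synthesis_weakly_summable rp W0 yW).
Qed.

End NuclearExistence.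

(** * Uniform boundedness for families of seminorms *)

Section UniformBoundedness.
Context {R : realType} {k : scalar_kind}.
Local Notation K := (scalars R k).

(* A gliding hump with adaptively chosen radii. *)
Theorem uniform_boundedness (Z : completeNormedModType K) (I : Type) (N : I -> Z -> R) :
  (forall i x y, N i (x + y) <= N i x + N i y) ->
  (forall i a x, N i (a *: x) = rnorm (a : K^o) * N i x) ->
  (forall i, exists C : R, forall x, N i x <= C * rnorm x) ->
  (forall x, exists M : R, forall i, N i x <= M) ->
  exists W : R, forall i x, N i x <= W * rnorm x.
Proof.
move=> ND NZ Nbd Npt; apply: contrapT => /forallNP noW.
have unbounded W : exists i x, W * rnorm x < N i x.
  apply: contrapT => /forallNP h; apply: (noW W) => i x; rewrite leNgt; apply/negP => ix.
  by apply: (h i); exists x.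
have NN i x : N i (- x) = N i x.
  by rewrite -scaleN1r NZ rnormN rnorm1 mul1r.
have N0 i : N i 0 = 0 by rewrite -(scale0r 0) NZ rnorm0 mul0r.
have N_ge0 i x : 0 <= N i x.
  by have := ND i x (- x); rewrite subrr N0 NN -mulr2n pmulrn_lge0.
pose st : Type := (Z * R * nat)%type.
have step (s : st) : exists t : I * (Z * R), 0 < s.1.2 ->
    [/\ rnorm (t.2.1 - s.1.1) <= s.1.2, 0 < t.2.2, 2 * t.2.2 <= s.1.2 & t.2.2 <= s.2.+1%:R^-1] /\
    (forall x, rnorm x <= 2 * t.2.2 -> N t.1 x <= 1) /\ s.2%:R <= N t.1 t.2.1.
  (* The choice function must be total; for a radius that is not positive any value serves. *)
  case: s => -[z rd] n /=; have [rd0|rd0] := ltP 0 rd; last first.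
    by have [i _] := unbounded 0; exists (i, (0, 0)).
  have [i [x0 ix]] := unbounded (n%:R / rd).
  have x00 : x0 != 0.
    by apply/eqP => x00; move: ix; rewrite x00 rnorm0 mulr0 N0 ltxx.
  have nx0 : 0 < rnorm x0.
    by rewrite lt_def rnorm_ge0 andbT; apply: contra x00 => /eqP/rnorm0_eq0 ->.
  pose x := (of_real (rd / rnorm x0) : K) *: x0.
  have xrd : rnorm x = rd.
    by rewrite /x rnormZ rnorm_of_real (ger0_norm (divr_ge0 (ltW rd0) (ltW nx0))) divfK// gt_eqF.
  have nx : n%:R <= N i x.
    rewrite /x NZ rnorm_of_real (ger0_norm (divr_ge0 (ltW rd0) (ltW nx0))) mulrAC ler_pdivlMr//.
    by move: (ltW ix); rewrite mulrAC ler_pdivrMr// [N i x0 * _]mulrC.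
  (* Since 2 N(x) <= N(z + x) + N(z - x), one of z + x and z - x is large. *)
  have [z' [z'z nz']] : exists z', rnorm (z' - z) <= rd /\ n%:R <= N i z'.
    have [h|h] := leP n%:R (N i (z + x)).
      by exists (z + x); rewrite addrAC subrr add0r xrd.
    exists (z - x); rewrite addrAC subrr add0r rnormN xrd; split=> //.
    have : N i (x + x) <= N i (z + x) + N i (z - x).
      rewrite -(NN i (z - x)) (le_trans _ (ND _ _ _))//.
      by rewrite opprB [X in _ <= N i X]addrC addrA subrK.
    have -> : N i (x + x) = 2 * N i x.
      have -> : x + x = (of_real 2 : K) *: x.
        by rewrite (_ : 2 = 1 + 1)// of_realD of_real1 scalerDl scale1r.
      by rewrite NZ rnorm_of_real ger0_norm.
    by lra.
  have [C NC] := Nbd i.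
  pose c := (2 * (`|C| + 1))^-1.
  have C1 : 0 < 2 * (`|C| + 1) by rewrite mulr_gt0// ltr_wpDl.
  (* Halving sums the later displacements to at most twice the new radius, 1/(n+1) gives a rate of
     convergence, and c makes the current seminorm at most 1 on all those displacements. *)
  exists (i, (z', Num.min (rd / 2) (Num.min n.+1%:R^-1 c))) => _ /=; split; [split=> //|split=> //].
  - by rewrite !lt_min divr_gt0//= invr_gt0 ltr0Sn /= invr_gt0.
  - by rewrite mulrC -ler_pdivlMr// ge_min lexx.
  - by rewrite !ge_min lexx orbT.
  move=> w wr; rewrite (le_trans (NC w))//.
  have wc : rnorm w <= 2 * c by rewrite (le_trans wr)// ler_wpM2l// !ge_min lexx !orbT.
  apply: (@le_trans _ _ ((`|C| + 1) * (2 * c))).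
    apply: (@le_trans _ _ ((`|C| + 1) * rnorm w)).
      by rewrite ler_wpM2r ?rnorm_ge0// (le_trans (ler_norm _))// lerDl.
    by rewrite ler_wpM2l// addr_ge0.
  by rewrite mulrA [_ * 2]mulrC mulfV// gt_eqF.
have /choice[f fP] := step.
pose sq := fix sq n : st := if n is n'.+1 then ((f (sq n')).2, n) else ((0, 1), 0%N).
pose z n := (sq n).1.1; pose rd n := (sq n).1.2; pose idx n := (f (sq n)).1.
have sqn n : (sq n).2 = n by case: n.
have rd0 n : 0 < rd n.
  by elim: n => [//|n IHn]; have [[_]] := fP (sq n) IHn.
have zstep n : rnorm (z n.+1 - z n) <= rd n by have [[]] := fP (sq n) (rd0 n).
have rdstep n : 2 * rd n.+1 <= rd n by have [[]] := fP (sq n) (rd0 n).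
have rdinv n : rd n.+1 <= n.+1%:R^-1.
  by have [[_ _ _]] := fP (sq n) (rd0 n); rewrite sqn.
have idxtail n x : rnorm x <= 2 * rd n.+1 -> N (idx n) x <= 1.
  by have [_ [H _]] := fP (sq n) (rd0 n); exact: H.
have idxbig n : n%:R <= N (idx n) (z n.+1).
  by have [_ [_]] := fP (sq n) (rd0 n); rewrite sqn.
have zdist n j : rnorm (z (n + j)%N - z n) <= 2 * rd n - 2 * rd (n + j)%N.
  elim: j => [|j IHj]; first by rewrite addn0 !subrr rnorm0.
  rewrite addnS (le_trans (rdist_le _ _ (z (n + j)%N)))//.
  have := zstep (n + j)%N; have := rdstep (n + j)%N; move: IHj.
  by rewrite -(rnormN (z n - _)) opprB; lra.
have [l zl] : exists l, rcvg \oo z l.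
  apply: rcauchy_rcvg => e e0.
  pose n := Num.truncn (2 / e); exists (z n.+1), n.+1 => // j /= nj.
  rewrite -(subnKC nj) (le_trans (zdist _ _))//.
  have r2 : 2 * rd n.+1 <= e.
    rewrite (le_trans (ler_wpM2l _ (rdinv n)))// ler_pdivrMr// mulrC -ler_pdivrMr//.
    exact/ltW/truncnS_gt.
  by have := rd0 (n.+1 + (j - n.+1))%N; lra.
have [M lM] := Npt l.
(* At stage n the seminorm is at least n at z_(n+1) and changes by at most 1 on the way to the limit
   l, where it is at most M. This n exceeds M + 1. *)
pose n := (Num.truncn (M + 1)).+1.
have : n%:R <= M + 1.
  rewrite (le_trans (idxbig n))// -[z n.+1](subrK l) addrC (le_trans (ND _ _ _))//.
  rewrite lerD ?lM// idxtail// -rnormN opprB.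
  have zl' : rcvg \oo (fun j => z j - z n.+1) (l - z n.+1).
    move=> e /zl; apply: filterS => j /=; congr (rnorm _ <= _).
    by rewrite opprB addrA subrK.
  apply: (rcvg_le _ zl').
  exists n.+1 => // j /= nj; rewrite -(subnKC nj) (le_trans (zdist _ _))//.
  by have := rd0 (n.+1 + (j - n.+1))%N; lra.
by apply/negP; rewrite -ltNge; exact: truncnS_gt.
Qed.

End UniformBoundedness.

(** * Compact adjoints and nuclear operators *)

Section CompactNuclear.
Context {R : realType} {k : scalar_kind}.
Local Notation K := (scalars R k).

Lemma lp_summable_le (E F : normedModType K) (p : \bar R) (x : nat -> E) (y : nat -> F) (C : R) :
  (1 <= p)%E -> 0 <= C -> (forall n, rnorm (x n) <= C * rnorm (y n)) ->
  lp_summable p y -> lp_summable p x.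
Proof.
move=> p1 C0 xy /(lp_summableP _ p1)[A A0 yA]; apply/(lp_summableP _ p1).
exists (C * A) => [|n]; first exact: mulr_ge0.
apply: le_trans (ler_wpM2l C0 (yA n)).
rewrite -(@fin_lp_normZ R p n (fun i => rnorm (y i)) C p1 C0 (fun i => rnorm_ge0 _)).
by apply: fin_lp_norm_le => // i; rewrite rnorm_ge0 xy.
Qed.

Theorem compact_dual_nuclear (m : nat) (E F : completeNormedModType K) (p : R) : 1 <= p ->
  polynomial_dual (compact_ideal p) m E F `<=`
  injective_hull (composition_ideal (nuclear_ideal p)) m E F.
Proof.
move=> p1 P [y y_lp yP].
have p1' : (1 <= p%:E)%E by rewrite lee_fin.
have pq := conjugate_exponentsP p1'.
have q1 := conjugate_exponents_ge1 (conjugate_exponents_sym pq).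
pose X : normedModType K := hpoly m E K^o; pose S := poly_ball m E.
(* These coefficients do not depend linearly on phi. As functions of phi they are still elements of
   l_oo(B_{F^*}), which is where the injective hull enters. *)
have /choice[alpha alphaP] (phi : dual_ball F) : exists al : nat -> K^o,
    coefficient_ball p al /\ series (fun n => al n *: y n) @ \oo --> hpoly_adjoint P (sval phi).
  by have [al al1 alE] := yP _ (svalP phi); exists al.
have /choice[s sE] n : exists s : S, y n = of_real (rnorm (y n)) *: sval s.
  by have [s Bs sE] := unit_multiple (y n); exists (exist _ s Bs).
have /choice[Phi PhiE] n : exists f : dual (linf R k S), forall g,
    f g = of_real (rnorm (y n)) *: (g (s n) : K^o).
  apply: (@linear_lop R k (linf R k S) K^o
    (fun g => of_real (rnorm (y n)) *: (g (s n) : K^o)) (rnorm (y n))).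
    by move=> a f g; rewrite /= !fctE scalerDr !scalerA mulrC.
  move=> g; rewrite rnormZ rnorm_of_real ger0_norm ?rnorm_ge0//.
  by rewrite ler_wpM2l ?rnorm_ge0// linf_le.
have Phi_lp : lp_summable p%:E Phi.
  apply: (lp_summable_le p1' ler01 _ y_lp) => n; rewrite mul1r.
  apply: lop_rnorm_le => [|g]; first exact: rnorm_ge0.
  rewrite PhiE rnormZ rnorm_of_real ger0_norm ?rnorm_ge0//.
  by rewrite ler_wpM2l ?rnorm_ge0// linf_le.
have alpha_le phi n : fin_lp_norm (hoelder_conjugate p%:E) (fun i : 'I_n => rnorm (alpha phi i)) <= 1.
  have [[al1 _] _] := alphaP phi.
  by have /(lp_norm_le _ q1 ler01)/(_ n) := al1.
have Ylinf n : (fun phi => alpha phi n) \in linf_pred (dual_ball F).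
  apply/asboolP; exists 1 => phi _; apply: le_trans (alpha_le phi n.+1).
  exact: (@fin_lp_norm_coord R _ n.+1 (fun i => rnorm (alpha phi i)) ord_max q1 (fun i => rnorm_ge0 _)).
pose Y n : linf R k (dual_ball F) := Linf (Ylinf n).
have YsumE n (b : 'I_n -> K^o) phi :
    (\sum_(i < n) b i *: Y i : linf R k (dual_ball F)) phi = \sum_(i < n) b i * alpha phi i :> K^o.
  by elim/big_ind2 : _ => // _ x _ z <- <-.
(* Hoelder for each phi; the constant is 1 because every coefficient sequence lies in the unit
   ball. *)
have YW : synthesis_bound p Y 1.
  move=> n b; rewrite mul1r; apply: linf_rnorm_le => [|phi]; first exact: fin_lp_norm_ge0.
  rewrite YsumE (le_trans (rnorm_sum _))//.
  apply: (@le_trans _ _ (\sum_(i < n) rnorm (b i) * rnorm (alpha phi i))).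
    by apply: ler_sum => i _; rewrite rnormM.
  apply: (le_trans (@fin_hoelder R _ _ n (fun i => rnorm (b i)) (fun i => rnorm (alpha phi i)) pq
     (fun i => rnorm_ge0 _) (fun i => rnorm_ge0 _))).
  by rewrite ler_piMr ?fin_lp_norm_ge0.
have [u [nu uE]] := nuclear_operator pq Phi_lp ler01 YW.
have [Q QE] := universal_hpoly m E.
exists (linf R k S), Q, u; split=> //.
apply/val_inj/funext => x; apply/val_inj/funext => phi.
have [_ cvgP] := alphaP phi.
have c1 := cvg_rcvg eventually_filter cvgP.
have c2 := cvg_rcvg eventually_filter (uE (Q x)).
(* The same partial sums are those of P^* phi evaluated at x and those of u (Q x) at the coordinate
   phi. *)
pose f n : K^o := \sum_(i < n) alpha phi i * y i x.
have f1 : rcvg \oo f (sval phi (P x)).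
  move=> e e0.
  have e0' : 0 < e / (rnorm x ^+ m + 1) by rewrite divr_gt0// ltr_wpDl// exprn_ge0 ?rnorm_ge0.
  apply: filterS (c1 _ e0') => n /= cn.
  have -> : f n - sval phi (P x) = (series (fun i => alpha phi i *: y i) n - hpoly_adjoint P (sval phi)) x.
    rewrite -[RHS]/(series (fun i => alpha phi i *: y i) n x - sval phi (P x)); congr (_ - _).
    by rewrite /series /= big_mkord hpoly_sumE.
  rewrite (le_trans (hpoly_le _ _))// (le_trans (ler_wpM2r _ cn)) ?exprn_ge0 ?rnorm_ge0//.
  rewrite mulrAC ler_pdivrMr ?ltr_wpDl ?exprn_ge0 ?rnorm_ge0// ler_wpM2l ?(ltW e0)//.
  by rewrite lerDl.
have f2 : rcvg \oo f (u (Q x) phi).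
  move=> e e0; apply: filterS (c2 _ e0) => n /= cn; apply: le_trans cn.
  have -> : f n - u (Q x) phi = (series (fun i => Phi i (Q x) *: Y i) n - u (Q x)) phi.
    rewrite -[RHS]/(series (fun i => Phi i (Q x) *: Y i) n phi - u (Q x) phi); congr (_ - _).
    rewrite /series /= big_mkord YsumE; apply: eq_bigr => i _.
    rewrite PhiE QE mulrC; congr (_ * _).
    by rewrite {1}sE.
  exact: linf_le.
exact: (rcvg_unique _ f1 f2).
Qed.

(* With [t n] the n-th tail of the series plus 1/(n+1), the weights are
   1 + t_n^(-1/2): then c_n a_n telescopes because a_n <= t_n - t_(n+1). *)
Lemma slowly_growing_weights (a : nat -> R) (A : R) : (forall n, 0 <= a n) ->
  (forall n, \sum_(i < n) a i <= A) ->
  exists c : nat -> R, [/\ forall n, 1 <= c n, exists B : R, forall n, \sum_(i < n) c i * a i <= B &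
    forall e, 0 < e -> exists N, forall n, (N <= n)%N -> (c n)^-1 <= e].
Proof.
move=> a0 aA; pose s n := \sum_(i < n) a i.
have sS n : s n.+1 = s n + a n by rewrite /s big_ord_recr.
have sups : has_sup (range s) by split; [exists (s 0%N), 0%N|exists A => _ [n _ <-]; exact: aA].
pose t n := sup (range s) - s n + n.+1%:R^-1.
have s_le n : s n <= sup (range s) by apply: ub_le_sup; [exact: sups.2|exists n].
have t0 n : 0 < t n by rewrite ltr_wpDl ?subr_ge0// invr_gt0.
have ta n : a n <= t n - t n.+1.
  rewrite /t sS; have : (n.+2%:R^-1 : R) <= n.+1%:R^-1 by rewrite lef_pV2 ?posrE// ler_nat.
  by move: (sup _) (s n) (n.+1%:R^-1) (n.+2%:R^-1) => x y z w; lra.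
pose r n := Num.sqrt (t n); have r0 n : 0 < r n by rewrite sqrtr_gt0.
have rE n : t n = r n * r n by rewrite -expr2 sqr_sqrtr// ltW.
have rdec n : r n.+1 <= r n.
  by rewrite ler_wsqrtr// -subr_ge0 (le_trans (a0 n)).
exists (fun n => (r n)^-1 + 1); split=> [n||e e0].
- by rewrite lerDr invr_ge0 ltW.
- exists (2 * r 0%N + A) => n.
  under eq_bigr do rewrite mulrDl mul1r.
  rewrite big_split /=; apply: lerD; last exact: aA.
  (* From a_i <= r_i^2 - r_(i+1)^2 and r_(i+1) <= r_i, the quotient a_i / r_i is at most 2 (r_i -
     r_(i+1)). *)
  apply: (@le_trans _ _ (\sum_(i < n) 2 * (r i - r i.+1))).
    apply: ler_sum => i _; rewrite mulrC ler_pdivrMr// (le_trans (ta i))// !rE.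
    have -> : r i * r i - r i.+1 * r i.+1 = (r i - r i.+1) * (r i + r i.+1) by ring.
    rewrite -mulrA mulrCA ler_wpM2l ?subr_ge0//.
    by rewrite mulr_natl mulr2n lerD2l.
  rewrite -mulr_sumr ler_wpM2l//.
  have -> : \sum_(i < n) (r i - r i.+1) = r 0%N - r n.
    elim: n => [|n IHn]; first by rewrite big_ord0 subrr.
    by rewrite big_ord_recr /= IHn addrA subrK.
  by rewrite lerBlDr lerDl ltW.
(* Both summands of t n, the tail and 1/(n+1), are brought below e^2 / 2, so that r n <= e. *)
- have e20 : 0 < e ^+ 2 / 2 by rewrite divr_gt0// exprn_gt0.
  have [_ [N1 _ <-] sN1] := sup_adherent e20 sups.
  pose N2 := Num.truncn (e ^+ 2 / 2)^-1; exists (maxn N1 N2) => n.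
  rewrite geq_max => /andP[N1n N2n].
  have re : r n <= e.
    rewrite -[e]ger0_norm ?(ltW e0)// -sqrtr_sqr ler_wsqrtr// /t.
    have sn : s N1 <= s n.
      rewrite -(subnKC N1n); elim: (n - N1)%N => [|j IHj]; first by rewrite addn0.
      by rewrite addnS sS (le_trans IHj)// lerDl.
    have nN2 : n.+1%:R^-1 <= e ^+ 2 / 2.
      rewrite -[leRHS]invrK lef_pV2 ?posrE ?invr_gt0// (le_trans (ltW (truncnS_gt _)))//.
      by rewrite ler_nat.
    by move: (n.+1%:R^-1) nN2 (sup _) sN1 => x xe y ye; lra.
  apply: le_trans re; rewrite -[leRHS]invrK lef_pV2 ?posrE ?invr_gt0//.
    by rewrite lerDl.
  by rewrite addr_gt0 ?invr_gt0.
Qed.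

(** Growing weights are called for only at p = 1, where coefficients must tend to 0; for p > 1 the
    weights are constant. *)
Lemma lp_summable_weights (E : normedModType K) (p : R) (x : nat -> E) : 1 <= p ->
  lp_summable p%:E x -> exists c : nat -> R, [/\ forall n, 1 <= c n,
    lp_summable p%:E (fun n => of_real (c n) *: x n) &
    p = 1 -> forall e, 0 < e -> exists N, forall n, (N <= n)%N -> (c n)^-1 <= e].
Proof.
move=> p1 xp; have [pE|pn] := eqVneq p 1; last first.
  exists (fun=> 1); split=> //; last by move=> pE; rewrite pE eqxx in pn.
  apply: (@lp_summable_le _ _ _ _ x 1); rewrite ?lee_fin// => n.
  by rewrite of_real1 scale1r mul1r.
have p1' : (1 <= p%:E)%E by rewrite lee_fin.
have /(lp_summableP _ p1')[A A0 xA] := xp.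
have finE (y : nat -> E) n : fin_lp_norm p%:E (fun i : 'I_n => rnorm (y i)) = \sum_(i < n) rnorm (y i).
  by rewrite pE fin_lp_norm1// => i; exact: rnorm_ge0.
have xA' n : \sum_(i < n) rnorm (x i) <= A by rewrite -(finE x).
have [c [c1 [B cB] c0]] := @slowly_growing_weights (fun n => rnorm (x n)) A
  (fun n => rnorm_ge0 _) xA'.
exists c; split=> //; apply/(lp_summableP _ p1').
have cn0 n : 0 <= c n by rewrite (le_trans ler01).
exists B => [|n]; first by have := cB 0%N; rewrite big_ord0.
rewrite (finE (fun n => of_real (c n) *: x n)); apply: le_trans (cB n).
by apply: ler_sum => i _; rewrite rnormZ rnorm_of_real ger0_norm.
Qed.

(** Weak summability bounds the initial sections for each psi separately. They are seminorms on the
    complete space [dual Y], so uniform boundedness gives one constant. *)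
Lemma weakly_summable_bounded (Y : normedModType K) (p : \bar R) (y : nat -> Y) :
  (1 <= p)%E -> weakly_lp_summable p y -> exists2 W : R, 0 < W &
  forall n (psi : dual Y), fin_lp_norm p (fun i : 'I_n => rnorm (psi (y i))) <= W * rnorm psi.
Proof.
move=> p1 yw.
pose N n (psi : dual Y) := fin_lp_norm p (fun i : 'I_n => rnorm (psi (y i))).
have [|||| W NW] := @uniform_boundedness R k (lop Y K^o) nat N.
- move=> n f g; apply: le_trans (fin_lp_normD p1 (fun i => rnorm_ge0 _) (fun i => rnorm_ge0 _)).
  by apply: fin_lp_norm_le => // i; rewrite rnorm_ge0 ler_rnormD.
- move=> n a f; rewrite -(fin_lp_normZ p1 (rnorm_ge0 _) (fun i : 'I_n => rnorm_ge0 (f (y i)))).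
  by congr fin_lp_norm; apply/funext => i; rewrite rnormZ.
- move=> n; exists (fin_lp_norm p (fun i : 'I_n => rnorm (y i))) => f.
  rewrite mulrC -(fin_lp_normZ p1 (rnorm_ge0 _) (fun i : 'I_n => rnorm_ge0 (y i))).
  by apply: fin_lp_norm_le => // i; rewrite rnorm_ge0 lop_le.
- move=> f; have /(lp_summableP _ p1)[C _ fC] := yw f.
  by exists C => n; exact: fC.
exists (`|W| + 1) => [|n f]; first by rewrite ltr_wpDl.
rewrite (le_trans (NW n f))// ler_wpM2r ?rnorm_ge0//.
by rewrite (le_trans (ler_norm _))// lerDl.
Qed.

(* Moving weights c_n from the coefficients to the vectors puts the coefficients
   in c_0, as p = 1 requires. *)
Theorem nuclear_dual_compact (m : nat) (E F : completeNormedModType K) (p : R) : 1 <= p ->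
  injective_hull (composition_ideal (nuclear_ideal p)) m E F `<=`
  polynomial_dual (compact_ideal p) m E F.
Proof.
move=> p1 P [G [Q [u [[Phi [y [Phi_lp y_weak uE]]] PQ]]]].
have p1' : (1 <= p%:E)%E by rewrite lee_fin.
have pq := conjugate_exponentsP p1'.
have q1 := conjugate_exponents_ge1 (conjugate_exponents_sym pq).
pose X : normedModType K := hpoly m E K^o.
have [W W0 yW] := weakly_summable_bounded q1 y_weak.
have yphi (phi : dual_ball F) n :
    fin_lp_norm (hoelder_conjugate p%:E) (fun i : 'I_n => rnorm (y i phi : K^o)) <= W.
  have e1 (f : linf R k (dual_ball F)) : rnorm (f phi : K^o) <= 1 * rnorm f.
    by rewrite mul1r linf_le.
  have [e eE] := @linear_lop R k (linf R k (dual_ball F)) K^o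
    (fun f => f phi) 1 (fun _ _ _ => erefl) e1.
  have -> : (fun i : 'I_n => rnorm (y i phi : K^o)) = fun i : 'I_n => rnorm (e (y i)).
    by apply/funext => i; rewrite eE.
  apply: (le_trans (yW n e)); rewrite ler_piMr ?(ltW W0)//.
  by apply: lop_rnorm_le => // f; rewrite eE.
pose r n : X := lop_hpoly (Phi n) Q.
have r_lp : lp_summable p%:E r.
  apply: (lp_summable_le p1' (rnorm_ge0 Q) _ Phi_lp) => n.
  by rewrite mulrC lop_hpoly_le.
have [c [c1 cr_lp c_infty]] := lp_summable_weights p1 r_lp.
have c0 n : 0 < c n by rewrite (lt_le_trans ltr01).
have KW0 (z : R) : 0 < z -> (of_real z : K) != 0.
  by move=> z0; rewrite -(@of_real0 R k) (inj_eq of_real_inj) gt_eqF.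
(* The coefficients will be y_n(phi) / (W c_n): W brings (y_n(phi))_n into the unit ball, where c_n
   >= 1 keeps it, and the growth of c_n gives convergence to 0 when p = 1. *)
exists (fun n => (of_real W : K) *: (of_real (c n) *: r n)).
  apply: (lp_summable_le p1' (ltW W0) _ cr_lp) => n.
  by rewrite [leLHS]rnormZ rnorm_of_real gtr0_norm.
move=> phi Bphi; pose phi' : dual_ball F := exist _ phi Bphi.
have al_le n : rnorm (y n phi' / (of_real (W * c n) : K) : K^o) =
    rnorm (y n phi' : K^o) / (W * c n).
  rewrite rnormM; congr (_ * _).
  have Wc : 0 < W * c n by rewrite mulr_gt0.
  have /eqP := rnormM (of_real (W * c n))^-1 (of_real (W * c n) : K).
  rewrite mulVf ?KW0// rnorm1 rnorm_of_real gtr0_norm// => /eqP H.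
  by apply: (mulIf (lt0r_neq0 Wc)); rewrite -H mulVf// lt0r_neq0.
exists (fun n => y n phi' / (of_real (W * c n) : K)).
  split.
    apply/(lp_norm_le _ q1 ler01) => n.
    apply: (@le_trans _ _ (fin_lp_norm (hoelder_conjugate p%:E)
      (fun i : 'I_n => W^-1 * rnorm (y i phi' : K^o)))).
      apply: fin_lp_norm_le => // i; rewrite rnorm_ge0 al_le mulrC ler_wpM2r ?rnorm_ge0//.
      by rewrite lef_pV2 ?posrE ?mulr_gt0// ler_peMr ?(ltW W0).
    rewrite fin_lp_normZ ?invr_ge0 ?(ltW W0)//; last by move=> i; exact: rnorm_ge0.
    by rewrite ler_pdivrMl// mulr1.
  move=> /c_infty cinf; apply: rcvg_cvg => e e0.
  have [N Nc] := cinf _ e0; exists N => // n /= Nn; rewrite subr0 al_le.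
  apply: le_trans (Nc _ Nn); rewrite invfM mulrA ler_piMl ?invr_ge0 ?(ltW (c0 n))//.
  rewrite ler_pdivrMr// mul1r; apply: le_trans (yphi phi' n.+1).
  exact: (@fin_lp_norm_coord R _ n.+1 (fun i => rnorm (y i phi' : K^o)) ord_max q1 (fun i => rnorm_ge0 _)).
have -> : (fun n => (y n phi' / of_real (W * c n)) *: (of_real W *: (of_real (c n) *: r n))) =
    fun n => y n phi' *: r n.
  apply/funext => n; by rewrite [of_real W *: _]scalerA -of_realM scalerA divfK// KW0// mulr_gt0.
apply: rcvg_cvg => e e0.
(* Convergence in X must be uniform on the unit ball of E, whereas the nuclear series converges for
   each x. The tail estimate for the scalar sequence y_n(phi) provides the uniformity. *)
have synth : synthesis_bound p (fun n => y n phi' : K^o) W.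
  move=> n b; rewrite (le_trans (rnorm_sum _))//.
  apply: (@le_trans _ _ (\sum_(i < n) rnorm (b i) * rnorm (y i phi' : K^o))).
    by apply: ler_sum => i _; rewrite rnormZ.
  apply: (le_trans (@fin_hoelder R _ _ n (fun i => rnorm (b i)) (fun i => rnorm (y i phi' : K^o)) pq
     (fun i => rnorm_ge0 _) (fun i => rnorm_ge0 _))).
  by rewrite mulrC ler_wpM2r ?fin_lp_norm_ge0.
(* The tail estimate is used twice, from the n-th partial sum to the N-th and from there to the
   limit; the 1 keeps M positive. *)
pose M := 2 * (W * rnorm Q) + 1.
have M0 : 0 < M by rewrite ltr_wpDl// mulr_ge0// mulr_ge0 ?(ltW W0) ?rnorm_ge0.
have eM : 0 < e / M by rewrite divr_gt0.
have [N tailN] := synthesis_tail_le pq Phi_lp (ltW W0) synth eM.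
pose Sx x n : K^o := series (fun i => Phi i x *: (y i phi' : K^o)) n.
exists N => // n /= Nn; rewrite rnorm_hpoly; apply: sup_norm_le => [|x Bx]; first exact: ltW.
have -> : (series (fun n0 => y n0 phi' *: r n0) n - hpoly_adjoint P phi) x = Sx (Q x) n - phi (P x).
  rewrite -[LHS]/(series (fun n0 => y n0 phi' *: r n0) n x - phi (P x)); congr (_ - _).
  rewrite /Sx /series /= !big_mkord hpoly_sumE; apply: eq_bigr => i _.
  by rewrite -[LHS]/(y i phi' * Phi i (Q x)) mulrC.
have Sx_cvg : rcvg \oo (Sx (Q x)) (phi (P x)).
  have -> : phi (P x) = u (Q x) phi'.
    by rewrite -[LHS]/((lop_hpoly (linf_embedding F) P x : linf R k (dual_ball F)) phi') PQ.
  have ysumE n' (b : 'I_n' -> K) : (\sum_(i < n') b i *: y i : linf R k (dual_ball F)) phi' =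
      \sum_(i < n') b i *: (y i phi' : K^o) :> K^o.
    by elim/big_ind2 : _ => // _ f _ g <- <-.
  have c2 := cvg_rcvg eventually_filter (uE (Q x)).
  move=> d d0; apply: filterS (c2 _ d0) => j /= cj; apply: le_trans cj.
  have -> : Sx (Q x) j - u (Q x) phi' = (series (fun i => Phi i (Q x) *: y i) j - u (Q x)) phi'.
    rewrite -[RHS]/(series (fun i => Phi i (Q x) *: y i) j phi' - u (Q x) phi'); congr (_ - _).
    rewrite /Sx /series /= !big_mkord; symmetry; exact: ysumE.
  exact: linf_le.
have Qx : rnorm (Q x) <= rnorm Q.
  by rewrite rnorm_hpoly; apply: sup_norm_ub => //; exact: hpoly_bounded.
pose D := W * (rnorm (Q x) * (e / M)).
have SN : rnorm (Sx (Q x) N - phi (P x)) <= D.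
  have lim : rcvg \oo (fun j => Sx (Q x) j - Sx (Q x) N) (phi (P x) - Sx (Q x) N).
    move=> d /Sx_cvg; apply: filterS => j /=; congr (rnorm _ <= _).
    by rewrite opprB addrA subrK.
  rewrite -rnormN opprB; apply: (rcvg_le _ lim).
  by exists N => // j /= Nj; exact: tailN.
rewrite (le_trans (rdist_le _ _ (Sx (Q x) N)))// -(rnormN (phi (P x) - _)) opprB.
apply: (@le_trans _ _ (D + D)); first by rewrite lerD// tailN.
have -> : D + D = (2 * (W * rnorm (Q x))) / M * e by rewrite /D; ring.
rewrite ler_piMl ?(ltW e0)// ler_pdivrMr// mul1r /M.
by rewrite (le_trans (y := 2 * (W * rnorm Q)))// ?lerDl// !ler_wpM2l ?(ltW W0).
Qed.

End CompactNuclear.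

(** * The equalities for p-compact and for Cohen strongly summing adjoints *)

Theorem corollary3p9 (R : realType) (k : scalar_kind) :
  (forall p : R, 1 <= p ->
   forall (m : nat) (E F : completeNormedModType (scalars R k)),
     polynomial_dual (compact_ideal p) m E F =
     injective_hull (composition_ideal (nuclear_ideal p)) m E F) /\
  (forall (p : \bar R) (q : R), (1 < p)%E -> (p^-1 + (q%:E)^-1 = 1)%E ->
   forall (m : nat) (E F : completeNormedModType (scalars R k)),
     polynomial_dual (cohen_ideal p) m E F =
     injective_hull (composition_ideal (integral_ideal q)) m E F).
Proof.
split=> [p p1|p q p1 pqE] m E F; apply/seteqP.
  by split; [exact: compact_dual_nuclear|exact: nuclear_dual_compact].
have pq : conjugate_exponents p q%:E.
  have [pNy p0] : (-oo < p)%E /\ p != 0%E.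
    by split; [exact: lt_trans (ltNyr 1) p1|rewrite gt_eqF// (lt_trans lte01)].
  have -> : q%:E = hoelder_conjugate p by apply/(hoelder_conjugateP q%:E pNy p0).
  exact: conjugate_exponentsP (ltW p1).
by split; [exact: cohen_dual_integral|exact: integral_dual_cohen].
Qed.
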